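(* Let $M$ be a supermanifold, let $\lambda\in\mathbb R$, $\lambda\neq 1$. Every derivation $\boldsymbol X$ of weight $\lambda$ of the algebra of densities $\mathfrak V(M)$ can be uniquely decomposed into the sum of a divergence-free derivation (of weight $\lambda$) and a derivation of the form $t^{\lambda}f(x)\,\hat w$. Every divergence-free derivation of weight $\lambda$ has the form $$\boldsymbol X=t^{\lambda}\Bigl(X^a(x)\,\partial_a-\tfrac{1}{\lambda-1}\,\partial_aX^a\,(-1)^{\tilde a(\tilde X+1)}\,\hat w\Bigr)$$ and is uniquely defined by the vector density $X=(Dx)^{\lambda}X^a\,\partial_a$ on $M$. For a general derivation $\boldsymbol X=t^{\lambda}(X^a(x)\partial_a+X_0(x)\hat w)$ of weight $\lambda$, the decomposition is $$\boldsymbol X=t^{\lambda}\Bigl(X^a(x)\,\partial_a-\tfrac{1}{\lambda-1}\,\partial_aX^a\,(-1)^{\tilde a(\tilde X+1)}\,\hat w\Bigr)+\tfrac{1}{\lambda-1}\,(\operatorname{div}\boldsymbol X)\,\hat w ,$$ where the first summand is the divergence-free part.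
   Context: Let $M$ be a supermanifold (an ordinary manifold is allowed) with local coordinates $x^a$ of parity $\tilde a$; $\partial_a=\partial/\partial x^a$; a tilde denotes parity; the atlas is such that all Jacobians (Berezinians) $J=Dx'/Dx$ are positive. A density of weight $w\in\mathbb R$ is locally $\psi(x)(Dx)^w$, where $Dx$ is the coordinate volume element. The algebra of densities $\mathfrak V(M)$ consists of finite formal sums of densities of arbitrary real weights, with the tensor product as multiplication. Densities are identified with functions on $\hat M=(\operatorname{Ber}TM)\setminus M$ with local coordinates $x^a,t$, where $t$ corresponds to $Dx$: $\sum_w\psi_w(x)(Dx)^w\leftrightarrow\sum_w\psi_w(x)t^w$. The weight operator is $\hat w=t\,\partial/\partial t$. Derivations of $\mathfrak V(M)$ are understood as vector fields on $\hat M$; one of weight $\lambda$ (raising weights by $\lambda$) has locally the form $\boldsymbol X=t^{\lambda}(X^a(x)\partial_a+X_0(x)\hat w)$; $\tilde X$ denotes its parity. Under a coordinate change $X^{a'}=J^{-\lambda}X^a\,\partial x^{a'}/\partial x^a$, $X_0'=J^{-\lambda}(X_0+X^a\partial_a\log J)$; in particular $X=(Dx)^\lambda X^a\partial_a$ is a vector density of weight $\lambda$ on $M$ (the restriction of $\boldsymbol X$ to functions on $M$). The scalar product on $\mathfrak V(M)$ is $\langle\boldsymbol\psi,\boldsymbol\chi\rangle=\int_M\psi\chi\,Dx$ if the weights add up to $1$ and zero otherwise. The canonical divergence of a derivation is $\operatorname{div}\boldsymbol X=-(\boldsymbol X+\boldsymbol X^* )$, where $\boldsymbol X^*$ is the formal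 adjoint with respect to this scalar product; explicitly $$\operatorname{div}\boldsymbol X=t^{\lambda}\bigl(\partial_aX^a(-1)^{\tilde a(\tilde X+1)}+(\lambda-1)X_0\bigr).$$ Divergence-free means $\operatorname{div}\boldsymbol X=0$. *)

(* Defs.v *)
From HB Require Import structures.
From mathcomp Require Import all_boot all_order all_algebra.
From mathcomp Require Import ring.

Set Implicit Arguments.
Unset Strict Implicit.
Unset Printing Implicit Defensive.
Import Order.TTheory GRing.Theory Num.Theory.
Local Open Scope ring_scope.

Section GrassmannAlgebra.
Variables (R : comNzRingType) (m : nat).

(* The exterior algebra on m odd generators, with a S the coefficient in a of
   the ordered monomial xi_S = \prod_(j in S) xi_j (j increasing).  The alias
   is there because {ffun _ -> _} carries the pointwise product. *)
Definition grassmann := {ffun {set 'I_m} -> R^o}.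

HB.instance Definition _ := GRing.Lmodule.on grassmann.

Definition ginversions (A B : {set 'I_m}) : nat :=
  (\sum_(i in A) \sum_(j in B) (j < i))%N.

(* xi_A * xi_B = gsign A B *: xi_(A :|: B) *)
Definition gsign (A B : {set 'I_m}) : R :=
  if [disjoint A & B] then (-1) ^+ ginversions A B else 0.

Definition gone : grassmann := [ffun S => (S == set0)%:R].

Definition gmul (a b : grassmann) : grassmann :=
  [ffun S => \sum_A \sum_(B | A :|: B == S) gsign A B * (a A * b B)].

Lemma ginversionsUl (A B C : {set 'I_m}) : [disjoint A & B] ->
  ginversions (A :|: B) C = (ginversions A C + ginversions B C)%N.
Proof.
move=> AB; rewrite /ginversions -bigU//=.
by apply: eq_bigl => i; rewrite !inE.
Qed.

Lemma ginversionsUr (A B C : {set 'I_m}) : [disjoint B & C] ->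
  ginversions A (B :|: C) = (ginversions A B + ginversions A C)%N.
Proof.
move=> BC; rewrite /ginversions -big_split; apply: eq_bigr => i _ /=.
by rewrite -bigU//=; apply: eq_bigl => j; rewrite !inE.
Qed.

Lemma gsign_cocycle (A B C : {set 'I_m}) :
  gsign (A :|: B) C * gsign A B = gsign A (B :|: C) * gsign B C.
Proof.
have UlD (X Y Z : {set 'I_m}) :
    [disjoint X :|: Y & Z] = [disjoint X & Z] && [disjoint Y & Z].
  by rewrite -!setI_eq0 setIUl setU_eq0.
have UrD (X Y Z : {set 'I_m}) :
    [disjoint X & Y :|: Z] = [disjoint X & Y] && [disjoint X & Z].
  by rewrite -!setI_eq0 setIUr setU_eq0.
rewrite /gsign UlD UrD.
have [AB|_] := boolP [disjoint A & B]; have [BC|_] := boolP [disjoint B & C];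
  rewrite ?(andbT, andbF, mulr0, mul0r) //=.
case: ifP => _; last by rewrite !mul0r.
rewrite -!exprD ginversionsUl// ginversionsUr//; congr (_ ^+ _); rewrite [LHS]addnC [LHS]addnA; done.
Qed.

Lemma big_setU_fibre (V : nmodType) (H : {set 'I_m} -> {set 'I_m} -> {set 'I_m} -> V) :
  \sum_D \sum_A \sum_(B | A :|: B == D) H D A B = \sum_A \sum_B H (A :|: B) A B.
Proof.
rewrite exchange_big; apply: eq_bigr => A _.
rewrite (exchange_big_dep xpredT)//=; apply: eq_bigr => B _.
by rewrite (big_pred1 (A :|: B))// => D; rewrite eq_sym.
Qed.

Lemma gmulA : associative gmul.
Proof.
move=> a b c; apply/ffunP => S; rewrite !ffunE.
transitivity (\sum_A \sum_B \sum_(C | A :|: B :|: C == S)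
    gsign (A :|: B) C * gsign A B * (a A * b B * c C)); last first.
  under [RHS]eq_bigr => D _.
    under eq_bigr => C _.
      rewrite ffunE mulr_suml mulr_sumr.
      under eq_bigr => A _ do rewrite mulr_suml mulr_sumr.
      over.
    rewrite exchange_big /=.
    under eq_bigr => A _ do rewrite exchange_big /=.
    over.
  rewrite (big_setU_fibre (fun D A B => \sum_(C | D :|: C == S)
    gsign D C * (gsign A B * (a A * b B) * c C))).
  by do 3!apply: eq_bigr => ? _; rewrite !mulrA.
apply: eq_bigr => A _.
under eq_bigr => D _.
  rewrite ffunE mulr_sumr mulr_sumr.
  under eq_bigr => B _ do rewrite mulr_sumr mulr_sumr.
  over.
rewrite big_mkcond /=.
transitivity (\sum_D \sum_B \sum_(C | B :|: C == D)
  (if A :|: D == S then gsign A D * (a A * (gsign B C * (b B * c C))) else 0)).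
  apply: eq_bigr => D _; case: ifP => // _.
  by rewrite big1 // => B _; rewrite big1.
rewrite (big_setU_fibre (fun D B C => if A :|: D == S then gsign A D * (a A * (gsign B C * (b B * c C))) else 0)).
apply: eq_bigr => B _; rewrite [RHS]big_mkcond /=; apply: eq_bigr => C _.
rewrite setUA; case: ifP => // _; rewrite gsign_cocycle; ring.
Qed.

Lemma ginversions0l A : ginversions set0 A = 0%N.
Proof. by rewrite /ginversions big_set0. Qed.

Lemma ginversions0r A : ginversions A set0 = 0%N.
Proof. by rewrite /ginversions big1// => i _; rewrite big_set0. Qed.

Lemma gmul1l : left_id gone gmul.
Proof.
move=> a; apply/ffunP => S; rewrite ffunE (bigD1 set0)//= [X in _ + X]big1.
  rewrite addr0 (big_pred1 S) => [|B]; last by rewrite set0U.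
  by rewrite ffunE eqxx mul1r /gsign -setI_eq0 set0I eqxx ginversions0l mul1r.
by move=> A /negbTE A0; rewrite big1// => B _; rewrite ffunE A0 mul0r mulr0.
Qed.

Lemma gmul1r : right_id gone gmul.
Proof.
move=> a; apply/ffunP => S; rewrite ffunE.
rewrite (bigD1 S)//= [X in _ + X]big1.
  rewrite addr0 (bigD1 set0) ?setU0//= big1 => [|B /andP[_ /negbTE B0]].
    by rewrite addr0 ffunE eqxx mulr1 /gsign -setI_eq0 setI0 eqxx ginversions0r mul1r.
  by rewrite ffunE B0 !mulr0.
move=> A AS; rewrite big1// => B /eqP ABS; rewrite ffunE; case: eqP => [B0|_].
  by move: AS; rewrite -ABS B0 setU0 eqxx.
by rewrite !mulr0.
Qed.

Lemma gmulDl : left_distributive gmul +%R.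
Proof.
move=> a b c; apply/ffunP => S; rewrite !ffunE -big_split; apply: eq_bigr => A _.
by rewrite -big_split; apply: eq_bigr => B _ /=; rewrite ffunE mulrDl mulrDr.
Qed.

Lemma gmulDr : right_distributive gmul +%R.
Proof.
move=> a b c; apply/ffunP => S; rewrite !ffunE -big_split; apply: eq_bigr => A _.
by rewrite -big_split; apply: eq_bigr => B _ /=; rewrite ffunE !mulrDr.
Qed.

Lemma gone_neq0 : gone != 0.
Proof. by apply/eqP => /ffunP/(_ set0)/eqP; rewrite !ffunE eqxx oner_eq0. Qed.

HB.instance Definition _ := GRing.Zmodule_isNzRing.Build grassmann
  gmulA gmul1l gmul1r gmulDl gmulDr gone_neq0.

Lemma gscaleAl (k : R) (a b : grassmann) : k *: (a * b) = (k *: a) * b.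
Proof.
apply/ffunP => S; rewrite !ffunE [LHS]mulr_sumr; apply: eq_bigr => A _.
rewrite mulr_sumr; apply: eq_bigr => B _; rewrite ffunE /GRing.scale /=; ring.
Qed.

Lemma gscaleAr (k : R) (a b : grassmann) : k *: (a * b) = a * (k *: b).
Proof.
apply/ffunP => S; rewrite !ffunE [LHS]mulr_sumr; apply: eq_bigr => A _.
rewrite mulr_sumr; apply: eq_bigr => B _; rewrite ffunE /GRing.scale /=; ring.
Qed.

HB.instance Definition _ := GRing.Lmodule_isLalgebra.Build R grassmann gscaleAl.
HB.instance Definition _ := GRing.Lalgebra_isAlgebra.Build R grassmann gscaleAr.

Definition ggen (j : 'I_m) : grassmann := [ffun S => (S == [set j])%:R].

(* left derivative with respect to xi_j *)
Definition gderiv (j : 'I_m) (a : grassmann) : grassmann :=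
  [ffun S : {set 'I_m} => if j \in S then 0
     else (-1) ^+ #|[set i in S | (i < j)%N]| * a (j |: S)].

Definition gparity (q : bool) (a : grassmann) : Prop :=
  forall S : {set 'I_m}, odd #|S| != q -> a S = 0.

Definition gbody (a : grassmann) : R := a set0.

Definition gsoul (a : grassmann) : grassmann := a - (gbody a)%:A.

End GrassmannAlgebra.

From mathcomp Require Import all_classical all_reals all_analysis.
Import numFieldNormedType.Exports.
Local Open Scope classical_set_scope.

Section SuperDomain.
Variables (R : realType) (n m : nat).

(* A superfunction f(x, xi) on R^n|m, as a Grassmann-valued function of x;
   it is only meaningful on some open subset of R^n. *)
Definition superfun := 'rV[R]_n -> grassmann R m.

Fixpoint partials (s : seq 'I_n) (g : 'rV[R]_n -> R^o) : 'rV[R]_n -> R^o :=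
  if s is i :: s' then fun x => 'D_(delta_mx 0 i) (partials s' g) x else g.

(* C^oo on the open set V *)
Definition smooth (V : set 'rV[R]_n) (f : superfun) : Prop :=
  forall (S : {set 'I_m}) (s : seq 'I_n) x, V x ->
    differentiable (partials s (fun y => f y S)) x.

(* The coordinates x^a are indexed by 'I_(n + m), even ones first. *)
Definition par (a : 'I_(n + m)) : bool := (n <= a)%N.

Definition scoord (a : 'I_(n + m)) : superfun := fun x =>
  match fintype.split a with
  | inl i => (x 0 i)%:A
  | inr j => ggen R j
  end.

Definition sderiv (a : 'I_(n + m)) (f : superfun) : superfun := fun x =>
  match fintype.split a with
  | inl i => [ffun S => partials [:: i] (fun y => f y S) x]
  | inr j => gderiv j (f x)
  end.

(* F(a) for a smooth real function F and an even a: the Taylor expansion at the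
   body of a, which is finite since the soul is nilpotent. *)
Definition gapply (F : R -> R) (a : grassmann R m) : grassmann R m :=
  \sum_(k < m.+1) (derive1n k F (gbody a) / k`!%:R) *: gsoul a ^+ k.

(* f(y, eta) where the arguments y^1,..,y^n (even) and eta^1,..,eta^m (odd) are
   the values at x of the components of Phi. *)
Definition pullback (Phi : 'I_(n + m) -> superfun) (f : superfun) : superfun :=
  fun x =>
    let y i := Phi (lshift m i) x in
    let eta j := Phi (rshift n j) x in
    \sum_(S : {set 'I_m})
      (\sum_(k < m.+1) \sum_(s : k.-tuple 'I_n)
         (partials s (fun z => f z S) (\row_i gbody (y i)) / k`!%:R)
           *: \prod_(i <- s) gsoul (y i))
      * \prod_(j in S) eta j.

(* Row a, column a': d x^a' / d x^a *)
Definition jacobi (Phi : 'I_(n + m) -> superfun) (x : 'rV[R]_n) :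
    'M[grassmann R m]_(n + m) :=
  \matrix_(a, a') sderiv a (Phi a') x.

(* Meant for even supermatrices with det A11 invertible; the entries of the
   diagonal blocks are then even, hence commute. *)
Definition berezinian (A : 'M[grassmann R m]_(n + m)) : grassmann R m :=
  let A00 := ulsubmx A in let A01 := ursubmx A in
  let A10 := dlsubmx A in let A11 := drsubmx A in
  let d := gapply GRing.inv (\det A11) in
  \det (A00 - A01 *m (d *: \adj A11) *m A10) * d.

Fixpoint Rn_integral (k : nat) : ('rV[R]_k -> R) -> R :=
  match k with
  | 0 => fun g => g 0
  | k'.+1 => fun g =>
      \int[lebesgue_measure]_t
         Rn_integral (fun v : 'rV[R]_k' => g (row_mx (t%:M : 'rV[R]_1) v))
  end.

(* The Berezin integral, normalised by \int xi_1 ... xi_m D(xi) = 1. *)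
Definition berezin_integral (f : superfun) : R :=
  Rn_integral (fun x => f x [set: 'I_m]%SET).

Definition test_superfun (V : set 'rV[R]_n) (f : superfun) : Prop :=
  smooth V f /\
  exists K, [/\ compact K, K `<=` V & forall x, ~ K x -> f x = 0].

(* Scalar product of psi (Dx)^w and chi (Dx)^w' *)
Definition scalar_product (w : R) (psi : superfun) (w' : R) (chi : superfun) : R :=
  if w + w' == 1 then berezin_integral (fun x => psi x * chi x) else 0.

End SuperDomain.

Record superatlas (R : realType) (n m : nat) := SuperAtlas {
  carrier : topologicalType;
  chart : Type;
  dom : chart -> set carrier;
  coord : chart -> carrier -> 'rV[R]_n;
  param : chart -> 'rV[R]_n -> carrier;
  (* trans c d a' = x^a', the a'-th coordinate of chart d as a function of the
     coordinates of chart c *)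
  trans : chart -> chart -> 'I_(n + m) -> superfun R n m
}.

Definition image_of R n m (M : superatlas R n m) (c : chart M) : set 'rV[R]_n :=
  @coord _ _ _ M c @` dom c.

Definition overlap R n m (M : superatlas R n m) (c d : chart M) : set 'rV[R]_n :=
  @coord _ _ _ M c @` (dom c `&` dom d).

(* J = Dx' / Dx *)
Definition jac R n m (M : superatlas R n m) (c d : chart M) : superfun R n m :=
  fun x => berezinian (jacobi (@trans _ _ _ M c d) x).

Record supermanifold (R : realType) (n m : nat) := Supermanifold {
  atlas :> superatlas R n m;
  carrier_hausdorff : hausdorff_space (carrier atlas);
  carrier_second_countable : @second_countable (carrier atlas);
  dom_open : forall c : chart atlas, open (dom c);
  dom_cover : forall p : carrier atlas, exists c : chart atlas, dom c p;
  image_open : forall c : chart atlas, open (image_of c);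
  coordK : forall (c : chart atlas) p, dom c p -> param c (coord c p) = p;
  coord_continuous : forall c : chart atlas, {within dom c, continuous (coord c)};
  param_continuous : forall c : chart atlas,
    {within image_of c, continuous (@param _ _ _ atlas c)};
  trans_smooth : forall (c d : chart atlas) a, smooth (overlap c d) (trans c d a);
  trans_parity : forall (c d : chart atlas) a x, overlap c d x ->
    gparity (par a) (trans c d a x);
  trans_body : forall (c d : chart atlas) p i, dom c p -> dom d p ->
    gbody (trans c d (lshift m i) (coord c p)) = coord d p 0 i;
  trans_id : forall (c : chart atlas) a x, image_of c x ->
    trans c c a x = scoord a x;
  trans_cocycle : forall (c d e : chart atlas) a p,
    dom c p -> dom d p -> dom e p ->
    pullback (trans c d) (trans d e a) (coord c p) = trans c e a (coord c p);
  jac_positive : forall (c d : chart atlas) x, overlap c d x -> 0 < gbody (jac c d x)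
}.

Section Densities.
Variables (R : realType) (n m : nat) (M : supermanifold R n m).
Notation SF := (superfun R n m).

(* J ^ w *)
Definition jacX (c d : chart M) (w : R) : SF :=
  fun x => gapply (fun s => s `^ w) (jac c d x).

Definition log_jac (c d : chart M) : SF := fun x => gapply (@ln R) (jac c d x).

(* The family psi c (Dx_c)^w, of parity q, defines a density of weight w. *)
Definition is_density (w : R) (q : bool) (psi : chart M -> SF) : Prop :=
  [/\ forall c, smooth (image_of c) (psi c),
      forall c x, image_of c x -> gparity q (psi c x) &
      forall c d x, overlap c d x ->
        pullback (trans c d) (psi d) x = jacX c d (- w) x * psi c x].

(* (Dx)^lam X^a d_a is a vector density of weight lam and parity p. *)
Definition is_vector_density (lam : R) (p : bool)
    (X : chart M -> 'I_(n + m) -> SF) : Prop :=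
  [/\ forall c a, smooth (image_of c) (X c a),
      forall c a x, image_of c x -> gparity (par a (+) p) (X c a x) &
      forall c d a' x, overlap c d x ->
        pullback (trans c d) (X d a') x =
        jacX c d (- lam) x * \sum_a X c a x * sderiv a (trans c d a') x].

(* Components of a vector field t^lam (X^a d_a + X_0 w^) in each chart. *)
Record vfield := VField {
  vcoef : chart M -> 'I_(n + m) -> SF;
  wcoef : chart M -> SF
}.

(* Derivations of weight lam and parity p of the algebra of densities,
   understood as vector fields on the complement of the zero section of Ber TM:
   abstract derivations of finite sums of real-weight densities need not be
   R-linear in the weight.  The components transform as those of
   t^lam (X^a d_a + X_0 w^) under x' = x'(x), t' = J t. *)
Definition is_derivation (lam : R) (p : bool) (X : vfield) : Prop :=
  [/\ is_vector_density lam p (vcoef X),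
      forall c, smooth (image_of c) (wcoef X c),
      forall c x, image_of c x -> gparity p (wcoef X c x) &
      forall c d x, overlap c d x ->
        pullback (trans c d) (wcoef X d) x =
        jacX c d (- lam) x *
          (wcoef X c x + \sum_a vcoef X c a x * sderiv a (log_jac c d) x)].

Definition vfield_eq (X Y : vfield) : Prop :=
  forall c x, image_of c x ->
    (forall a, vcoef X c a x = vcoef Y c a x) /\ wcoef X c x = wcoef Y c x.

Definition vfield_add (X Y : vfield) : vfield :=
  VField (fun c a x => vcoef X c a x + vcoef Y c a x)
         (fun c x => wcoef X c x + wcoef Y c x).

(* t^lam f w^ *)
Definition weight_field (f : chart M -> SF) : vfield := VField (fun _ _ _ => 0) f.

(* The coefficient of t^(w + lam) in X (psi t^w), in chart c *)
Definition action (X : vfield) (c : chart M) (w : R) (psi : SF) : SF :=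
  fun x => \sum_a vcoef X c a x * sderiv a psi x + w *: (wcoef X c x * psi x).

(* <L psi, chi> = (-1)^(L psi) <psi, L* chi>, where L and Ls send densities of
   weight w over chart c to densities of weight w + lam.  As usual for formal
   adjoints, the arguments are compactly supported (here, inside a chart). *)
Definition formal_adjoint (lam : R) (p : bool) (c : chart M)
    (L Ls : R -> SF -> SF) : Prop :=
  forall (w w' : R) (q : bool) (psi chi : SF),
    test_superfun (image_of c) psi -> test_superfun (image_of c) chi ->
    (forall x, gparity q (psi x)) ->
    scalar_product (w + lam) (L w psi) w' chi =
    (-1) ^+ (p && q) * scalar_product w psi (w' + lam) (Ls w' chi).

(* div X = D, i.e. - (X + X* ) is the multiplication by the density D. *)
Definition is_divergence (lam : R) (p : bool) (X : vfield) (D : chart M -> SF) : Prop :=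
  is_density lam p D /\
  forall c, exists2 Xs : R -> SF -> SF,
    formal_adjoint lam p c (action X c) Xs &
    forall w chi x, test_superfun (image_of c) chi -> image_of c x ->
      D c x * chi x = - (action X c w chi x + Xs w chi x).

Definition divergence_free (lam : R) (p : bool) (X : vfield) : Prop :=
  is_divergence lam p X (fun _ _ => 0).

(* d_a X^a (-1)^(a (X + 1)) *)
Definition coord_div (p : bool) (X : chart M -> 'I_(n + m) -> SF) : chart M -> SF :=
  fun c x => \sum_a (-1) ^+ (par a && ~~ p) *: sderiv a (X c a) x.

(* X^a d_a - 1/(lam - 1) d_a X^a (-1)^(a (X + 1)) w^ *)
Definition canonical_lift (lam : R) (p : bool)
    (X : chart M -> 'I_(n + m) -> SF) : vfield :=
  VField X (fun c x => - (lam - 1)^-1 *: coord_div p X c x).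

End Densities.

(* Main.v *)
Require Import Defs.
From HB Require Import structures.
From mathcomp Require Import all_boot all_order all_algebra perm.
From mathcomp Require Import ring lra.

(** In a chart, integration by parts computes the adjoint of a derivation
    X = t^lam (X^a d_a + X_0 w^): for compactly supported psi and chi the Berezin
    integral of each total derivative d_a (X^a psi chi) vanishes
    ([berezin_sderiv]), and the Leibniz rule turns the sum of these identities
    into - (X + X* ) = multiplication by d_a X^a (-1)^(a (X + 1)) + (lam - 1) X_0
    ([vfield_div_divergence]).  Two facts make this local computation a statement
    about the manifold.

    The expression is a density of weight lam.  When coordinates change, the
    chain rule for superfunctions ([sderiv_pullback]) and the contraction of the
    Jacobi matrix with its inverse leave d_a X^a up to two extra terms: the
    derivative of the factor J^(-lam), and the supertrace of the inverse Jacobi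
    matrix times its derivative.  The latter is the logarithmic derivative of the
    Berezinian ([sderiv_berezinian]), so that together they amount to
    - (lam - 1) X^a d_a log J ([pullback_divergence]).  The transformation law of
    X_0 contributes (lam - 1) X^a d_a log J, and the two cancel
    ([vfield_div_density]).

    The density is determined by the scalar product.  If D is another divergence
    of X, the difference of the two densities has zero pairing with all test
    functions; bump functions supported in a small box, multiplied by a
    Grassmann monomial that isolates one component, force it to vanish
    ([berezin_fundamental], [divergence_unique]).

    The theorem is then linear algebra.  Since div (t^lam f w^) = (lam - 1) f and
    lam <> 1, a derivation is divergence-free exactly when its weight component
    is - (lam - 1)^-1 d_a X^a (-1)^(a (X + 1)), and subtracting
    (lam - 1)^-1 (div X) w^ from X makes it so.  The same law
    [pullback_divergence] shows that the lift of a vector density by this weight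
    component is a derivation on the whole manifold
    ([canonical_lift_derivation]). *)

Set Implicit Arguments.
Unset Strict Implicit.
Unset Printing Implicit Defensive.
Import Order.TTheory GRing.Theory Num.Theory.
Local Open Scope ring_scope.

(** * The Grassmann algebra *)
Section Grassmann.
Variables (R : comNzRingType) (m : nat).
Local Notation G := (grassmann R m).
Implicit Types (A B S : {set 'I_m}) (a b c : G) (j : 'I_m).

Lemma signr_odd_eq (k l : nat) : odd k = odd l -> (-1) ^+ k = (-1) ^+ l :> R.
Proof. by move=> kl; rewrite -signr_odd kl signr_odd. Qed.

Lemma disjD A S : [disjoint A & S :\: A].
Proof. by rewrite -setI_eq0; apply/eqP/setP => k; rewrite !inE; case: (k \in A). Qed.

Lemma setDUK A S : A \subset S -> A :|: (S :\: A) = S.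
Proof. by move=> AS; rewrite -{1}(setIidPr AS) setID. Qed.

(** The definition sums over all pairs of subsets with a given union; only the
    disjoint ones contribute, so the second subset is a complement of the first. *)
Lemma gmulE a b S : (a * b) S =
  \sum_(A : {set 'I_m} | A \subset S)
    (-1) ^+ ginversions A (S :\: A) * (a A * b (S :\: A)).
Proof.
rewrite [LHS]ffunE [RHS]big_mkcond; apply: eq_bigr => A _.
case: ifPn => [AS|nAS]; last first.
  rewrite big1// => B /eqP ABS; case/negP: nAS; rewrite -ABS; exact: subsetUl.
rewrite (bigD1 (S :\: A)) ?setDUK//= /gsign disjD.
rewrite big1 ?addr0// => B /andP[/eqP ABS BSA].
case: ifPn => [dAB|_]; last by rewrite mul0r.
case/eqP: BSA; rewrite -ABS setDUl setDv set0U.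
by apply/esym/setDidPl; rewrite disjoint_sym.
Qed.

(** The subsets of j |: S come in pairs A, j |: A; this is how a derivative with
    respect to xi_j is compared with a product. *)
Lemma big_subset_setU1 (V : nmodType) j S (F : {set 'I_m} -> V) : j \notin S ->
  \sum_(A : {set 'I_m} | A \subset j |: S) F A =
  \sum_(A : {set 'I_m} | A \subset S) (F A + F (j |: A)).
Proof.
move=> jS; rewrite big_split/= (bigID (fun A : {set 'I_m} => j \in A))/= addrC; congr (_ + _).
  apply: eq_bigl => A; apply/andP/idP => [[AjS jA]|AS].
    by move: (subsetD1 A (j |: S) j); rewrite AjS jA setU1K.
  split; first by rewrite (subset_trans AS)// subsetUr.
  by apply: contra jS; exact: (fintype.subsetP AS).
rewrite (reindex_onto (fun A => j |: A) (fun A => A :\ j))/=; last first.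
  by move=> A /andP[_ jA]; rewrite setD1K.
apply: eq_bigl => A; rewrite setU11 andbT; apply/andP/idP => [[AjS /eqP AE]|AS].
  by rewrite -AE subDset.
have jA : j \notin A by apply: contra jS; exact: (fintype.subsetP AS).
by rewrite setUS//  setU1K.
Qed.

Definition nbelow j S : nat := #|[set i in S | (i < j)%N]|.

Lemma ginversions1l j S : ginversions [set j] S = nbelow j S.
Proof.
rewrite /ginversions big_set1 /nbelow -sum1dep_card big_mkcond/= [RHS]big_mkcond/=.
by apply: eq_bigr => i _; case: (i \in S); case: (i < j)%N.
Qed.

(** Every pair of elements of A and B is counted exactly once, which is the
    source of the sign rule. *)
Lemma ginversions_disj A B : [disjoint A & B] ->
  (ginversions A B + ginversions B A = #|A| * #|B|)%N.
Proof.
move=> dAB; rewrite /ginversions [X in (_ + X)%N]exchange_big -big_split/=.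
rewrite -sum_nat_const; apply: eq_bigr => i iA; rewrite -big_split/= -sum1_card.
apply: eq_bigr => k kB; case: ltngtP => // ik; move: (disjointFr dAB iA).
by rewrite -(val_inj ik : k = i) kB.
Qed.

Lemma ginversions1r j S : j \notin S ->
  odd (ginversions S [set j]) = odd #|S| (+) odd (nbelow j S).
Proof.
move=> jS; have := @ginversions_disj [set j] S; rewrite disjoints1 jS cards1 mul1n => /(_ isT) <-.
by rewrite ginversions1l oddD -addbA addbC addbK.
Qed.

Lemma nbelowU j A B : [disjoint A & B] -> nbelow j (A :|: B) = (nbelow j A + nbelow j B)%N.
Proof. by move=> dAB; rewrite -!ginversions1l ginversionsUr. Qed.

Lemma gderivE j a S :
  gderiv j a S = if j \in S then 0 else (-1) ^+ nbelow j S * a (j |: S).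
Proof. by rewrite ffunE. Qed.

(** The parity involution: it carries the sign that an odd operator picks up when
    it passes a factor. *)
Definition ginvol a : G := [ffun S : {set 'I_m} => (-1) ^+ #|S| * a S].

Lemma ginvolE a S : ginvol a S = (-1) ^+ #|S| * a S.
Proof. by rewrite ffunE. Qed.

Lemma gsubsetD j S A : j \notin S -> A \subset S ->
  [/\ j \notin A, j \notin S :\: A, (j |: S) :\: A = j |: (S :\: A),
     (j |: S) :\: (j |: A) = S :\: A & nbelow j S = (nbelow j A + nbelow j (S :\: A))%N].
Proof.
move=> jS AS.
have jA : j \notin A by apply: contra jS; exact: (fintype.subsetP AS).
split=> //; first by rewrite inE (negbTE jS) andbF.
  apply/setP => k; rewrite !inE; case: eqP => [->|]//=; by rewrite jA.
  apply/setP => k; rewrite !inE; case: eqP => [->|]//=; by rewrite (negbTE jS) andbF.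
by rewrite -nbelowU ?disjD// setDUK.
Qed.

(** Only the parity of the inversion counts matters; after expressing all of them
    through [nbelow] both sides agree because squares of signs are 1. *)
Lemma gderiv_mul j a b : gderiv j (a * b) = gderiv j a * b + ginvol a * gderiv j b.
Proof.
apply/ffunP => S; rewrite gderivE [RHS]ffunE; have [jS|jS] := boolP (j \in S).
  rewrite -(setD1K jS); set T := S :\ j; have jT : j \notin T by rewrite !inE eqxx.
  rewrite !gmulE !big_subset_setU1// -big_split big1//= => A AT.
  have [jA jTA -> -> _] := gsubsetD jT AT.
  rewrite !gderivE !ginvolE !setU11 (negbTE jA) (negbTE jTA) /= !(mulr0, mul0r) addr0 add0r.
  rewrite ginversionsUr ?disjoints1// ginversionsUl ?disjoints1//.
  rewrite ginversions1l !(exprD, mulrA) (signr_odd_eq (l := (#|A| + nbelow j A)%N)) ?oddD ?ginversions1r//.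
  rewrite cardsU1 jA !exprD.
  set x := (-1) ^+ ginversions _ _; set y := (-1) ^+ #|A|; set z := (-1) ^+ nbelow j A; set t := (-1) ^+ nbelow j _.
  have zz : z * z = 1 by rewrite -expr2 sqrr_sign.
  have tt : t * t = 1 by rewrite -expr2 sqrr_sign.
  transitivity (a (j |: A) * b (j |: (T :\: A)) * x * y * (z * z - t * t)); first by ring.
  by rewrite zz tt subrr mulr0.
rewrite !gmulE big_subset_setU1// big_distrr/= -big_split/=; apply: eq_bigr => A AS.
have [jA jTA -> -> nS] := gsubsetD jS AS.
rewrite !gderivE !ginvolE (negbTE jA) (negbTE jTA).
rewrite ginversionsUr ?disjoints1// ginversionsUl ?disjoints1//.
rewrite ginversions1l !(exprD, mulrA) (signr_odd_eq (k := ginversions A [set j]) (l := (#|A| + nbelow j A)%N)) ?oddD ?ginversions1r//.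
rewrite nS !exprD.
set x := (-1) ^+ ginversions _ _; set y := (-1) ^+ #|A|; set z := (-1) ^+ nbelow j A; set t := (-1) ^+ nbelow j _.
have zz : z * z = 1 by rewrite -expr2 sqrr_sign.
have tt : t * t = 1 by rewrite -expr2 sqrr_sign.
transitivity (a A * b (j |: (S :\: A)) * x * y * t * (z * z) + a (j |: A) * b (S :\: A) * x * z * (t * t)); first by ring.
by rewrite zz tt !mulr1; ring.
Qed.

Lemma ginvolM a b : ginvol (a * b) = ginvol a * ginvol b.
Proof.
apply/ffunP => S; rewrite ffunE !gmulE big_distrr/=; apply: eq_bigr => A AS.
rewrite !ffunE -[in #|S|](setDUK AS) cardsU (disjoint_setI0 (disjD A S)) cards0 subn0 exprD.
by ring.
Qed.

Lemma gderiv_is_linear j : linear (@gderiv R m j).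
Proof.
move=> k a b; apply/ffunP => S; rewrite !ffunE; case: ifP => _; first by rewrite scaler0 addr0.
by rewrite /GRing.scale/=; ring.
Qed.
HB.instance Definition _ j := GRing.isLinear.Build R G G _ (@gderiv R m j) (gderiv_is_linear j).

Lemma ginvol_is_linear : linear ginvol.
Proof. by move=> k a b; apply/ffunP => S; rewrite !ffunE /GRing.scale/=; ring. Qed.
HB.instance Definition _ := GRing.isLinear.Build R G G _ ginvol ginvol_is_linear.

Lemma ginvol1 : ginvol 1 = 1.
Proof.
apply/ffunP => S; rewrite !ffunE; case: eqP => [->|]; last by rewrite mulr0.
by rewrite cards0 mul1r.
Qed.

Lemma ginvol_is_monoid : monoid_morphism ginvol.
Proof. by split; [exact: ginvol1|exact: ginvolM]. Qed.
HB.instance Definition _ := GRing.isMonoidMorphism.Build G G ginvol ginvol_is_monoid.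

Lemma gparity_involE q a : gparity q a -> ginvol a = (-1) ^+ q *: a.
Proof.
move=> qa; apply/ffunP => S; rewrite !ffunE; have [<-|Sq] := eqVneq (odd #|S|) q.
  by rewrite signr_odd.
by rewrite (qa S Sq) mulr0 scaler0.
Qed.

Lemma gparity0 q : gparity q (0 : G).
Proof. by move=> S _; rewrite ffunE. Qed.

Lemma gparity1 : gparity false (1 : G).
Proof. by move=> S; rewrite ffunE; case: (S =P finset.set0) => [->|//]; rewrite cards0. Qed.

Lemma gparityD q a b : gparity q a -> gparity q b -> gparity q (a + b).
Proof. by move=> qa qb S Sq; rewrite ffunE qa// qb// addr0. Qed.

Lemma gparityZ q k a : gparity q a -> gparity q (k *: a).
Proof. by move=> qa S Sq; rewrite ffunE qa// scaler0. Qed.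

Lemma gparityN q a : gparity q a -> gparity q (- a).
Proof. by move=> qa S Sq; rewrite ffunE qa// oppr0. Qed.

Lemma gparityM q r a b : gparity q a -> gparity r b -> gparity (q (+) r) (a * b).
Proof.
move=> qa rb S Sqr; rewrite gmulE big1// => A AS.
have [Aq|Aq] := eqVneq (odd #|A|) q; last by rewrite qa// mul0r mulr0.
rewrite (rb (S :\: A)) ?mulr0//; apply: contra Sqr => /eqP <-.
by rewrite -[in #|S|](setDUK AS) cardsU (disjoint_setI0 (disjD A S)) cards0 subn0 oddD Aq.
Qed.

Lemma gparity_sum (I : Type) (r : seq I) (P : pred I) (F : I -> G) q :
  (forall i, P i -> gparity q (F i)) -> gparity q (\sum_(i <- r | P i) F i).
Proof.
by move=> h; elim/big_ind: _ => //; [exact: gparity0|move=> x y; exact: gparityD].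
Qed.

Lemma gparity_prod_even (I : Type) (r : seq I) (P : pred I) (F : I -> G) :
  (forall i, P i -> gparity false (F i)) -> gparity false (\prod_(i <- r | P i) F i).
Proof.
by move=> h; elim/big_ind: _ => //; [exact: gparity1|move=> x y; exact: gparityM].
Qed.

Lemma gparity_deriv q j a : gparity q a -> gparity (~~ q) (gderiv j a).
Proof.
move=> qa S Sq; rewrite ffunE; case: ifPn => // jS; rewrite qa ?mulr0//.
by rewrite cardsU1 jS oddD /=; case: (odd _) q Sq {qa} => -[].
Qed.

(** Exchanging A with its complement in S changes the number of inversions by
    #|A| * #|S :\: A|, whose parity is that of the product of the degrees. *)
Lemma gmulC q r a b : gparity q a -> gparity r b -> a * b = (-1) ^+ (q && r) *: (b * a).
Proof.
move=> qa rb; apply/ffunP => S; rewrite [RHS]ffunE !gmulE /GRing.scale/= big_distrr/=.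
rewrite (reindex_onto (fun A => S :\: A) (fun A => S :\: A))/=; last first.
  by move=> A AS; rewrite setDDr setDv set0U (setIidPr AS).
transitivity (\sum_(A : {set 'I_m} | A \subset S) (-1) ^+ ginversions (S :\: A) A * (a (S :\: A) * b A)).
  apply: eq_big => [A|A /andP[_ /eqP AE]]; last by rewrite AE.
  rewrite subsetDl/= setDDr setDv set0U; apply/eqP/idP => [<-|/setIidPr//].
  exact: subsetIl.
apply: eq_bigr => A AS.
have [Aq|Aq] := eqVneq (odd #|A|) r; last by rewrite rb// mul0r !mulr0.
have [Bq|Bq] := eqVneq (odd #|S :\: A|) q; last by rewrite qa// mul0r !mulr0.
have -> : (-1) ^+ ginversions (S :\: A) A = (-1) ^+ (q && r) * (-1) ^+ ginversions A (S :\: A) :> R.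
  rewrite -exprD; apply: signr_odd_eq; rewrite oddD oddb -Aq -Bq andbC -oddM -ginversions_disj ?disjD//.
  by rewrite oddD addbC addKb.
by ring.
Qed.

Lemma gevenC a b : gparity false a -> a * b = b * a.
Proof.
move=> ea; have -> : b = [ffun S : {set 'I_m} => if odd #|S| then b S else 0]
  + [ffun S : {set 'I_m} => if odd #|S| then 0 else b S].
  by apply/ffunP => S; rewrite !ffunE; case: ifP; rewrite ?addr0 ?add0r.
rewrite mulrDl mulrDr; congr (_ + _).
  by rewrite (@gmulC false true) ?scale1r// => S; rewrite ffunE; case: ifP.
by rewrite (@gmulC false false) ?scale1r// => S; rewrite ffunE; case: ifP.
Qed.

Lemma gbody_is_linear : linear_for *%R (@gbody R m).
Proof. by move=> k a b; rewrite /gbody !ffunE. Qed.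
HB.instance Definition _ := GRing.isLinear.Build R G R _ (@gbody R m) gbody_is_linear.

Lemma gbody_is_monoid : monoid_morphism (@gbody R m).
Proof.
split; first by rewrite /gbody ffunE eqxx.
move=> a b; rewrite /gbody gmulE (big_pred1 set0) => [|A]; last by rewrite subset0.
by rewrite setD0 ginversions0l mul1r.
Qed.
HB.instance Definition _ := GRing.isMonoidMorphism.Build G R (@gbody R m) gbody_is_monoid.

Lemma gparity_soul a : gparity false a -> gparity false (gsoul a).
Proof. by move=> ea; apply: gparityD => //; apply/gparityN/gparityZ/gparity1. Qed.

(** The k-th power of the ideal generated by the xi_j; it vanishes for k > m. *)
Definition gdeg_ge k a := forall S, (#|S| < k)%N -> a S = 0.

Lemma gdeg_geM k l a b : gdeg_ge k a -> gdeg_ge l b -> gdeg_ge (k + l) (a * b).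
Proof.
move=> ka lb S Skl; rewrite gmulE big1// => A AS.
have [Ak|kA] := ltnP #|A| k; first by rewrite ka// mul0r mulr0.
rewrite (lb (S :\: A)) ?mulr0//.
have := Skl; rewrite -[in #|S|](setDUK AS) cardsU (disjoint_setI0 (disjD A S)) cards0 subn0 => h.
by rewrite -(ltn_add2l k); apply: leq_ltn_trans h; rewrite leq_add2r.
Qed.

Lemma gdeg_ge_eq0 k a : (m < k)%N -> gdeg_ge k a -> a = 0.
Proof.
move=> mk ka; apply/ffunP => S; rewrite ffunE ka//; apply: leq_ltn_trans mk.
by rewrite -[X in (_ <= X)%N](card_ord m) max_card.
Qed.

(** The soul of an even element starts in degree 2, so that its k-th power
    vanishes as soon as 2 k > m. *)
Lemma gsoul_deg a : gparity false a -> gdeg_ge 2 (gsoul a).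
Proof.
move=> ea S; rewrite ltnS leq_eqVlt ltnS leqn0 => /orP[/eqP S1|].
  by apply: (gparity_soul ea); rewrite S1.
rewrite cards_eq0 => /eqP ->; rewrite /gsoul /gbody !ffunE eqxx.
by rewrite [_ *: _]mulr1 subrr.
Qed.

Lemma gdeg_ge_prod (I : Type) (r : seq I) (F : I -> G) :
  (forall i, gdeg_ge 2 (F i)) -> gdeg_ge (size r).*2 (\prod_(i <- r) F i).
Proof.
move=> h; elim: r => [|i r IH]; first by move=> S; rewrite ltn0.
by rewrite big_cons/= doubleS -addn2 addnC; apply: gdeg_geM.
Qed.

Definition geven : pred G := [pred a : G | [forall S : {set 'I_m}, odd #|S| ==> (a S == 0)]].

Lemma gevenP a : reflect (gparity false a) (geven a).
Proof.
apply: (iffP forallP) => [h S|h S]; first by rewrite eqbF_neg negbK => oS; have /implyP/(_ oS)/eqP := h S.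
by apply/implyP => oS; rewrite h// oS.
Qed.

Lemma geven_subring : subring_closed geven.
Proof.
split=> [|a b /gevenP ea /gevenP eb|a b /gevenP ea /gevenP eb]; apply/gevenP.
  exact: gparity1.
  exact/gparityD/gparityN.
exact: (@gparityM false false).
Qed.
HB.instance Definition _ := GRing.isSubringClosed.Build G geven geven_subring.

(** The even elements as a commutative ring, so that the theory of determinants
    and adjugates applies to even matrices. *)
Record geven_ring := GEven {geval :> G; _ : geven geval}.
HB.instance Definition _ := [isSub for geval].
HB.instance Definition _ := [Choice of geven_ring by <:].
HB.instance Definition _ := [SubChoice_isSubNzRing of geven_ring by <:].

Lemma geven_mulC : commutative (@GRing.mul geven_ring).
Proof. by move=> a b; apply: val_inj; rewrite !rmorphM/=; apply: gevenC; apply/gevenP; case: a. Qed.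
HB.instance Definition _ := GRing.PzRing_hasCommutativeMul.Build geven_ring geven_mulC.

End Grassmann.

Section EvenMatrices.
Variables (R : comNzRingType) (m : nat).
Local Notation G := (grassmann R m).

Definition gmx_even k l (A : 'M[G]_(k, l)) := forall i j, gparity false (A i j).

Lemma gmx_evenP k l (A : 'M[G]_(k, l)) : gmx_even A ->
  {A0 : 'M[geven_ring R m]_(k, l) | A = map_mx val A0}.
Proof.
move=> eA; have eA' i j : geven (A i j) by apply/gevenP.
by exists (\matrix_(i, j) GEven (eA' i j)); apply/matrixP => i j; rewrite !mxE.
Qed.

Lemma gval_even (a : geven_ring R m) : gparity false (val a).
Proof. by apply/gevenP; case: a. Qed.

Lemma gdet_even k (A : 'M[G]_k) : gmx_even A -> gparity false (\det A).
Proof. by case/gmx_evenP => A0 ->; rewrite det_map_mx; apply: gval_even. Qed.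

Lemma gadj_even k (A : 'M[G]_k) : gmx_even A -> gmx_even (\adj A).
Proof. by case/gmx_evenP => A0 -> i j; rewrite -map_mx_adj mxE; apply: gval_even. Qed.

Lemma gmul_mx_adj k (A : 'M[G]_k) : gmx_even A -> A *m \adj A = (\det A)%:M.
Proof. by case/gmx_evenP => A0 ->; rewrite -map_mx_adj -map_mxM mul_mx_adj map_scalar_mx det_map_mx. Qed.

Lemma gmul_adj_mx k (A : 'M[G]_k) : gmx_even A -> \adj A *m A = (\det A)%:M.
Proof. by case/gmx_evenP => A0 ->; rewrite -map_mx_adj -map_mxM mul_adj_mx map_scalar_mx det_map_mx. Qed.

(** Used to differentiate a determinant over the non-commutative algebra. *)
Lemma gexpand_cofactor k (A : 'M[G]_k) i j : gmx_even A ->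
  cofactor A i j =
  \sum_(s : 'S_k | s i == j) (-1) ^+ s * \prod_(l | i != l) A l (s l).
Proof.
case/gmx_evenP => A0 ->; rewrite cofactor_map_mx expand_cofactor rmorph_sum; apply: eq_bigr => s _.
rewrite rmorphM rmorph_sign rmorph_prod/=; congr (_ * _); apply: eq_bigr => l _; by rewrite mxE.
Qed.

End EvenMatrices.

From mathcomp Require Import all_classical all_reals all_analysis.
Import numFieldNormedType.Exports.
Local Open Scope classical_set_scope.
Local Open Scope ring_scope.

(** * Smooth functions of real variables *)
Section LocalDifferentiability.
Variables (R : realType) (U W : normedModType R).

Lemma near_eq_differentiable (f g : U -> W) x :
  {near x, f =1 g} -> differentiable f x -> differentiable g x.
Proof.
move=> fg df.
have E : g \o shift x = cst (g x) + 'd f x +o_ 0 id.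
  apply/eqaddoP => e e0; have /eqaddoP/(_ e e0) := diff_locally df.
  apply: filterS2; last first.
    have := fg; rewrite (near_shift 0)/= => h; move: h.
    by rewrite -[X in X -> _]/(\forall y \near 0, (fun z => f z = g z) (shift (x - 0) y)) => h; exact: h.
  move=> y /= fgy; rewrite !fctE /= -(nbhs_singleton fg).
  by rewrite subr0 in fgy; rewrite fgy.
have dg : 'd g x = 'd f x :> (U -> W) by apply: diff_unique E; exact: diff_continuous.
by apply/diff_locallyP; rewrite dg; split=> //; exact: diff_continuous.
Qed.

End LocalDifferentiability.

Section Partials.
Variables (R : realType) (n : nat).
Implicit Types (f g : 'rV[R]_n -> R^o) (V : set 'rV[R]_n) (s t : seq 'I_n).

Lemma partials_cat s t f : partials (s ++ t) f = partials s (partials t f).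
Proof. by elim: s => //= i s ->. Qed.

Lemma partials_rcons s i f : partials (rcons s i) f = partials s (partials [:: i] f).
Proof. by rewrite -cats1 partials_cat. Qed.

Lemma partials_local V f g s : open V -> (forall y, V y -> f y = g y) ->
  forall y, V y -> partials s f y = partials s g y.
Proof.
move=> oV fg; elim: s => //= i s IH y Vy; apply: near_eq_derive.
by near=> z; apply: IH; near: z; exact: open_nbhs_nbhs.
Unshelve. all: by end_near. Qed.

(** Differentiability up to order k: the closure of smooth functions under
    products is an induction on the order. *)
Definition Cdiff k V f := forall s x, (size s <= k)%N -> V x -> differentiable (partials s f) x.
Definition Csmooth V f := forall s x, V x -> differentiable (partials s f) x.

Lemma CsmoothP V f : Csmooth V f <-> forall k, Cdiff k V f.
Proof. by split=> [h k s x _|h s x]; [exact: h|exact: (h (size s))]. Qed.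

Lemma Csmooth_partials V f t : Csmooth V f -> Csmooth V (partials t f).
Proof. by move=> h s x Vx; rewrite -partials_cat; apply: h. Qed.

Lemma differentiable_eq_on V f g x : open V -> V x -> (forall y, V y -> f y = g y) ->
  differentiable f x -> differentiable g x.
Proof.
move=> oV Vx fg; apply: near_eq_differentiable; near=> y; apply: fg; near: y; exact: open_nbhs_nbhs.
Unshelve. all: by end_near. Qed.

Lemma Cdiff_local k V f g : open V -> (forall y, V y -> f y = g y) -> Cdiff k V f -> Cdiff k V g.
Proof.
move=> oV fg h s x sk Vx; apply: (differentiable_eq_on oV Vx _ (h s x sk Vx)) => y Vy.
exact: partials_local fg _ _.
Qed.

Lemma Cdiff_cst k V (c : R) : Cdiff k V (fun=> c).
Proof.
move=> s x _ _; suff [d ->] : exists d : R, partials s (fun=> c : R^o) = cst (d : R^o) by exact: differentiable_cst.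
elim: s => [|i s [d IH]]; first by exists c.
by exists 0; apply/funext => y; rewrite /= IH derive_cst.
Qed.

Lemma partialsD_Cdiff k V f g s x : open V -> Cdiff k V f -> Cdiff k V g ->
  (size s <= k.+1)%N -> V x -> partials s (fun y => f y + g y) x = partials s f x + partials s g x.
Proof.
move=> oV hf hg; elim: s x => //= i s IH x sk Vx.
rewrite -deriveD; [|exact/diff_derivable/hf|exact/diff_derivable/hg].
apply: near_eq_derive; near=> y; rewrite /= IH ?(ltnW sk)//; near: y; exact: open_nbhs_nbhs.
Unshelve. all: by end_near. Qed.

Lemma CdiffD k V f g : open V -> Cdiff k V f -> Cdiff k V g -> Cdiff k V (fun y => f y + g y).
Proof.
move=> oV hf hg s x sk Vx.
apply: (@differentiable_eq_on V (fun y => partials s f y + partials s g y)) => //.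
  by move=> y Vy; rewrite (partialsD_Cdiff oV hf hg)// ltnW.
exact: differentiableD (hf _ _ sk Vx) (hg _ _ sk Vx).
Qed.

(** By the Leibniz rule the first derivatives of f * g are built from functions of
    one order less; the innermost derivative is split off so that the induction
    hypothesis applies to them. *)
Lemma CdiffM k V f g : open V -> Cdiff k V f -> Cdiff k V g -> Cdiff k V (fun y => f y * g y).
Proof.
move=> oV; elim: k f g => [|k IH] f g hf hg.
  by move=> [|//] x _ Vx; apply: differentiableM; [exact: (hf [::])|exact: (hg [::])].
have hS h : Cdiff k.+1 V h -> Cdiff k V h by move=> hh s x sk; apply: hh; rewrite leqW.
have hP h i : Cdiff k.+1 V h -> Cdiff k V (partials [:: i] h).
  by move=> hh s x sk Vx; rewrite -partials_rcons; apply: hh => //; rewrite size_rcons.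
case/lastP => [|s i] x sk Vx; first by apply: differentiableM; [exact: (hf [::])|exact: (hg [::])].
rewrite partials_rcons; move: s x sk Vx => s x; rewrite size_rcons ltnS => sk Vx.
suff : Cdiff k V (partials [:: i] (fun y => f y * g y)) by apply.
apply: (@Cdiff_local _ V (fun y => f y * partials [:: i] g y + g y * partials [:: i] f y)) => //.
  by move=> y Vy /=; rewrite deriveM//; apply: diff_derivable; [exact: (hf [::])|exact: (hg [::])].
by apply: CdiffD => //; apply: IH => //; [exact: hS|exact: hP|exact: hS|exact: hP].
Qed.

Lemma CsmoothD V f g : open V -> Csmooth V f -> Csmooth V g -> Csmooth V (fun y => f y + g y).
Proof. by move=> oV /CsmoothP hf /CsmoothP hg; apply/CsmoothP => k; exact: CdiffD. Qed.

Lemma CsmoothM V f g : open V -> Csmooth V f -> Csmooth V g -> Csmooth V (fun y => f y * g y).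
Proof. by move=> oV /CsmoothP hf /CsmoothP hg; apply/CsmoothP => k; exact: CdiffM. Qed.

Lemma Csmooth_cst V (c : R) : Csmooth V (fun=> c).
Proof. by apply/CsmoothP => k; exact: Cdiff_cst. Qed.

Lemma Csmooth_local V f g : open V -> (forall y, V y -> f y = g y) -> Csmooth V f -> Csmooth V g.
Proof. by move=> oV fg /CsmoothP hf; apply/CsmoothP => k; exact: Cdiff_local (hf k). Qed.

Lemma CsmoothZ V (c : R) f : open V -> Csmooth V f -> Csmooth V (fun y => c * f y).
Proof. by move=> oV; apply: CsmoothM => //; exact: Csmooth_cst. Qed.

Lemma Csmooth_sum (I : Type) (r : seq I) (P : pred I) V (F : I -> 'rV[R]_n -> R^o) : open V ->
  (forall i, P i -> Csmooth V (F i)) -> Csmooth V (fun y => \sum_(i <- r | P i) F i y).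
Proof.
move=> oV h; elim: r => [|i r IH].
  by apply: Csmooth_local (Csmooth_cst 0) => // y _; rewrite big_nil.
case: (boolP (P i)) => Pi.
  by apply: Csmooth_local (CsmoothD oV (h i Pi) IH) => // y _; rewrite big_cons Pi.
by apply: Csmooth_local IH => // y _; rewrite big_cons (negbTE Pi).
Qed.

Lemma partialsD V f g s x : open V -> Csmooth V f -> Csmooth V g -> V x ->
  partials s (fun y => f y + g y) x = partials s f x + partials s g x.
Proof. by move=> oV /CsmoothP hf /CsmoothP hg Vx; rewrite (partialsD_Cdiff (k := size s) oV). Qed.

Lemma partialsZ V (c : R) f s x : open V -> Csmooth V f -> V x ->
  partials s (fun y => c * f y) x = c * partials s f x.
Proof.
move=> oV hf; elim: s x => //= i s IH x Vx.
rewrite -[RHS]deriveZ; last by apply: diff_derivable; apply: hf.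
apply: near_eq_derive; near=> y; rewrite /= IH//; near: y; exact: open_nbhs_nbhs.
Unshelve. all: by end_near. Qed.

Lemma partials0 s x : partials s (fun=> 0 : R^o) x = 0.
Proof.
elim: s x => //= i s IH x; rewrite (_ : partials s _ = cst 0) ?derive_cst//.
by apply/funext => y; rewrite IH.
Qed.

End Partials.

Section Schwarz.
Variables (R : realType) (U : normedModType R).
Implicit Types (f : U -> R^o) (x u v : U).

Lemma is_derive_line f x u (s : R) : derivable f (s *: u + x) u ->
  is_derive s 1 (fun t : R => f (t *: u + x)) ('D_u f (s *: u + x)).
Proof.
have E : (fun h : R => h^-1 *: (f ((h *: 1 + s) *: u + x) - f (s *: u + x))) =
         (fun h : R => h^-1 *: (f (h *: u + (s *: u + x)) - f (s *: u + x))).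
  by apply/funext => h; rewrite addrA -scalerDl [h *: 1]mulr1.
by move=> df; split; rewrite /derivable /derive /= E.
Qed.

(** The mean value theorem in direction u expresses the second difference of f
    through 'D_u f at two points on parallel segments; differentiability of
    'D_u f at x then gives the second-order estimate. *)
Lemma second_difference f x u v V (e : R) : open V -> V x -> 0 < e ->
  (forall y, V y -> derivable f y u) -> differentiable ('D_u f : U -> R^o) x ->
  \forall h \near (0 : R)^'+,
    `|f (h *: u + (h *: v + x)) - f (h *: u + x) - f (h *: v + x) + f x
       - h ^+ 2 * 'D_v ('D_u f : U -> R^o) x| <= e * h ^+ 2.
Proof.
move=> oV Vx e0 df dG; set G := 'D_u f in dG *.
(* The derivative 'D_u f is evaluated at two displacements from x, of lengths at
   most h (|u| + |v|) and h |u|; the summand 1 makes c positive. *)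
pose c := 2 * `|u| + `|v| + 1.
have c0 : 0 < c by rewrite ltr_wpDl// addr_ge0// mulr_ge0.
have /eqaddoP/(_ (e / c) (divr_gt0 e0 c0)) := diff_locally dG.
move=> /nbhs_ballP[r1 /= r10 Hr1].
have /nbhs_ballP[r2 /= r20 Hr2] := open_nbhs_nbhs (conj oV Vx).
pose r := Num.min r1 r2; have r0 : 0 < r by rewrite lt_min r10.
have Hr w : `|w| < r -> V (w + x) /\ `|G (w + x) - (G x + 'd G x w)| <= e / c * `|w|.
  rewrite lt_min => /andP[w1 w2]; split.
    by apply: Hr2; rewrite -ball_normE /ball_/= opprD addrC subrK normrN.
  by apply: Hr1; rewrite -ball_normE /ball_/= sub0r normrN.
near=> h.
have h0 : 0 < h by near: h; exact: nbhs_right_gt.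
have hc : h * c < r.
  by rewrite -ltr_pdivlMr//; near: h; apply: nbhs_right_lt; rewrite divr_gt0.
have hu (s t : R) : 0 <= s <= h -> 0 <= t <= h -> `|s *: u + t *: v| <= h * (`|u| + `|v|).
  move=> /andP[s0 sh] /andP[t0 th]; rewrite (le_trans (ler_normD _ _))// !normrZ !ger0_norm// mulrDr.
  by rewrite lerD// ler_wpM2r.
have hu' (s t : R) : 0 <= s <= h -> 0 <= t <= h -> `|s *: u + t *: v| < r.
  move=> hs ht; apply: le_lt_trans (hu _ _ hs ht) _; apply: le_lt_trans hc.
  by rewrite ler_pM2l// /c; have := normr_ge0 u; lra.
have hV (s t : R) : 0 <= s <= h -> 0 <= t <= h -> V (s *: u + (t *: v + x)).
  by move=> hs ht; rewrite addrA; have [] := Hr _ (hu' _ _ hs ht).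
pose phi (s : R) : R := f (s *: u + (h *: v + x)) - f (s *: u + x).
have hh : 0 <= h <= h by rewrite (ltW h0)/=.
have h00 : (0 : R) <= 0 <= h by rewrite lexx (ltW h0).
have hV0 s : 0 <= s <= h -> V (s *: u + x).
  by move=> hs; have := hV s 0 hs h00; rewrite scale0r add0r.
have dphi s : 0 <= s <= h -> is_derive s (1 : R) phi (G (s *: u + (h *: v + x)) - G (s *: u + x)).
  by move=> hs; apply: is_deriveB; apply: is_derive_line; apply: df; [exact: hV|exact: hV0].
have [s| |s sI E] := @MVT R phi (fun s => G (s *: u + (h *: v + x)) - G (s *: u + x)) 0 h h0.
  by rewrite in_itv/= => /andP[? ?]; apply: dphi; rewrite !ltW.
  have H : {in `[0, h]%R, forall s, derivable phi s 1} by move=> s; rewrite in_itv/= => sI; have D := dphi s sI; exact: (@ex_derive _ _ _ _ _ _ _ D).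
  exact: derivable_within_continuous H.
have {}sI : 0 <= s <= h by move: sI; rewrite in_itv/= => /andP[? ?]; rewrite !ltW.
have -> : f (h *: u + (h *: v + x)) - f (h *: u + x) - f (h *: v + x) + f x = phi h - phi 0.
  by rewrite /phi !scale0r !add0r; lra.
rewrite E subr0.
have [_ B1] := Hr _ (hu' s h sI hh); have [_ B2] := Hr _ (hu' s 0 sI h00).
have dGE : 'D_v G x = 'd G x v by rewrite deriveE.
have L1 : 'd G x (s *: u + h *: v) = s * 'd G x u + h * 'd G x v by rewrite linearD !linearZ.
have L2 : 'd G x (s *: u + 0 *: v) = s * 'd G x u by rewrite linearD !linearZ/= [0 *: _]mul0r addr0.
rewrite L1 -addrA in B1; rewrite L2 scale0r !addr0 in B2.
have N1 := hu s h sI hh; have N2 := hu s 0 sI h00; rewrite scale0r addr0 in N2.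
rewrite dGE; set g1 := G _ in B1 *; set g2 := G _ in B2 *.
have {}N2 : `|s *: u| <= h * `|u| by rewrite normrZ ger0_norm ?ler_wpM2r//; case/andP: sI.
have ec : 0 <= e / c by rewrite ltW// divr_gt0.
have {}B1 := le_trans B1 (ler_wpM2l ec N1).
have {}B2 := le_trans B2 (ler_wpM2l ec N2).
have -> : (g1 - g2) * h - h ^+ 2 * 'd G x v =
  h * ((g1 - (G x + (s * 'd G x u + h * 'd G x v))) - (g2 - (G x + s * 'd G x u))) by ring.
rewrite normrM (gtr0_norm h0) expr2 mulrCA ler_pM2l//.
apply: le_trans (ler_normB _ _) _; apply: le_trans (lerD B1 B2) _.
have -> : e * h = e / c * (h * c) by rewrite mulrCA mulrA mulrA divfK ?lt0r_neq0// mulrC.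
rewrite -mulrDr ler_wpM2l// -mulrDr ler_pM2l// /c; lra.
Unshelve. all: by end_near. Qed.

(** The second difference is symmetric in u and v, hence so is its limit. *)
Lemma derive_sym f x u v V : open V -> V x ->
  (forall y, V y -> derivable f y u) -> (forall y, V y -> derivable f y v) ->
  differentiable ('D_u f : U -> R^o) x -> differentiable ('D_v f : U -> R^o) x ->
  'D_v ('D_u f : U -> R^o) x = 'D_u ('D_v f : U -> R^o) x.
Proof.
move=> oV Vx fu fv du dv; apply/eqP; rewrite -subr_eq0 -normr_le0; apply/ler_addgt0Pr => e e0.
have e4 : 0 < e / 2 by lra.
have H1 := second_difference v oV Vx e4 fu du.
have H2 := second_difference u oV Vx e4 fv dv.
have H0 : \forall h \near (0 : R)^'+, 0 < h by exact: nbhs_right_gt.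
have [h [[B1 B2] h0]] := filter_ex (filterI (filterI H1 H2) H0).
rewrite add0r.
have h2 : 0 < h ^+ 2 by rewrite exprn_gt0.
rewrite -(ler_pM2l h2) -{1}(gtr0_norm h2) -normrM.
set a := f (h *: v + (h *: u + x)) in B2.
have E : f (h *: u + (h *: v + x)) = a by rewrite /a addrCA.
rewrite E in B1; set b := f (h *: u + x) in B1 B2; set d := f (h *: v + x) in B1 B2.
set A := 'D_v _ x in B1 *; set B := 'D_u _ x in B2 *.
have -> : h ^+ 2 * (A - B) = (a - d - b + f x - h ^+ 2 * B) - (a - b - d + f x - h ^+ 2 * A) by ring.
apply: le_trans (ler_normB _ _) _; apply: le_trans (lerD B2 B1) _.
by rewrite -mulrDl -splitr mulrC.
Qed.
End Schwarz.

Section MixedPartials.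
Variables (R : realType) (n : nat).
Implicit Types (f g : 'rV[R]_n -> R^o) (V : set 'rV[R]_n) (s t : seq 'I_n).

Lemma partials_swap V f i j x : open V -> Csmooth V f -> V x ->
  partials [:: i; j] f x = partials [:: j; i] f x.
Proof.
move=> oV hf Vx; apply: (@derive_sym _ _ f x _ _ V oV Vx).
  by move=> y Vy; apply/diff_derivable/(hf [::]).
  by move=> y Vy; apply/diff_derivable/(hf [::]).
  exact: (hf [:: j]).
exact: (hf [:: i]).
Qed.

(** Moves the outermost partial derivative innermost, which is the form that the
    recursion for Taylor terms produces. *)
Lemma partials_cons_rcons V f i s x : open V -> Csmooth V f -> V x ->
  partials (i :: s) f x = partials (rcons s i) f x.
Proof.
move=> oV hf; elim: s x => [//|j s IH] x Vx.
rewrite -[i :: j :: s]/([:: i; j] ++ s) partials_cat (partials_swap _ _ oV)//; last exact: Csmooth_partials.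
rewrite -partials_cat/=; apply: near_eq_derive; near=> y; rewrite -IH//; near: y; exact: open_nbhs_nbhs.
Unshelve. all: by end_near. Qed.

End MixedPartials.

Section ChainRule.
Variables (R : realType) (U : normedModType R) (k : nat).
Implicit Types (g : 'rV[R]_k -> R^o) (b : 'I_k -> U -> R^o).

Lemma differentiable_row b x : (forall i, differentiable (b i) x) ->
  differentiable (fun y => \row_i b i y : 'rV[R]_k) x.
Proof.
move=> db.
have -> : (fun y => \row_i b i y : 'rV[R]_k) = \sum_(i < k) (fun y => b i y *: (delta_mx 0 i : 'rV[R]_k)).
  apply/funext => y; rewrite fct_sumE; apply/rowP => i; rewrite summxE !mxE (bigD1 i)//= !mxE !eqxx mulr1.
  by rewrite big1 ?addr0// => j ji; rewrite !mxE eqxx/= eq_sym (negbTE ji) mulr0.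
by apply: differentiable_sum => i; apply: differentiableZl.
Qed.

(** Chain rule for an outer function of a row vector. *)
Lemma derive_comp_row g b x v : (forall i, differentiable (b i) x) ->
  differentiable g (\row_i b i x) ->
  'D_v (fun y => g (\row_i b i y)) x = \sum_i 'D_v (b i) x * 'D_(delta_mx 0 i) g (\row_i b i x).
Proof.
move=> db dg; have db' := differentiable_row db.
rewrite deriveE; last exact: (differentiable_comp db').
rewrite (diff_comp (f := fun y => \row_i b i y) (g := g))//=.
have -> : 'd (fun y => \row_i b i y : 'rV[R]_k) x v = \sum_i 'D_v (b i) x *: (delta_mx 0 i : 'rV[R]_k).
  rewrite -deriveE// derive_mx; last exact: diff_derivable.
  rewrite [LHS]row_sum_delta; apply: eq_bigr => i _; congr (_ *: _); rewrite mxE; congr ('D_v _ x).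
  by apply/funext => y; rewrite mxE.
rewrite linear_sum; apply: eq_bigr => i _.
by rewrite linearZ/= [in RHS](deriveE _ dg).
Qed.

Lemma differentiable_comp_row g b x : (forall i, differentiable (b i) x) ->
  differentiable g (\row_i b i x) -> differentiable (fun y => g (\row_i b i y)) x.
Proof. by move=> db dg; apply: (differentiable_comp (differentiable_row db) dg). Qed.

End ChainRule.

(** * Superfunctions and their derivatives *)
Section Superderivations.
Variables (R : realType) (n m : nat).
Local Notation SF := (superfun R n m).
Local Notation G := (grassmann R m).
Implicit Types (F H : SF) (x y : 'rV[R]_n) (a b : 'I_(n + m)) (V : set 'rV[R]_n).

Lemma gaddE (c d : G) S : (c + d) S = c S + d S.
Proof. by rewrite ffunE. Qed.

Definition gdiff F x := forall S, differentiable (fun y => F y S) x.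

Lemma ord_split_ind (P : 'I_(n + m) -> Prop) :
  (forall i, P (lshift m i)) -> (forall j, P (rshift n j)) -> forall a, P a.
Proof. by move=> Pl Pr a; rewrite -(splitK a); case: (fintype.split a) => i; [exact: Pl|exact: Pr]. Qed.

Lemma par_lshift i : par (lshift m i : 'I_(n + m)) = false.
Proof. by rewrite /par/= leqNgt ltn_ord. Qed.

Lemma par_rshift j : par (rshift n j : 'I_(n + m)) = true.
Proof. by rewrite /par/= leq_addr. Qed.

Lemma split_lshift i : fintype.split (lshift m i : 'I_(n + m)) = inl i.
Proof. exact: (unsplitK (inl i)). Qed.

Lemma split_rshift j : fintype.split (rshift n j : 'I_(n + m)) = inr j.
Proof. exact: (unsplitK (inr j)). Qed.

Lemma sderiv_even i F x S : sderiv (lshift m i) F x S = 'D_(delta_mx 0 i) (fun y => F y S : R^o) x.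
Proof. by rewrite /sderiv split_lshift ffunE. Qed.

Lemma sderiv_odd j F x : sderiv (rshift n j) F x = gderiv j (F x).
Proof. by rewrite /sderiv split_rshift. Qed.

Lemma sderiv_local V F H x a : open V -> V x -> (forall y, V y -> F y = H y) ->
  sderiv a F x = sderiv a H x.
Proof.
move=> oV Vx FH; elim/ord_split_ind: a => [i|j]; last by rewrite !sderiv_odd FH.
apply/ffunP => S; rewrite !sderiv_even; apply: near_eq_derive; near=> y.
by rewrite FH//; near: y; exact: open_nbhs_nbhs.
Unshelve. all: by end_near. Qed.

Lemma gdiffD F H x : gdiff F x -> gdiff H x -> gdiff (fun y => F y + H y) x.
Proof.
move=> dF dH S; have -> : (fun y => (F y + H y) S) = (fun y => F y S) + (fun y => H y S).
  by apply/funext => y; rewrite gaddE.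
exact: differentiableD.
Qed.

Lemma sderivD a F H x : gdiff F x -> gdiff H x ->
  sderiv a (fun y => F y + H y) x = sderiv a F x + sderiv a H x.
Proof.
move=> dF dH; elim/ord_split_ind: a => [i|j]; last by rewrite !sderiv_odd linearD.
apply/ffunP => S; rewrite gaddE !sderiv_even.
have -> : (fun y => (F y + H y) S : R^o) = (fun y => F y S : R^o) + (fun y => H y S : R^o).
  by apply/funext => y; rewrite gaddE.
by rewrite deriveD//; exact: diff_derivable.
Qed.

Lemma gscalE (c : R) (S : {set 'I_m}) : (c%:A : G) S = c * (S == finset.set0)%:R.
Proof. by rewrite !ffunE. Qed.

Lemma gdiff_scal (r : 'rV[R]_n -> R^o) x : differentiable r x -> gdiff (fun y => (r y)%:A) x.
Proof.
move=> dr S; have -> : (fun y => ((r y)%:A : G) S) = (fun y => r y) * cst ((S == finset.set0)%:R : R).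
  by apply/funext => y; rewrite gscalE.
exact: differentiableM.
Qed.

Lemma sderiv_scal_even i (r : 'rV[R]_n -> R^o) x : differentiable r x ->
  sderiv (lshift m i) (fun y => (r y)%:A) x = ('D_(delta_mx 0 i) r x)%:A.
Proof.
move=> dr; apply/ffunP => S; rewrite sderiv_even gscalE.
have -> : (fun y => ((r y)%:A : G) S : R^o) = (fun y => r y) * cst ((S == finset.set0)%:R : R).
  by apply/funext => y; rewrite gscalE.
by rewrite deriveM// ?derive_cst ?scaler0 ?add0r; [rewrite mulrC|exact: diff_derivable].
Qed.

Lemma gderiv_scal j (c : R) : gderiv j (c%:A : G) = 0.
Proof.
rewrite linearZ/=; suff -> : gderiv j (1 : G) = 0 by rewrite scaler0.
apply/ffunP => S; rewrite gderivE [RHS]ffunE; case: ifP => // _.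
by rewrite !ffunE; case: eqP => [/setP/(_ j)|]; rewrite ?mulr0// !inE eqxx.
Qed.

Lemma sderiv_scal_odd j (r : 'rV[R]_n -> R) x : sderiv (rshift n j) (fun y => (r y)%:A : G) x = 0.
Proof. by rewrite sderiv_odd gderiv_scal. Qed.

Lemma gdiff_cst (c : G) x : gdiff (fun=> c) x.
Proof. by move=> S; exact: differentiable_cst. Qed.

Lemma sderiv_cst (c : R) a x : sderiv a (fun=> c%:A : G) x = 0.
Proof.
elim/ord_split_ind: a => [i|j]; last by rewrite sderiv_scal_odd.
by apply/ffunP => S; rewrite sderiv_even derive_cst ffunE.
Qed.

Lemma gdiffM F H x : gdiff F x -> gdiff H x -> gdiff (fun y => F y * H y) x.
Proof.
move=> dF dH S.
have -> : (fun y => (F y * H y) S) = (fun y => \sum_(A : {set 'I_m} | (A \subset S)%SET)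
    (-1) ^+ ginversions A (S :\: A) * (F y A * H y (S :\: A)%SET)).
  by apply/funext => y; rewrite gmulE.
pose g (A : {set 'I_m}) : 'rV[R]_n -> R^o := if A \subset S then
    (cst ((-1) ^+ ginversions A (S :\: A) : R)) * ((fun y => F y A) * (fun y => H y (S :\: A)%SET)) else cst 0.
have -> : (fun y => \sum_(A : {set 'I_m} | A \subset S)
    (-1) ^+ ginversions A (S :\: A) * (F y A * H y (S :\: A)%SET)) = \sum_(A : {set 'I_m}) g A.
  by apply/funext => y; rewrite fct_sumE big_mkcond; apply: eq_bigr => A _; rewrite /g; case: ifP.
elim/big_ind: _ => [|f1 f2|A _]; [exact: differentiable_cst|exact: differentiableD|].
rewrite /g; case: ifP => _; last exact: differentiable_cst.
by apply: differentiableM; [exact: differentiable_cst|exact: differentiableM].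
Qed.

Lemma gdiff_sum (I : Type) (r : seq I) (P : pred I) (F : I -> SF) x :
  (forall i, P i -> gdiff (F i) x) -> gdiff (fun y => \sum_(i <- r | P i) F i y) x.
Proof.
move=> h; elim: r => [|i r IH].
  by under eq_fun do rewrite big_nil; exact: gdiff_cst.
under eq_fun do rewrite big_cons; case: (boolP (P i)) => Pi //.
by apply: gdiffD => //; apply: h.
Qed.

Lemma sderiv_sum a (I : Type) (r : seq I) (P : pred I) (F : I -> SF) x :
  (forall i, P i -> gdiff (F i) x) ->
  sderiv a (fun y => \sum_(i <- r | P i) F i y) x = \sum_(i <- r | P i) sderiv a (F i) x.
Proof.
move=> h; elim: r => [|i r IH].
  rewrite big_nil; under eq_fun do rewrite big_nil.
  by rewrite -[X in sderiv _ (fun=> X)](scale0r 1) sderiv_cst.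
rewrite big_cons; under eq_fun do rewrite big_cons; case: (boolP (P i)) => Pi //.
by rewrite sderivD ?IH//; [apply: h|apply: gdiff_sum].
Qed.

(** The sign operator of the graded Leibniz rule, for a derivation of parity q. *)
Definition gtwist (q : bool) (c : G) : G := if q then ginvol c else c.

(** For an even coordinate the Leibniz rule holds in each component of the
    product; for an odd one it is [gderiv_mul]. *)
Lemma sderivM a F H x : gdiff F x -> gdiff H x ->
  sderiv a (fun y => F y * H y) x = sderiv a F x * H x + gtwist (par a) (F x) * sderiv a H x.
Proof.
move=> dF dH; elim/ord_split_ind: a => [i|j]; last by rewrite !sderiv_odd par_rshift gderiv_mul.
rewrite par_lshift /gtwist; apply/ffunP => S; rewrite [RHS]ffunE sderiv_even !gmulE -big_split/=.
pose s (A : {set 'I_m}) : R := (-1) ^+ ginversions A (S :\: A).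
pose g (A : {set 'I_m}) : 'rV[R]_n -> R^o := (fun y => s A * (F y A * H y (S :\: A)%SET)).
have dg A v : is_derive x v (g A) (s A * ('D_v (fun y => F y A : R^o) x * H x (S :\: A)%SET + F x A * 'D_v (fun y => H y (S :\: A)%SET : R^o) x)).
  have -> : g A = s A \*: ((fun y => F y A) * (fun y => H y (S :\: A)%SET)) by [].
  apply: is_derive_eq.
    by apply: is_deriveZ; apply: is_deriveM; apply: derivableP; exact: diff_derivable.
  by rewrite /GRing.scale/= addrC; congr (_ * (_ + _)); rewrite mulrC.
transitivity ('D_(delta_mx 0 i) (\sum_(A : {set 'I_m} | A \subset S) g A) x).
  by congr ('D_ _ _ x); apply/funext => y; rewrite fct_sumE (gmulE (F y)).
transitivity (\sum_(A : {set 'I_m} | A \subset S) 'D_(delta_mx 0 i) (g A) x).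
  elim: (index_enum _) => [|A r IH]; first by rewrite !big_nil derive_cst.
  rewrite !big_cons; case: ifP => // _; rewrite deriveD ?IH//.
  rewrite -[X in derivable X]/(\sum_(j <- r | j \subset S) g j).
  by elim/big_ind: _ => [|f1 f2|B _]; [exact: derivable_cst|exact: derivableD|].
by apply: eq_bigr => A AS; rewrite derive_val !sderiv_even mulrDr.
Qed.

Lemma sderivZ a (c : R) F x : gdiff F x -> sderiv a (fun y => c *: F y) x = c *: sderiv a F x.
Proof.
move=> dF; have -> : (fun y => c *: F y) = (fun y => c%:A * F y) by apply/funext => y; rewrite mulr_algl.
rewrite (sderivM a (gdiff_cst (c%:A) x) dF) sderiv_cst mul0r add0r.
have -> : gtwist (par a) (c%:A) = c%:A by rewrite /gtwist; case: ifP => // _; rewrite linearZ/= ginvol1.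
by rewrite mulr_algl.
Qed.

Lemma gdiffZ (c : R) F x : gdiff F x -> gdiff (fun y => c *: F y) x.
Proof.
move=> dF; have -> : (fun y => c *: F y) = (fun y => c%:A * F y) by apply/funext => y; rewrite mulr_algl.
by apply: gdiffM => //; exact: gdiff_cst.
Qed.

Lemma gdiffB F H x : gdiff F x -> gdiff H x -> gdiff (fun y => F y - H y) x.
Proof.
move=> dF dH; apply: gdiffD => //.
by under eq_fun do rewrite -scaleN1r; exact: gdiffZ.
Qed.

Lemma sderivB a F H x : gdiff F x -> gdiff H x ->
  sderiv a (fun y => F y - H y) x = sderiv a F x - sderiv a H x.
Proof.
move=> dF dH; rewrite -scaleN1r -sderivZ// -sderivD//; last exact: gdiffZ.
by congr (sderiv _ _ _); apply/funext => y; rewrite scaleN1r.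
Qed.

Lemma gparity_sderiv V a F x q : open V -> V x -> (forall y, V y -> gparity q (F y)) ->
  gparity (par a (+) q) (sderiv a F x).
Proof.
move=> oV Vx pF; elim/ord_split_ind: a => [i|j]; last first.
  by rewrite par_rshift sderiv_odd; apply: gparity_deriv; apply: pF.
rewrite par_lshift => S Sq; rewrite sderiv_even -[RHS](derive_cst (0 : R^o) x (delta_mx 0 i)).
apply: near_eq_derive; near=> y; rewrite pF//; near: y; exact: open_nbhs_nbhs.
Unshelve. all: by end_near. Qed.

Lemma gtwist_even q c : gparity false c -> gtwist q c = c.
Proof. by rewrite /gtwist => /gparity_involE; case: q => // ->; rewrite scale1r. Qed.

Lemma gtwist_parity q r c : gparity r c -> gtwist q c = (-1) ^+ (q && r) *: c.
Proof. by move=> rc; rewrite /gtwist; case: q; rewrite ?scale1r//= (gparity_involE rc). Qed.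

Lemma gdiff_prod (I : Type) (r : seq I) (P : pred I) (F : I -> SF) x :
  (forall i, P i -> gdiff (F i) x) -> gdiff (fun y => \prod_(i <- r | P i) F i y) x.
Proof.
move=> h; elim: r => [|i r IH].
  by under eq_fun do rewrite big_nil; exact: gdiff_cst.
under eq_fun do rewrite big_cons; case: (boolP (P i)) => Pi //.
by apply: gdiffM => //; apply: h.
Qed.

Lemma smooth_gdiff V F x : smooth V F -> V x -> gdiff F x.
Proof. by move=> sF Vx S; exact: (sF S [::] x). Qed.

Lemma smoothD V F H : open V -> smooth V F -> smooth V H -> smooth V (fun y => F y + H y).
Proof.
move=> oV sF sH S; apply: (Csmooth_local oV _ (CsmoothD oV (sF S) (sH S))) => y _.
by rewrite ffunE.
Qed.

Lemma smooth_local V F H : open V -> (forall y, V y -> F y = H y) -> smooth V F -> smooth V H.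
Proof. by move=> oV FH sF S; apply: (Csmooth_local oV _ (sF S)) => y Vy; rewrite FH. Qed.

Lemma smooth0 V : smooth V ((fun=> 0) : SF).
Proof.
move=> S; have -> : (fun y : 'rV[R]_n => (0 : G) S) = (fun=> 0) by apply/funext => y; rewrite ffunE.
exact: Csmooth_cst.
Qed.

Lemma smoothZ V c F : open V -> smooth V F -> smooth V (fun y => c *: F y).
Proof.
move=> oV sF S; apply: (Csmooth_local oV _ (CsmoothZ c oV (sF S))) => y _.
by rewrite ffunE.
Qed.

Lemma smooth_sum (I : Type) (r : seq I) (P : pred I) V (F : I -> SF) : open V ->
  (forall i, P i -> smooth V (F i)) -> smooth V (fun y => \sum_(i <- r | P i) F i y).
Proof.
move=> oV h; elim: r => [|i r IH]; first by under eq_fun do rewrite big_nil; exact: smooth0.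
under eq_fun do rewrite big_cons; case: (boolP (P i)) => Pi //.
by apply: smoothD => //; apply: h.
Qed.

Lemma smoothM V F H : open V -> smooth V F -> smooth V H -> smooth V (fun y => F y * H y).
Proof.
move=> oV sF sH S.
have := @Csmooth_sum R n _ (index_enum {set 'I_m}) (fun A : {set 'I_m} => (A \subset S)%SET) V
  (fun A y => (-1) ^+ ginversions A (S :\: A) * (F y A * H y (S :\: A)%SET)) oV.
move=> E; apply: (Csmooth_local oV _ (E _)) => [y _|A _]; first by rewrite gmulE.
by apply: CsmoothZ => //; apply: CsmoothM => //; [exact: sF|exact: sH].
Qed.

Lemma smooth_sderiv V a F : open V -> smooth V F -> smooth V (sderiv a F).
Proof.
move=> oV sF; elim/ord_split_ind: a => [i|j] S.
  have := @Csmooth_partials _ _ _ _ [:: i] (sF S); apply: Csmooth_local => // y _.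
  by rewrite sderiv_even.
have [jS|jS] := boolP (j \in S).
  suff : Csmooth V (fun y => sderiv (rshift n j) F y S : R^o) by [].
  have -> : (fun y => sderiv (rshift n j) F y S : R^o) = (fun=> 0).
    by apply/funext => y; rewrite sderiv_odd gderivE jS.
  exact: Csmooth_cst.
apply: (Csmooth_local oV _ (CsmoothZ ((-1) ^+ nbelow j S) oV (sF (j |: S)))) => y _.
by rewrite sderiv_odd gderivE (negbTE jS).
Qed.

(** Even derivatives commute by Schwarz, odd ones anticommute because of the count
    of generators below each index, and mixed ones act on different data. *)
Lemma sderiv_swap V a b F x : open V -> V x -> smooth V F ->
  sderiv a (sderiv b F) x = (-1) ^+ (par a && par b) *: sderiv b (sderiv a F) x.
Proof.
move=> oV Vx sF.
have EO i j : sderiv (lshift m i) (sderiv (rshift n j) F) x = sderiv (rshift n j) (sderiv (lshift m i) F) x.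
  apply/ffunP => S; rewrite sderiv_even sderiv_odd gderivE.
  have [jS|jS] := boolP (j \in S).
    rewrite -[RHS](derive_cst (0 : R^o) x (delta_mx 0 i)); congr ('D_ _ _ x).
    by apply/funext => y; rewrite sderiv_odd gderivE jS.
  rewrite sderiv_even -[RHS]deriveZ; last exact/diff_derivable/(sF _ [::]).
  by congr ('D_ _ _ x); apply/funext => y; rewrite sderiv_odd gderivE (negbTE jS).
elim/ord_split_ind: a => [i|j]; elim/ord_split_ind: b => [i'|j'];
  rewrite ?par_lshift ?par_rshift /= ?scale1r ?EO//.
  apply/ffunP => S; rewrite !sderiv_even.
  have := partials_swap i i' oV (sF S) Vx => /= E.
  transitivity ('D_(delta_mx 0 i) ('D_(delta_mx 0 i') (fun y => F y S : R^o) : _ -> R^o) x).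
    by congr ('D_ _ _ x); apply/funext => y; rewrite sderiv_even.
  by rewrite E; congr ('D_ _ _ x); apply/funext => y; rewrite sderiv_even.
rewrite !sderiv_odd scaleN1r; apply/ffunP => S; rewrite [RHS]ffunE !gderivE.
have [jS|jS] := boolP (j \in S); have [jS'|jS'] := boolP (j' \in S); rewrite ?oppr0// !inE ?jS ?jS' ?orbT ?mulr0 ?oppr0//.
rewrite (negbTE jS) (negbTE jS') !orbF eq_sym; case: eqVneq => [_|jj]; first by rewrite !mulr0 oppr0.
rewrite finset.setUCA !mulrA -mulNr; congr (_ * _).
have nb k l : k \notin S -> nbelow l (k |: S) = ((k < l) + nbelow l S)%N.
  move=> kS; rewrite nbelowU ?disjoints1//; congr (_ + _)%N.
  rewrite /nbelow (_ : [set i in [set k] | (i < l)%N]%SET = if (k < l)%N then [set k]%SET else finset.set0).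
    by case: ifP; rewrite ?cards1 ?cards0.
  by apply/setP => i; rewrite !inE; case: ifP => kl; rewrite !inE; case: eqP => [->|].
rewrite !nb// !exprD; have -> : (j' < j)%N = ~~ (j < j')%N by rewrite -leqNgt ltn_neqAle eq_sym jj.
by case: (j < j')%N; rewrite /= ?expr0 ?expr1; ring.
Qed.

End Superderivations.

(** * Taylor expansion in souls and the chain rule *)
Section TaylorExpansion.
Variables (R : realType) (n m : nat).
Local Notation SF := (superfun R n m).
Local Notation G := (grassmann R m).
Implicit Types (F H : SF) (x y : 'rV[R]_n) (a b : 'I_(n + m)) (V : set 'rV[R]_n).

Lemma gdiff_body F x : gdiff F x -> differentiable (fun y => gbody (F y) : R^o) x.
Proof. by move=> dF; apply: dF. Qed.

Lemma gdiff_soul F x : gdiff F x -> gdiff (fun y => gsoul (F y)) x.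
Proof. by move=> dF; apply: gdiffB => //; apply: gdiff_scal; exact: gdiff_body. Qed.

Lemma sderiv_soul a F x : gdiff F x ->
  sderiv a (fun y => gsoul (F y)) x = sderiv a F x - sderiv a (fun y => (gbody (F y))%:A) x.
Proof. by move=> dF; rewrite sderivB//; apply: gdiff_scal; exact: gdiff_body. Qed.

(** The purely real chain rule, restated for scalars of the Grassmann algebra so
    that both kinds of coordinates are treated uniformly. *)
Lemma sderiv_scal_comp (k : nat) a (g : 'rV[R]_k -> R^o) (Y : 'I_k -> SF) x :
  (forall i, gdiff (Y i) x) -> differentiable g (\row_i gbody (Y i x)) ->
  gdiff (fun y => (g (\row_i gbody (Y i y)))%:A : G) x /\
  sderiv a (fun y => (g (\row_i gbody (Y i y)))%:A : G) x =
  \sum_i sderiv a (fun y => (gbody (Y i y))%:A : G) x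
     * ('D_(delta_mx 0 i) g (\row_i gbody (Y i x)))%:A.
Proof.
move=> dY dg; have db i : differentiable (fun y => gbody (Y i y) : R^o) x by exact: gdiff_body.
have dgb := differentiable_comp_row db dg.
split; first exact: gdiff_scal.
elim/ord_split_ind: a => [i|j]; last first.
  rewrite sderiv_scal_odd big1// => i _; by rewrite sderiv_scal_odd mul0r.
rewrite sderiv_scal_even// derive_comp_row// scaler_suml; apply: eq_bigr => l _.
by rewrite sderiv_scal_even// mulr_algl scalerA.
Qed.

Lemma sderiv_scal_comp1 a (g : R -> R) F x :
  gdiff F x -> derivable g (gbody (F x)) 1 ->
  gdiff (fun y => (g (gbody (F y)))%:A : G) x /\
  sderiv a (fun y => (g (gbody (F y)))%:A : G) x =
  (g^`()%classic (gbody (F x)))%:A * sderiv a (fun y => (gbody (F y))%:A : G) x.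
Proof.
move=> dF /derivable1_diffP dg; have db := gdiff_body dF.
have dgb : differentiable (fun y => g (gbody (F y)) : R^o) x by exact: (differentiable_comp db dg).
split; first exact: gdiff_scal.
elim/ord_split_ind: a => [i|j]; last by rewrite !sderiv_scal_odd mulr0.
rewrite !sderiv_scal_even// mulr_algl scalerA; congr (_ *: _).
rewrite [in LHS]deriveE// (diff_comp (f := fun y => gbody (F y) : R^o) (g := g))//=.
rewrite [in RHS]deriveE// diff1E//= /GRing.scale/=; exact: mulrC.
Qed.

Lemma gbodyZ (t : R) (c : G) : gbody (t *: c) = t * gbody c.
Proof. by rewrite /gbody ffunE. Qed.

Lemma gsoul_body (c : G) : gbody (gsoul c) = 0.
Proof. by rewrite /gsoul raddfB/= linearZ/= rmorph1 mulr1 subrr. Qed.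

Lemma gsoul_m0 (c : G) : m = 0%N -> gsoul c = 0.
Proof.
move=> m0; apply/ffunP => S; rewrite [RHS]ffunE.
have -> : S = finset.set0 by apply/setP => j; move: (ltn_ord j); rewrite {2}m0.
exact: gsoul_body.
Qed.

(** The Taylor polynomial is cut at order m, and its derivative would produce one
    more term of that order; that term is killed by its degree. *)
Lemma sderiv_soul_mul0 a F x (c : G) : gdiff F x -> gdeg_ge m.*2 c ->
  sderiv a (fun y => gsoul (F y)) x * c = 0.
Proof.
move=> dF dc; have [m0|m0] := posnP m.
  have -> : (fun y => gsoul (F y)) = (fun=> 0%:A).
    by apply/funext => y; rewrite gsoul_m0// scale0r.
  by rewrite sderiv_cst mul0r.
suff -> : c = 0 by rewrite mulr0.
by apply: gdeg_ge_eq0 dc; rewrite -addnn -[X in (X < _)%N]addn0 ltn_add2l.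
Qed.

Lemma gparityX (c : G) k : gparity false c -> gparity false (c ^+ k).
Proof. by move=> ec; elim: k => [|k IH]; [exact: gparity1|rewrite exprS; exact: (@gparityM _ _ false false)]. Qed.

Lemma sderivX a F x k : gdiff F x -> gparity false (F x) ->
  gdiff (fun y => F y ^+ k) x /\
  sderiv a (fun y => F y ^+ k) x = k%:R *: (F x ^+ k.-1 * sderiv a F x).
Proof.
move=> dF eF; elim: k => [|k [IHd IH]].
  split; first exact: gdiff_cst.
  by rewrite scale0r; rewrite -[X in sderiv _ (fun=> X)]scale1r sderiv_cst.
split; first by under eq_fun do rewrite exprS; exact: gdiffM.
under eq_fun do rewrite exprS.
rewrite sderivM// IH gtwist_even//.
have -> : F x * (k%:R *: (F x ^+ k.-1 * sderiv a F x)) = k%:R *: (F x ^+ k * sderiv a F x).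
  case: k {IHd IH} => [|k]; first by rewrite !scale0r mulr0.
  by rewrite -scalerAr mulrA -exprS.
rewrite (_ : sderiv a F x * F x ^+ k = F x ^+ k * sderiv a F x).
  by rewrite -[X in X + _]scale1r -scalerDl -natr1 addrC.
by apply/esym/gevenC/gparityX.
Qed.

Lemma gdeg_soulX (c : G) k : gparity false c -> gdeg_ge k.*2 (gsoul c ^+ k).
Proof.
move=> ec; elim: k => [|k IH]; first by move=> S; rewrite ltn0.
by rewrite exprS doubleS -addn2 addnC; apply: gdeg_geM => //; exact: gsoul_deg.
Qed.

Lemma gsoulX_m1 (c : G) : gparity false c -> gsoul c ^+ m.+1 = 0.
Proof.
move=> ec; apply: gdeg_ge_eq0 (gdeg_soulX (k := m.+1) ec).
by rewrite -addnn addSn ltnS leq_addr.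
Qed.

(** [gapply F u] with the derivatives of F at the body replaced by an arbitrary
    sequence: identities between functions become identities between sequences. *)
Definition gtaylor (c : nat -> R) (u : G) : G :=
  \sum_(k < m.+1) (c k / k`!%:R) *: gsoul u ^+ k.

Lemma gapplyE (F : R -> R) (u : G) : gapply F u = gtaylor (fun k => F^`(k)%classic (gbody u)) u.
Proof. by []. Qed.

Lemma eq_gtaylor c c' u : (forall k, c k = c' k) -> gtaylor c u = gtaylor c' u.
Proof. by move=> cc; apply: eq_bigr => k _; rewrite cc. Qed.

Lemma gtaylorZ t c u : gtaylor (fun k => t * c k) u = t *: gtaylor c u.
Proof. by rewrite scaler_sumr; apply: eq_bigr => k _; rewrite scalerA mulrA. Qed.

Lemma gtaylor_even c u : gparity false u -> gparity false (gtaylor c u).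
Proof. by move=> eu; apply: gparity_sum => k _; apply/gparityZ/gparityX/gparity_soul. Qed.

Lemma gtaylor_body c u : gbody (gtaylor c u) = c 0%N.
Proof.
rewrite /gtaylor raddf_sum big_ord_recl/= big1 ?addr0 => [|k _].
  by rewrite fact0 divr1 expr0 gbodyZ rmorph1 mulr1.
by rewrite gbodyZ rmorphXn/= gsoul_body expr0n mulr0.
Qed.

(** Multiplication by u = body + soul acts on Taylor coefficients by the Leibniz
    rule for s * c(s); this is how functional equations such as s * s^-1 = 1 are
    transported to even elements. *)
Lemma gtaylor_mulid c u : gparity false u ->
  gtaylor c u * u = gtaylor (fun k => c k * gbody u + k%:R * c k.-1) u.
Proof.
move=> eu; have -> : gtaylor c u * u = gbody u *: gtaylor c u + gtaylor c u * gsoul u.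
  by rewrite -mulr_algr -mulrDr /gsoul addrC subrK.
rewrite /gtaylor scaler_sumr mulr_suml.
rewrite [X in _ + X]big_ord_recr/= -[X in _ + (_ + X)]scalerAl -exprSr gsoulX_m1// scaler0 addr0.
transitivity (\sum_(k < m.+1) ((c k * gbody u / k`!%:R) *: gsoul u ^+ k
   + (k%:R * c k.-1 / k`!%:R) *: gsoul u ^+ k)); last first.
  by apply: eq_bigr => k _; rewrite -scalerDl -mulrDl.
rewrite big_split/=; congr (_ + _).
  by apply: eq_bigr => k _; rewrite scalerA mulrA [gbody u * _]mulrC.
rewrite [RHS]big_ord_recl/= !mul0r scale0r add0r; apply: eq_bigr => k _.
rewrite -scalerAl -exprSr /bump/= add1n factS natrM; congr (_ *: _).
rewrite invfM mulrACA divff ?mul1r//; by rewrite pnatr_eq0.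
Qed.

(** Differentiating the k-th term gives a term with the derivative of the body
    and one with the derivative of the soul, and the second cancels the shift of
    the index: the sum telescopes into the Taylor polynomial of the derivative. *)
Lemma sderiv_gapply a (g : R -> R) F x :
  gdiff F x -> gparity false (F x) ->
  (forall k, derivable (g^`(k)%classic) (gbody (F x)) 1) ->
  gdiff (fun y => gapply g (F y)) x /\
  sderiv a (fun y => gapply g (F y)) x = gapply (g^`()%classic) (F x) * sderiv a F x.
Proof.
move=> dF eF dg.
pose u (k : nat) y : R := g^`(k)%classic (gbody (F y)) / k`!%:R.
pose T (k : nat) y : G := (g^`(k)%classic (gbody (F y)))%:A * (k`!%:R^-1 *: gsoul (F y) ^+ k).
have TE k y : (u k y) *: gsoul (F y) ^+ k = T k y by rewrite /T mulr_algl scalerA.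
have dS := gdiff_soul dF.
have eS : gparity false (gsoul (F x)) by exact: gparity_soul.
have dT k : gdiff (T k) x.
  apply: gdiffM; first by case: (@sderiv_scal_comp1 a (g^`(k)%classic) F x dF (dg k)).
  by apply: gdiffZ; case: (@sderivX a _ x k dS eS).
have -> : (fun y => gapply g (F y)) = (fun y => \sum_(k < m.+1) T k y).
  by apply/funext => y; apply: eq_bigr => k _; rewrite -TE.
split; first exact: gdiff_sum.
pose Db := sderiv a (fun y => (gbody (F y))%:A : G) x.
pose Ds := sderiv a (fun y => gsoul (F y)) x.
pose D (k : nat) : G := (g^`(k.+1)%classic (gbody (F x)) / k`!%:R) *: gsoul (F x) ^+ k.
have eD k : gparity false (D k) by apply/gparityZ/gparityX.
have DT (k : nat) : sderiv a (T k) x = D k * Db + if k is k'.+1 then D k' * Ds else 0.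
  have [d1 E1] := @sderiv_scal_comp1 a (g^`(k)%classic) F x dF (dg k).
  have [d2 E2] := @sderivX a _ x k dS eS.
  rewrite /T sderivM//; last exact: gdiffZ.
  rewrite E1 sderivZ// E2 gtwist_even; last by apply/gparityZ/gparity1.
  congr (_ + _).
    rewrite -derive1nS /D -mulrA -/Db -(@gevenC _ _ (k`!%:R^-1 *: _)); last exact/gparityZ/gparityX.
    by rewrite mulrA mulr_algl scalerA.
  case: k {d1 E1 d2 E2} => [|k]; first by rewrite scale0r scaler0 mulr0.
  rewrite mulr_algl /D -/Ds -scalerAl !scalerA; congr (_ *: _); rewrite factS natrM invfM.
  by rewrite -mulrA; congr (_ * _); rewrite [X in X * _]mulrC -mulrA mulVf ?mulr1// pnatr_eq0.
rewrite sderiv_sum// (eq_bigr (fun k : 'I_m.+1 => D k * Db + (if k : nat is k'.+1 then D k' * Ds else 0)))//.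
rewrite big_split/= [X in _ + X]big_ord_recl add0r/=.
have -> : sderiv a F x = Db + Ds by rewrite /Ds sderiv_soul// addrC subrK.
have -> : gapply g^`()%classic (F x) = \sum_(k < m.+1) D k.
  by apply: eq_bigr => k _; rewrite /D derive1Sn.
rewrite mulrDr mulr_suml; congr (_ + _).
rewrite mulr_suml [RHS]big_ord_recr/=.
rewrite (gevenC Ds (eD m)) sderiv_soul_mul0//; last first.
  by move=> S Sm; rewrite /D ffunE (gdeg_soulX eF Sm) scaler0.
by rewrite addr0; apply: eq_bigr.
Qed.

(** Homogeneous part of order k of the expansion of g at the body of Y, without
    the factor 1/k!; the sum runs over tuples of indices rather than
    multi-indices, so that derivatives can be peeled off one at a time. *)
Definition taylor_term k (g : 'rV[R]_n -> R^o) (Y : 'I_n -> G) : G :=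
  \sum_(s : k.-tuple 'I_n) partials s g (\row_i gbody (Y i)) *: \prod_(i <- s) gsoul (Y i).

Definition taylor (g : 'rV[R]_n -> R^o) (Y : 'I_n -> G) : G :=
  \sum_(k < m.+1) k`!%:R^-1 *: taylor_term k g Y.

Lemma pullbackE (Phi : 'I_(n + m) -> SF) F x : pullback Phi F x =
  \sum_(S : {set 'I_m}) taylor (fun z => F z S) (fun i => Phi (lshift m i) x)
     * \prod_(j in S) Phi (rshift n j) x.
Proof.
apply: eq_bigr => S _; congr (_ * _); apply: eq_bigr => k _; rewrite scaler_sumr.
by apply: eq_bigr => s _; rewrite scalerA mulrC.
Qed.

Lemma taylor_term0 g Y : taylor_term 0 g Y = (g (\row_i gbody (Y i)))%:A.
Proof.
by rewrite /taylor_term (big_pred1 [tuple]) => [|s]; [rewrite big_nil|rewrite [s]tuple0/= eqxx].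
Qed.

(** Peeling off the innermost derivative gives a recursion in the order. *)
Lemma taylor_termS k V g Y : open V -> Csmooth V g -> V (\row_i gbody (Y i)) ->
  taylor_term k.+1 g Y = \sum_i gsoul (Y i) * taylor_term k (partials [:: i] g) Y.
Proof.
move=> oV sg Vb; rewrite /taylor_term.
under [RHS]eq_bigr do rewrite mulr_sumr.
rewrite pair_big/=.
rewrite (reindex (fun p : 'I_n * k.-tuple 'I_n => [tuple of p.1 :: p.2]))/=; last first.
  exists (fun s : k.+1.-tuple 'I_n => (thead s, [tuple of behead s])).
    by move=> [i s] _; congr (_, _); apply: val_inj.
  by move=> s _; rewrite -tuple_eta.
apply: eq_bigr => -[i s] _ /=; rewrite big_cons -scalerAr; congr (_ *: _).
by rewrite -[LHS]/(partials (i :: s) g _) (partials_cons_rcons i s oV sg Vb) partials_rcons.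
Qed.

Lemma eq_partials s V (g h : 'rV[R]_n -> R^o) x : open V -> V x -> (forall y, V y -> g y = h y) ->
  partials s g x = partials s h x.
Proof. by move=> oV Vx gh; apply: partials_local Vx. Qed.

Lemma taylor_term_local V k g h Y : open V -> V (\row_i gbody (Y i)) -> (forall y, V y -> g y = h y) ->
  taylor_term k g Y = taylor_term k h Y.
Proof. by move=> oV Vb gh; apply: eq_bigr => s _; rewrite (eq_partials s oV Vb gh). Qed.

Lemma taylor_term_swap V k g i j Y : open V -> Csmooth V g -> V (\row_i gbody (Y i)) ->
  taylor_term k (partials [:: i] (partials [:: j] g)) Y = taylor_term k (partials [:: j] (partials [:: i] g)) Y.
Proof.
move=> oV sg Vb; have sw y : V y -> partials [:: i; j] g y = partials [:: j; i] g y.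
  exact: partials_swap oV sg.
exact: (@taylor_term_local V k (partials [:: i; j] g) (partials [:: j; i] g) Y oV Vb sw).
Qed.

Lemma mulr_evenCA (u c t : G) : gparity false u -> u * (c * t) = c * (u * t).
Proof. by move=> eu; rewrite !mulrA (gevenC c eu). Qed.

Lemma mulr_taylor_term_swap V k g i j Y (u c : G) : open V -> Csmooth V g -> V (\row_i gbody (Y i)) ->
  gparity false u ->
  u * (c * taylor_term k (partials [:: i] (partials [:: j] g)) Y) =
  c * (u * taylor_term k (partials [:: j] (partials [:: i] g)) Y).
Proof.
move=> oV sg Vb eu; have E := @taylor_term_swap V k g i j Y oV sg Vb.
apply: etrans (congr1 (fun t => u * (c * t)) E) _.
exact: mulr_evenCA.
Qed.

Lemma taylorD V g h Y : open V -> Csmooth V g -> Csmooth V h -> V (\row_i gbody (Y i)) ->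
  taylor (fun y => g y + h y) Y = taylor g Y + taylor h Y.
Proof.
move=> oV sg sh Vb; rewrite -big_split; apply: eq_bigr => k _ /=; rewrite -scalerDr -big_split.
by congr (_ *: _); apply: eq_bigr => s _ /=; rewrite -scalerDl (partialsD _ oV sg sh Vb).
Qed.

Lemma taylorZ V c g Y : open V -> Csmooth V g -> V (\row_i gbody (Y i)) ->
  taylor (fun y => c * g y) Y = c *: taylor g Y.
Proof.
move=> oV sg Vb; rewrite scaler_sumr; apply: eq_bigr => k _; rewrite scalerA mulrC -scalerA.
congr (_ *: _); rewrite scaler_sumr; apply: eq_bigr => s _; rewrite scalerA.
by rewrite (partialsZ c s oV sg Vb).
Qed.

Lemma taylor0 Y : taylor (fun=> 0) Y = 0.
Proof.
by apply: big1 => k _; rewrite /taylor_term big1 ?scaler0// => s _; rewrite partials0 scale0r.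
Qed.

Lemma taylor_term_even k g Y : (forall i, gparity false (Y i)) -> gparity false (taylor_term k g Y).
Proof.
by move=> eY; apply: gparity_sum => s _; apply/gparityZ/gparity_prod_even => i _; exact: gparity_soul.
Qed.

Lemma taylor_even g Y : (forall i, gparity false (Y i)) -> gparity false (taylor g Y).
Proof. by move=> eY; apply: gparity_sum => k _; apply/gparityZ/taylor_term_even. Qed.

Lemma taylor_term_deg k g Y : (forall i, gparity false (Y i)) -> gdeg_ge k.*2 (taylor_term k g Y).
Proof.
move=> eY S Sk; rewrite /taylor_term sum_ffunE big1// => s _; rewrite ffunE gdeg_ge_prod ?scaler0 ?size_tuple//.
by move=> i; exact: gsoul_deg.
Qed.

Section ChainTaylor.
Variables (a : 'I_(n + m)) (Y : 'I_n -> SF) (x : 'rV[R]_n) (V : set 'rV[R]_n).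
Hypotheses (oV : open V) (Vb : V (\row_i gbody (Y i x))).
Hypotheses (dY : forall i, gdiff (Y i) x) (eY : forall i, gparity false (Y i x)).
Hypothesis (nV : \forall y \near x, V (\row_i gbody (Y i y))).
Let b i := sderiv a (fun y => (gbody (Y i y))%:A : G) x.
Let s i := sderiv a (fun y => gsoul (Y i y)) x.
Let Yx i := Y i x.

Lemma sderiv_near F H z c : {near z, F =1 H} -> sderiv c F z = sderiv c H z.
Proof.
move=> FH; elim/ord_split_ind: c => [i|j]; last by rewrite !sderiv_odd (nbhs_singleton FH).
apply/ffunP => S; rewrite !sderiv_even; apply: near_eq_derive; near=> y.
have -> //: F y = H y; near: y; exact: FH.
Unshelve. all: by end_near. Qed.

Lemma gdiff_near F H z : {near z, F =1 H} -> gdiff F z -> gdiff H z.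
Proof.
move=> FH dF S; apply: near_eq_differentiable (dF S); near=> y.
have -> //: F y = H y; near: y; exact: FH.
Unshelve. all: by end_near. Qed.

(** By induction on the order: the derivative falls either on the body, which
    raises the order of the derivative of g, or on one of the k souls; by symmetry
    of the partial derivatives the k choices give the same term. *)
Lemma sderiv_taylor_term k g : Csmooth V g ->
  gdiff (fun y => taylor_term k g (Y^~ y)) x /\
  sderiv a (fun y => taylor_term k g (Y^~ y)) x =
  \sum_l b l * taylor_term k (partials [:: l] g) Yx +
  k%:R *: \sum_l s l * taylor_term k.-1 (partials [:: l] g) Yx.
Proof.
elim: k g => [|k IH] g sg.
  have := @sderiv_scal_comp n a g Y x dY (sg [::] _ Vb).
  under eq_fun do rewrite -taylor_term0; move=> [d E]; split=> //.
  by rewrite E scale0r addr0; apply: eq_bigr => l _; rewrite taylor_term0.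
have sP l : Csmooth V (partials [:: l] g) by exact: Csmooth_partials.
have N : {near x, (fun y => \sum_i gsoul (Y i y) * taylor_term k (partials [:: i] g) (Y^~ y)) =1
   (fun y => taylor_term k.+1 g (Y^~ y))}.
  by near=> y; rewrite /= (taylor_termS k oV sg)//; near: y.
have dM i : gdiff (fun y => gsoul (Y i y) * taylor_term k (partials [:: i] g) (Y^~ y)) x.
  by apply: gdiffM; [exact: gdiff_soul|case: (IH _ (sP i))].
split; first by apply: gdiff_near N _; exact: gdiff_sum.
rewrite -(sderiv_near _ N) sderiv_sum//.
have E i : sderiv a (fun y => gsoul (Y i y) * taylor_term k (partials [:: i] g) (Y^~ y)) x =
  s i * taylor_term k (partials [:: i] g) Yx + (\sum_l b l * (gsoul (Yx i) * taylor_term k (partials [:: i] (partials [:: l] g)) Yx)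
   + k%:R *: \sum_l s l * (gsoul (Yx i) * taylor_term k.-1 (partials [:: i] (partials [:: l] g)) Yx)).
  have [dI EI] := IH _ (sP i).
  rewrite sderivM//; last exact: gdiff_soul.
  have eS : gparity false (gsoul (Y i x)) by exact/gparity_soul.
  rewrite EI gtwist_even//; congr (_ + _).
  have A (c : 'I_n -> G) k' :
      gsoul (Y i x) * (\sum_l c l * taylor_term k' (partials [:: l] (partials [:: i] g)) Yx) =
      \sum_l c l * (gsoul (Yx i) * taylor_term k' (partials [:: i] (partials [:: l] g)) Yx).
    rewrite mulr_sumr; apply: eq_bigr => l _.
    exact: (@mulr_taylor_term_swap V k' g l i Yx _ _ oV sg Vb eS).
  by rewrite mulrDr -scalerAr !A.
rewrite (eq_bigr _ (fun i _ => E i)) !big_split/= -scaler_sumr.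
rewrite exchange_big [X in k%:R *: X]exchange_big/= addrCA; congr (_ + _).
  apply: eq_bigr => l _; rewrite -mulr_sumr; congr (_ * _).
  by rewrite (taylor_termS k oV (sP l)).
rewrite -natr1 addrC scalerDl scale1r; congr (_ + _).
case: k {IH N dM E} => [|k]; first by rewrite !scale0r.
congr (_ *: _); apply: eq_bigr => l _; rewrite -mulr_sumr; congr (_ * _).
by rewrite (taylor_termS k oV (sP l)).
Unshelve. all: by end_near. Qed.

(** The soul term of order k + 1 has the same coefficient 1/k! as the body term of
    order k, and together they form the derivative of Y; the leftover soul term
    at the top order vanishes by degree. *)
Lemma sderiv_taylor g : Csmooth V g ->
  gdiff (fun y => taylor g (Y^~ y)) x /\
  sderiv a (fun y => taylor g (Y^~ y)) x =
  \sum_l sderiv a (Y l) x * taylor (partials [:: l] g) Yx.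
Proof.
move=> sg; have dT k : gdiff (fun y => k`!%:R^-1 *: taylor_term k g (Y^~ y)) x.
  by apply: gdiffZ; case: (sderiv_taylor_term k sg).
split; first exact: gdiff_sum.
rewrite sderiv_sum//.
have E (k : nat) : sderiv a (fun y => k`!%:R^-1 *: taylor_term k g (Y^~ y)) x =
  \sum_l b l * (k`!%:R^-1 *: taylor_term k (partials [:: l] g) Yx) +
  \sum_l s l * (if k is k'.+1 then k'`!%:R^-1 *: taylor_term k' (partials [:: l] g) Yx else 0).
  have [d E] := sderiv_taylor_term k sg; rewrite sderivZ// E scalerDr; congr (_ + _).
    by rewrite scaler_sumr; apply: eq_bigr => l _; rewrite scalerAr.
  case: k {d E} => [|k]; first by rewrite scale0r scaler0 big1// => l _; rewrite mulr0.
  rewrite scalerA factS natrM invfM mulrAC mulVf ?pnatr_eq0// mul1r scaler_sumr.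
  by apply: eq_bigr => l _; rewrite scalerAr.
rewrite (eq_bigr _ (fun (k : 'I_m.+1) _ => E k)) big_split/= exchange_big [X in _ + X]exchange_big/= -big_split/=.
apply: eq_bigr => l _; have -> : sderiv a (Y l) x = b l + s l by rewrite /s sderiv_soul// addrC subrK.
rewrite -!mulr_sumr mulrDl; congr (_ + _).
rewrite big_ord_recl/= add0r /taylor [in RHS]big_ord_recr/= mulrDr.
rewrite [X in _ = _ + X]sderiv_soul_mul0 ?addr0//.
by move=> S Sm; rewrite ffunE (taylor_term_deg _ _ Sm) ?scaler0.
Qed.

End ChainTaylor.

Lemma nbelow_count j (S : {set 'I_m}) :
  nbelow j S = count (fun i => (i \in S) && (i < j)%N) (index_enum 'I_m).
Proof.
rewrite /nbelow -sum1_count -sum1_card; apply: eq_bigl => i; by rewrite inE.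
Qed.

Lemma index_enum_ord_sorted : sorted (fun i j : 'I_m => (i < j)%N) (index_enum 'I_m).
Proof.
have -> : index_enum 'I_m = enum 'I_m by rewrite enumT /index_enum unlock.
by have := iota_ltn_sorted 0 m; rewrite -val_enum_ord sorted_map.
Qed.

Section OddProducts.
Variables (a : 'I_(n + m)) (eta : 'I_m -> SF) (x : 'rV[R]_n).
Hypotheses (deta : forall j, gdiff (eta j) x) (oeta : forall j, gparity true (eta j x)).
Hypothesis (odeta : forall j, gparity (par a (+) true) (sderiv a (eta j) x)).

(** An odd factor changes its sign when the derivative passes it, so the j-th term
    carries the number of factors before it; this is the sign of [gderiv]. *)
Lemma sderiv_prod_odd (r : seq 'I_m) (P : pred 'I_m) :
  sorted (fun i j : 'I_m => (i < j)%N) r ->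
  sderiv a (fun y => \prod_(j <- r | P j) eta j y) x =
  \sum_(j <- r | P j) (-1) ^+ count (fun i => P i && (i < j)%N) r *:
    (sderiv a (eta j) x * \prod_(i <- r | P i && (i != j)) eta i x).
Proof.
elim: r => [_|i r IH sr].
  rewrite big_nil; under eq_fun do rewrite big_nil.
  by rewrite -[X in sderiv _ (fun=> X)]scale1r sderiv_cst.
have ir : forall j, j \in r -> (i < j)%N.
  move: sr; rewrite sorted_pairwise; last by move=> ? ? ?; exact: ltn_trans.
  by rewrite pairwise_cons => /andP[/allP].
have {}IH := IH (path_sorted sr).
under eq_fun do rewrite big_cons; rewrite big_cons; case: (boolP (P i)) => Pi; last first.
  rewrite IH; apply: eq_bigr => j _; rewrite /= (negbTE Pi)/= add0n; congr (_ *: (_ * _)).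
  by rewrite big_cons (negbTE Pi).
rewrite sderivM//; last exact: gdiff_prod.
rewrite /= Pi ltnn/= add0n; congr (_ + _).
  rewrite (_ : count _ _ = 0%N) ?scale1r; last first.
    by apply/eqP; rewrite -leqn0 leqNgt -has_count; apply/hasPn => j /ir ij; rewrite negb_and orbC ltnNge ltnW.
  rewrite big_cons Pi eqxx/= big_seq_cond [in RHS]big_seq_cond; congr (_ * _); apply: eq_bigl => j.
  by have [/ir ij|//] := boolP (j \in r); rewrite [j == i](gtn_eqF ij) andbT.
rewrite IH mulr_sumr big_seq_cond [RHS]big_seq_cond; apply: eq_bigr => j /andP[/ir ij Pj].
rewrite ij exprD expr1 -scalerA -scalerAr scaleN1r -scalerN; congr (_ *: _).
rewrite big_cons Pi [i == j](ltn_eqF ij)/= !mulrA -mulNr; congr (_ * _).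
rewrite (gtwist_parity _ (oeta i)) -scalerAl (gmulC (oeta i) (odeta j)) scalerA.
transitivity ((-1 : R) *: (sderiv a (eta j) x * eta i x)); last by rewrite scaleN1r.
congr (_ *: _); rewrite -exprD -[RHS]expr1; apply: signr_odd_eq; by case: (par a).
Qed.

End OddProducts.

(** The chain rule for a change of coordinates that mixes even and odd variables.
    The derivative of the Taylor polynomials accounts for the even coordinates,
    the derivative of the monomials in eta for the odd ones. *)
Lemma sderiv_pullback (V O : set 'rV[R]_n) (Phi : 'I_(n + m) -> SF) F a x :
  open V -> open O -> O x -> smooth V F ->
  (forall y, O y -> V (\row_i gbody (Phi (lshift m i) y))) ->
  (forall b, gdiff (Phi b) x) ->
  (forall b y, O y -> gparity (par b) (Phi b y)) ->
  gdiff (pullback Phi F) x /\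
  sderiv a (pullback Phi F) x = \sum_b sderiv a (Phi b) x * pullback Phi (sderiv b F) x.
Proof.
move=> oV oO Ox sF OV dPhi pPhi.
have nV : \forall y \near x, V (\row_i gbody (Phi (lshift m i) y)).
  by near=> y; apply: OV; near: y; exact: open_nbhs_nbhs.
have eY i : gparity false (Phi (lshift m i) x) by have := pPhi (lshift m i) _ Ox; rewrite par_lshift.
have oeta j : gparity true (Phi (rshift n j) x) by have := pPhi (rshift n j) _ Ox; rewrite par_rshift.
have odeta j : gparity (par a (+) true) (sderiv a (Phi (rshift n j)) x).
  by apply: gparity_sderiv oO Ox _ => y Oy; have := pPhi (rshift n j) _ Oy; rewrite par_rshift.
have Vb := OV _ Ox.
pose Y i := Phi (lshift m i) x; pose eta j := Phi (rshift n j) x.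
pose et (S : {set 'I_m}) := \prod_(j in S) eta j.
have HT (S : {set 'I_m}) := @sderiv_taylor a _ x V oV Vb (fun i => dPhi _) eY nV _ (sF S).
have dP (S : {set 'I_m}) : gdiff (fun y => \prod_(j in S) Phi (rshift n j) y) x by exact: gdiff_prod.
have -> : pullback Phi F = (fun y => \sum_(S : {set 'I_m})
    taylor (fun z => F z S) (fun i => Phi (lshift m i) y) * \prod_(j in S) Phi (rshift n j) y).
  by apply/funext => y; rewrite pullbackE.
split.
  by apply: gdiff_sum => S _; apply: gdiffM => //; case: (HT S).
rewrite sderiv_sum; last by move=> S _; apply: gdiffM => //; case: (HT S).
have DE (S : {set 'I_m}) :
    sderiv a (fun y => taylor (fun z => F z S) (fun i => Phi (lshift m i) y) * \prod_(j in S) Phi (rshift n j) y) x =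
    \sum_i sderiv a (Phi (lshift m i)) x * (taylor (partials [:: i] (fun z => F z S)) Y * et S) +
    \sum_(j in S) sderiv a (Phi (rshift n j)) x *
       ((-1) ^+ nbelow j S *: (taylor (fun z => F z S) Y * et (S :\ j)%SET)).
  have [dT ET] := HT S.
  rewrite sderivM// ET mulr_suml gtwist_even; last exact: taylor_even.
  congr (_ + _); first by apply: eq_bigr => i _; rewrite mulrA.
  rewrite (sderiv_prod_odd (fun j => dPhi _) oeta odeta _ index_enum_ord_sorted).
  rewrite mulr_sumr; apply: eq_bigr => j jS.
  have E : \prod_(i | (i \in S) && (i != j)) Phi (rshift n i) x = et (S :\ j)%SET.
    by apply: eq_bigl => i; rewrite !inE andbC.
  by rewrite E -nbelow_count -!scalerAr mulr_evenCA//; exact: taylor_even.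
rewrite (eq_bigr _ (fun S _ => DE S)) big_split big_split_ord/=; congr (_ + _).
  rewrite exchange_big; apply: eq_bigr => i _; rewrite -mulr_sumr; congr (_ * _).
  rewrite pullbackE; apply: eq_bigr => S _.
  suff -> : (fun z => sderiv (lshift m i) F z S) = partials [:: i] (fun z => F z S) by [].
  by apply/funext => z; rewrite sderiv_even.
rewrite (exchange_big_dep xpredT)//=; apply: eq_bigr => j _; rewrite -mulr_sumr; congr (_ * _).
rewrite pullbackE [RHS](bigID (fun S : {set 'I_m} => j \in S))/= [X in _ = X + _]big1 ?add0r; last first.
  move=> S jS; have -> : (fun z => sderiv (rshift n j) F z S : R^o) = (fun=> 0).
    by apply/funext => z; rewrite sderiv_odd gderivE jS.
  by rewrite taylor0 mul0r.
rewrite (reindex_onto (fun S => j |: S)%SET (fun S => S :\ j)%SET)/=; last first.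
  by move=> S jS; rewrite finset.setD1K.
apply: eq_big => [S|S jS].
  rewrite setU11/=; apply/eqP/idP => [<-|jS]; first by rewrite !inE eqxx.
  by rewrite finset.setU1K.
have {}jS : j \notin S by case/andP: jS => _ /eqP <-; rewrite !inE eqxx.
rewrite finset.setU1K//.
have -> : (fun z => sderiv (rshift n j) F z S : R^o) = (fun z => (-1) ^+ nbelow j S * F z (j |: S)%SET).
  by apply/funext => z; rewrite sderiv_odd gderivE (negbTE jS).
rewrite (taylorZ _ oV (sF _) Vb) -scalerAl; congr (_ *: _).
congr (_ ^+ _); rewrite nbelowU ?disjoints1// -[RHS]add0n; congr (_ + _)%N.
apply/eqP; rewrite cards_eq0; apply/eqP/setP => i; rewrite !inE; case: eqP => //= ->; exact: ltnn.
Unshelve. all: by end_near. Qed.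

Section PullbackLinear.
Variables (Phi : 'I_(n + m) -> SF) (V : set 'rV[R]_n) (x : 'rV[R]_n).
Hypotheses (oV : open V) (Vb : V (\row_i gbody (Phi (lshift m i) x))).

Lemma pullbackD F H : smooth V F -> smooth V H ->
  pullback Phi (fun y => F y + H y) x = pullback Phi F x + pullback Phi H x.
Proof.
move=> sF sH; rewrite !pullbackE -big_split; apply: eq_bigr => S _ /=; rewrite -mulrDl.
rewrite -(taylorD oV (sF S) (sH S) Vb) (_ : (fun z => (F z + H z) S) = (fun z => F z S + H z S))//.
by apply/funext => z; rewrite gaddE.
Qed.

Lemma pullbackZ (c : R) F : smooth V F ->
  pullback Phi (fun y => c *: F y) x = c *: pullback Phi F x.
Proof.
move=> sF; rewrite !pullbackE scaler_sumr; apply: eq_bigr => S _; rewrite scalerAl.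
rewrite -(taylorZ c oV (sF S) Vb) (_ : (fun z => (c *: F z) S) = (fun z => c * F z S))//.
by apply/funext => z; rewrite ffunE.
Qed.

Lemma pullback0 : pullback Phi (fun=> 0) x = 0.
Proof.
rewrite pullbackE big1// => S _; rewrite (_ : (fun z => (0 : G) S) = (fun=> 0)) ?taylor0 ?mul0r//.
by apply/funext => z; rewrite ffunE.
Qed.

Lemma pullback_sum (I : Type) (r : seq I) (F : I -> SF) : (forall i, smooth V (F i)) ->
  pullback Phi (fun y => \sum_(i <- r) F i y) x = \sum_(i <- r) pullback Phi (F i) x.
Proof.
move=> sF; elim: r => [|i r IH].
  by rewrite big_nil; under eq_fun do rewrite big_nil; exact: pullback0.
rewrite big_cons -IH; under eq_fun do rewrite big_cons.
by apply: pullbackD => //; apply: smooth_sum.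
Qed.

End PullbackLinear.

End TaylorExpansion.

(** * Powers, logarithms and the Berezinian *)
Section SuperMatrices.
Variables (R : realType) (n m : nat).
Local Notation SF := (superfun R n m).
Local Notation G := (grassmann R m).
Implicit Types (F H : SF) (x y : 'rV[R]_n) (V : set 'rV[R]_n).

Definition gmxpar (q : bool) k l (M : 'M[G]_(k, l)) := forall i j, gparity q (M i j).

Lemma gmxparM q r k l o (M : 'M[G]_(k, l)) (N : 'M[G]_(l, o)) :
  gmxpar q M -> gmxpar r N -> gmxpar (q (+) r) (M *m N).
Proof.
by move=> pM pN i j; rewrite mxE; apply: gparity_sum => u _; apply: gparityM.
Qed.

Lemma gmxparD q k l (M N : 'M[G]_(k, l)) : gmxpar q M -> gmxpar q N -> gmxpar q (M + N).
Proof. by move=> pM pN i j; rewrite mxE; apply: gparityD. Qed.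

Lemma gmxparN q k l (M : 'M[G]_(k, l)) : gmxpar q M -> gmxpar q (- M).
Proof. by move=> pM i j; rewrite mxE; apply: gparityN. Qed.

Lemma gmxparZ q k l (c : G) (M : 'M[G]_(k, l)) : gparity false c -> gmxpar q M -> gmxpar q (c *: M).
Proof. by move=> ec pM i j; rewrite mxE; apply: (@gparityM _ _ false q). Qed.

Lemma scaler_signr (q : bool) (c : G) : ((-1) ^+ q : R) *: c = (-1) ^+ q * c.
Proof. by case: q; rewrite ?expr1 ?expr0 ?mulN1r ?scaleN1r ?mul1r ?scale1r. Qed.

Lemma gmxtraceN k (M : 'M[G]_k) : \tr (- M) = - \tr M.
Proof. by rewrite -scaleN1r mxtraceZ mulN1r. Qed.

Lemma gmxtraceB k (M N : 'M[G]_k) : \tr (M - N) = \tr M - \tr N.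
Proof. by rewrite -scaleN1r mxtraceD mxtraceZ mulN1r. Qed.

(** The trace is cyclic only up to the sign of the exchange of homogeneous
    entries. *)
Lemma gmxtraceC q r k l (M : 'M[G]_(k, l)) (N : 'M[G]_(l, k)) :
  gmxpar q M -> gmxpar r N -> \tr (M *m N) = (-1) ^+ (q && r) * \tr (N *m M).
Proof.
move=> pM pN; rewrite /mxtrace mulr_sumr.
under eq_bigr do rewrite mxE.
under [RHS]eq_bigr do rewrite mxE mulr_sumr.
rewrite exchange_big; apply: eq_bigr => j _; apply: eq_bigr => i _.
by rewrite -scaler_signr; exact: gmulC.
Qed.

End SuperMatrices.

Section RealDerivatives.
Variable R : realType.
Implicit Types (f g : R -> R) (O : set R) (s w : R).

Lemma derivable_local O f g s : open O -> O s -> (forall t, O t -> f t = g t) ->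
  derivable f s 1 -> derivable g s 1.
Proof.
move=> oO Os fg; apply: near_eq_derivable; near=> t.
by apply: fg; near: t; exact: open_nbhs_nbhs.
Unshelve. all: by end_near. Qed.

(** If the functions h k are successive derivatives on O, then they are the
    iterated derivatives of any f that agrees with h 0 there. *)
Lemma derive1n_family O (h : nat -> R -> R) f :
  open O -> (forall s, O s -> f s = h 0%N s) ->
  (forall k s, O s -> is_derive s 1 (h k) (h k.+1 s)) ->
  forall k s, O s -> f^`(k)%classic s = h k s /\ derivable (f^`(k)%classic) s 1.
Proof.
move=> oO fh dh; have E k : forall s, O s -> f^`(k)%classic s = h k s.
  elim: k => [|k IH] s Os; first exact: fh.
  rewrite derive1nS derive1E (_ : 'D_1 _ s = 'D_1 (h k) s).
    by have D := dh k s Os; rewrite derive_val.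
  by apply: near_eq_derive; near=> t; apply: IH; near: t; exact: open_nbhs_nbhs.
move=> k s Os; split; first exact: E.
apply: (derivable_local (f := h k) oO Os) => [t Ot|]; first by rewrite E.
by have D := dh k s Os; exact: (@ex_derive _ _ _ _ _ _ _ D).
Unshelve. all: by end_near. Qed.

Definition inv_family k s : R := (-1) ^+ k * k`!%:R * s^-1 ^+ k.+1.

Lemma derive1n_inv k s : s != 0 ->
  (@GRing.inv R)^`(k)%classic s = inv_family k s /\ derivable ((@GRing.inv R)^`(k)%classic) s 1.
Proof.
move: k s; apply: (@derive1n_family [set s | s != 0] inv_family).
- exact: open_neq.
- by move=> s _; rewrite /inv_family expr1 fact0 !mul1r.
move=> {}k s s0; rewrite /inv_family.
have D : is_derive s 1 (fun t : R => t^-1) (- s ^- 2).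
  apply: is_derive_eq; first by apply: derivableP; exact: derivableV.
  by rewrite deriveV// derive_id /GRing.scale/= mulr1.
have -> : (fun t : R => (-1) ^+ k * k`!%:R * t^-1 ^+ k.+1) = ((-1) ^+ k * k`!%:R) \*: ((fun t : R => t^-1) ^+ k.+1).
  by apply/funext => t; rewrite fctE.
apply: is_derive_eq.
rewrite /GRing.scale/= factS natrM [in RHS]exprS -exprVn; set v := s^-1.
rewrite [v ^+ k.+2]exprS [v ^+ k.+1]exprS [v ^+ 2]expr2.
by move: ((-1) ^+ k) (v ^+ k) => A B; ring.
Qed.

Fixpoint falling w k : R := if k is k'.+1 then falling w k' * (w - k'%:R) else 1.

Definition pow_family w k s : R := falling w k * s `^ (w - k%:R).

Lemma derive1n_powR w k s : 0 < s ->
  (fun t => t `^ w)^`(k)%classic s = pow_family w k s /\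
  derivable ((fun t => t `^ w)^`(k)%classic) s 1.
Proof.
move: k s; apply: (@derive1n_family [set s | 0 < s] (pow_family w)).
- exact: open_gt.
- by move=> s _; rewrite /pow_family mul1r subr0.
move=> k s s0; rewrite /pow_family.
have sI : s \in `]0, +oo[%R by rewrite in_itv/= andbT.
have D : is_derive s 1 (fun t : R => t `^ (w - k%:R)) ((w - k%:R) * s `^ (w - k%:R - 1)).
  by apply: DeriveDef; [exact: derivable_powR|rewrite -derive1E powR_derive1].
have -> : (fun t : R => falling w k * t `^ (w - k%:R)) = falling w k \*: (fun t : R => t `^ (w - k%:R)) by [].
apply: is_derive_eq; rewrite /GRing.scale/= mulrA -natr1; congr (_ * _ `^ _); ring.
Qed.

Lemma derive1n_ln k s : 0 < s ->
  (@ln R)^`(k.+1)%classic s = inv_family k s /\ derivable ((@ln R)^`(k)%classic) s 1.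
Proof.
pose h k s := if k is k'.+1 then inv_family k' s else ln s.
have H : forall k s, [set s | 0 < s] s -> (@ln R)^`(k)%classic s = h k s /\ derivable ((@ln R)^`(k)%classic) s 1.
  apply: (@derive1n_family [set s | 0 < s] h).
  - exact: open_gt.
  - by [].
  move=> [|{}k] {}s /= s0.
    have -> : inv_family 0 s = s^-1 by rewrite /inv_family expr1 fact0 !mul1r.
    exact: is_derive1_ln.
  have s1 : s != 0 by rewrite gt_eqF.
  have O (t : R) : 0 < t -> (@GRing.inv R)^`(k)%classic t = inv_family k t.
    move=> t0; have t1 : t != 0 by rewrite gt_eqF.
    by have [-> _] := derive1n_inv k t1.
  have [E1 d1] := derive1n_inv k.+1 s1; have [E d] := derive1n_inv k s1.
  apply: DeriveDef; first by apply: (derivable_local (O := [set s | 0 < s])) d => //; exact: open_gt.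
  rewrite -E1 derive1nS derive1E; apply: near_eq_derive; near=> t.
  by rewrite O//; near: t; exact: lt_nbhsr.
by move=> s0; split; [have [] := H k.+1 s s0|have [] := H k s s0].
Unshelve. all: by end_near. Qed.

End RealDerivatives.

Section GapplyIdentities.
Variables (R : realType) (n m : nat).
Local Notation SF := (superfun R n m).
Local Notation G := (grassmann R m).
Implicit Types (u : G) (F : SF) (x : 'rV[R]_n).

Lemma gtaylor_delta u : gtaylor (fun k => (k == 0%N)%:R) u = 1.
Proof.
rewrite /gtaylor big_ord_recl/= fact0 divr1 expr0 scale1r big1 ?addr0// => k _.
by rewrite mul0r scale0r.
Qed.

Lemma gtaylor_invK u : gparity false u -> gbody u != 0 ->
  gtaylor (fun k => inv_family k (gbody u)) u * u = 1.
Proof.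
move=> eu u0; rewrite gtaylor_mulid// -[RHS](gtaylor_delta u); apply: eq_gtaylor => k.
rewrite /inv_family; set v := (gbody u)^-1.
have vu : v * gbody u = 1 by rewrite mulVf.
case: k => [|k]; first by rewrite mul0r addr0 expr0 fact0 !mul1r expr1 vu.
rewrite /= [v ^+ k.+2]exprSr factS natrM exprS.
move: ((-1) ^+ k) (v ^+ k.+1) => A B; transitivity (A * B * (k.+1)%:R * k`!%:R * (1 - v * gbody u)); first by ring.
by rewrite vu subrr mulr0.
Qed.

Lemma gapply_invK u : gparity false u -> gbody u != 0 -> gapply GRing.inv u * u = 1.
Proof.
move=> eu u0; rewrite gapplyE -[RHS](gtaylor_invK eu u0); congr (_ * _).
by apply: eq_gtaylor => k; have [] := derive1n_inv k u0.
Qed.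

Lemma gapply_lnK u : gparity false u -> 0 < gbody u -> gapply (@ln R)^`()%classic u * u = 1.
Proof.
move=> eu u0; rewrite gapplyE -[RHS](gtaylor_invK eu) ?gt_eqF//; congr (_ * _).
by apply: eq_gtaylor => k; rewrite -derive1Sn; have [] := derive1n_ln k u0.
Qed.

(** The identity s * (s^w)' = w s^w on Taylor coefficients. *)
Lemma gapply_powRK w u : gparity false u -> 0 < gbody u ->
  gapply (fun s => s `^ w)^`()%classic u * u = w *: gapply (fun s => s `^ w) u.
Proof.
move=> eu u0; rewrite !gapplyE -gtaylorZ (gtaylor_mulid _ eu); apply: eq_gtaylor => k.
rewrite -!derive1Sn; have [-> _] := derive1n_powR w k u0; have [-> _] := derive1n_powR w k.+1 u0.
have E l : gbody u `^ (w - l.+1%:R) * gbody u = gbody u `^ (w - l%:R).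
  have -> : w - l%:R = (w - l.+1%:R) + 1 by rewrite -natr1; ring.
  have C : ((w - l.+1%:R) + 1 == 0) ==> (gbody u != 0) by rewrite (gt_eqF u0) implybT.
  by rewrite (powRD C) powRr1// ltW.
rewrite /pow_family -mulrA E; case: k => [|k]; first by rewrite /= mul0r addr0 subr0; ring.
have [-> _] := derive1n_powR w k.+1 u0; rewrite /pow_family /= -!natr1; ring.
Qed.

Lemma gapply_even (g : R -> R) u : gparity false u -> gparity false (gapply g u).
Proof. by move=> eu; rewrite gapplyE; exact: gtaylor_even. Qed.

Lemma gbody_gapply (g : R -> R) u : gbody (gapply g u) = g (gbody u).
Proof. by rewrite gapplyE gtaylor_body. Qed.

(** Derivatives of powers of an even function are expressed through its
    logarithmic derivative, whose product with the function is the plain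
    derivative. *)
Lemma sderiv_powR_ln a w F x : gdiff F x -> gparity false (F x) -> 0 < gbody (F x) ->
  [/\ gdiff (fun y => gapply (fun s => s `^ w) (F y)) x,
      gdiff (fun y => gapply (@ln R) (F y)) x,
      sderiv a (fun y => gapply (fun s => s `^ w) (F y)) x =
        w *: (gapply (fun s => s `^ w) (F x) * sderiv a (fun y => gapply (@ln R) (F y)) x)
    & F x * sderiv a (fun y => gapply (@ln R) (F y)) x = sderiv a F x].
Proof.
move=> dF eF F0.
have [d1 E1] := @sderiv_gapply _ _ _ a (fun s => s `^ w) F x dF eF (fun k => proj2 (derive1n_powR w k F0)).
have [d2 E2] := @sderiv_gapply _ _ _ a (@ln R) F x dF eF (fun k => proj2 (derive1n_ln k F0)).
have EL : F x * sderiv a (fun y => gapply (@ln R) (F y)) x = sderiv a F x.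
  by rewrite E2 mulrA (gevenC _ eF) gapply_lnK// mul1r.
split=> //; rewrite E1 -EL mulrA gapply_powRK//; exact/esym/scalerAl.
Qed.

Lemma sderiv_inv a F x (V : set 'rV[R]_n) : open V -> V x ->
  (forall y, V y -> gparity false (F y)) -> (forall y, V y -> gbody (F y) != 0) -> gdiff F x ->
  gdiff (fun y => gapply GRing.inv (F y)) x /\
  sderiv a (fun y => gapply GRing.inv (F y)) x =
  - (gapply GRing.inv (F x) * gapply GRing.inv (F x) * sderiv a F x).
Proof.
move=> oV Vx eF F0 dF.
have [d E] := @sderiv_gapply _ _ _ a (@GRing.inv R) F x dF (eF _ Vx) (fun k => proj2 (derive1n_inv k (F0 _ Vx))).
split=> //; set v := gapply _ (F x).
have ev : gparity false v by apply: gapply_even; exact: eF.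
have vF : v * F x = 1 by apply: gapply_invK; [exact: eF|exact: F0].
have : sderiv a (fun y => gapply GRing.inv (F y) * F y) x = 0.
  rewrite -(@sderiv_cst R n m 1 a x); apply: (sderiv_local _ oV Vx) => y Vy.
  by rewrite scale1r gapply_invK//; [exact: eF|exact: F0].
rewrite sderivM// gtwist_even// -/v => /eqP; rewrite addr_eq0 => /eqP H.
have Fv : F x * v = 1 by rewrite gevenC// ; exact: eF.
rewrite -[LHS]mulr1 -Fv mulrA H mulNr; congr (- _).
by rewrite -mulrA -(gevenC _ ev) mulrA.
Qed.

End GapplyIdentities.

Section LogDerivativeDet.
Variables (R : realType) (n m : nat) (b : 'I_(n + m)) (x : 'rV[R]_n).
Local Notation SF := (superfun R n m).
Local Notation G := (grassmann R m).

Definition mxdiff k l (M : 'rV[R]_n -> 'M[G]_(k, l)) := forall i j, gdiff (fun y => M y i j) x.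
Definition mxderiv k l (M : 'rV[R]_n -> 'M[G]_(k, l)) : 'M[G]_(k, l) :=
  \matrix_(i, j) sderiv b (fun y => M y i j) x.
Definition mxtwist k l (M : 'M[G]_(k, l)) : 'M[G]_(k, l) := map_mx (gtwist (par b)) M.

Lemma mxdiffM k l o (M : 'rV[R]_n -> 'M[G]_(k, l)) (N : 'rV[R]_n -> 'M[G]_(l, o)) :
  mxdiff M -> mxdiff N -> mxdiff (fun y => M y *m N y).
Proof.
move=> dM dN i j; under eq_fun do rewrite mxE.
by apply: gdiff_sum => u _; apply: gdiffM.
Qed.

Lemma mxderivM k l o (M : 'rV[R]_n -> 'M[G]_(k, l)) (N : 'rV[R]_n -> 'M[G]_(l, o)) :
  mxdiff M -> mxdiff N ->
  mxderiv (fun y => M y *m N y) = mxderiv M *m N x + mxtwist (M x) *m mxderiv N.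
Proof.
move=> dM dN; apply/matrixP => i j; rewrite !mxE -big_split/=.
under [in LHS]eq_fun do rewrite mxE.
rewrite sderiv_sum; last by move=> u _; apply: gdiffM.
by apply: eq_bigr => u _; rewrite sderivM// !mxE.
Qed.

Lemma mxderivB k l (M N : 'rV[R]_n -> 'M[G]_(k, l)) : mxdiff M -> mxdiff N ->
  mxderiv (fun y => M y - N y) = mxderiv M - mxderiv N.
Proof.
move=> dM dN; apply/matrixP => i j; rewrite !mxE -sderivB//.
by congr (sderiv _ _ _); apply/funext => y; rewrite !mxE.
Qed.

Lemma mxdiffB k l (M N : 'rV[R]_n -> 'M[G]_(k, l)) : mxdiff M -> mxdiff N -> mxdiff (fun y => M y - N y).
Proof.
by move=> dM dN i j; under eq_fun do rewrite !mxE; apply: gdiffB.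
Qed.

Lemma mxtwist_par q k l (M : 'M[G]_(k, l)) : gmxpar q M ->
  mxtwist M = (-1) ^+ (par b && q) *: M.
Proof. by move=> pM; apply/matrixP => i j; rewrite !mxE (gtwist_parity _ (pM i j)) scaler_signr. Qed.

Lemma mxtwist_even k l (M : 'M[G]_(k, l)) : gmxpar false M -> mxtwist M = M.
Proof. by move=> pM; rewrite (mxtwist_par pM) andbF scale1r. Qed.

Lemma sderiv_prod_even (I : eqType) (r : seq I) (f : I -> SF) :
  uniq r -> (forall i, gdiff (f i) x) -> (forall i, gparity false (f i x)) ->
  sderiv b (fun y => \prod_(i <- r) f i y) x =
  \sum_(i <- r) \prod_(k <- r | i != k) f k x * sderiv b (f i) x.
Proof.
move=> + df ef; elim: r => [_|i r IH /andP[ir ur]].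
  rewrite big_nil; under eq_fun do rewrite big_nil.
  by rewrite -[X in sderiv _ (fun=> X)]scale1r sderiv_cst.
under eq_fun do rewrite big_cons; rewrite big_cons sderivM//; last exact: gdiff_prod.
rewrite gtwist_even// IH// mulr_sumr; congr (_ + _).
  rewrite big_cons eqxx/= -gevenC; last exact: gparity_prod_even.
  congr (_ * _); rewrite big_seq [RHS]big_seq_cond; apply: eq_bigl => j.
  by have [jr|//] := boolP (j \in r); case: eqVneq => // ij; rewrite ij jr in ir.
apply: eq_big_seq => j jr; rewrite big_cons mulrA.
by case: eqVneq => // ij; rewrite -ij jr in ir.
Qed.

Lemma mxdiff_det k (M : 'rV[R]_n -> 'M[G]_k) : mxdiff M -> gdiff (fun y => \det (M y)) x.
Proof.
move=> dM; apply: gdiff_sum => s _; apply: gdiffM; first exact: gdiff_cst.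
by apply: gdiff_prod => i _; exact: dM.
Qed.

(** Jacobi's formula: the even entries of M x commute with everything, so the
    differentiated factor of each product can be moved to the right, and the rest
    is a cofactor. *)
Lemma sderiv_det k (M : 'rV[R]_n -> 'M[G]_k) : mxdiff M -> gmxpar false (M x) ->
  sderiv b (fun y => \det (M y)) x = \tr (\adj (M x) *m mxderiv M).
Proof.
move=> dM eM.
have -> : (fun y => \det (M y)) = (fun y => \sum_(s : 'S_k) ((-1) ^+ s : R) *: \prod_i M y i (s i)).
  apply/funext => y; apply: eq_bigr => s _.
  by rewrite scaler_signr.
have dP (s : 'S_k) : gdiff (fun y => \prod_i M y i (s i)) x by apply: gdiff_prod => i _; exact: dM.
rewrite sderiv_sum; last by move=> s _; apply: gdiffZ.
transitivity (\sum_(s : 'S_k) \sum_i ((-1) ^+ s * \prod_(l | i != l) M x l (s l)) * sderiv b (fun y => M y i (s i)) x).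
  apply: eq_bigr => s _; rewrite sderivZ//.
  rewrite (@sderiv_prod_even _ (index_enum 'I_k) (fun i y => M y i (s i)))//; last exact: index_enum_uniq.
  rewrite scaler_sumr; apply: eq_bigr => i _.
  by rewrite scalerAl scaler_signr.
rewrite exchange_big /mxtrace.
under [RHS]eq_bigr do rewrite mxE.
rewrite [RHS]exchange_big; apply: eq_bigr => i _.
rewrite (partition_big (fun s : 'S_k => s i) xpredT)//=; apply: eq_bigr => j _.
rewrite !mxE (gexpand_cofactor i j eM) mulr_suml; apply: eq_bigr => s /eqP si.
by rewrite si.
Qed.

End LogDerivativeDet.

(** The inverse of a block matrix in terms of the inverse of a diagonal block and
    of its Schur complement, over a non-commutative ring. *)
Lemma block_inverse (T : pzRingType) k l (a : 'M[T]_k) (b : 'M[T]_(k, l))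
    (c : 'M[T]_(l, k)) (d : 'M[T]_l) (Si : 'M[T]_k) (Di : 'M[T]_l) :
  d *m Di = 1%:M -> Di *m d = 1%:M ->
  (a - b *m Di *m c) *m Si = 1%:M -> Si *m (a - b *m Di *m c) = 1%:M ->
  let B := block_mx Si (- (Si *m b *m Di))
    (- (Di *m c *m Si)) (Di + Di *m c *m Si *m b *m Di) in
  block_mx a b c d *m B = 1%:M /\ B *m block_mx a b c d = 1%:M.
Proof.
move=> dDi Did; rewrite mulmxBl mulmxBr !mulmxA => E1 E2 B; rewrite /B !mulmx_block.
have E1' : a *m Si = 1%:M + b *m Di *m c *m Si by rewrite -E1 subrK.
have E2' : Si *m a = 1%:M + Si *m b *m Di *m c by rewrite -E2 subrK.
split; rewrite [RHS](@scalar_mx_block _ k l 1); congr block_mx.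
- by rewrite mulmxN !mulmxA.
- by rewrite mulmxN mulmxDr !mulmxA E1' !mulmxDl !mul1mx addNr.
- by rewrite mulmxN !mulmxA dDi mul1mx subrr.
- by rewrite mulmxDr mulmxN !mulmxA dDi mul1mx addrCA addNr addr0.
- by rewrite mulNmx.
- by rewrite mulNmx -!mulmxA Did mulmx1 subrr.
- by rewrite mulNmx mulmxDl -[_ *m Si *m a]mulmxA E2' mulmxDr mulmx1 !mulmxA addNr.
- by rewrite mulNmx mulmxDl -[_ *m Di *m d]mulmxA Did mulmx1 addrCA addNr addr0.
Qed.

Section SuperInverse.
Variables (R : realType) (n m : nat).
Local Notation G := (grassmann R m).
Implicit Types A : 'M[G]_(n + m).

Lemma gscalemxAr (d : G) k l o (M : 'M[G]_(k, l)) (N : 'M[G]_(l, o)) : gparity false d ->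
  M *m (d *: N) = d *: (M *m N).
Proof.
move=> ed; apply/matrixP => i j; rewrite !mxE mulr_sumr; apply: eq_bigr => u _.
by rewrite mxE; exact/esym/mulr_evenCA.
Qed.

(** The inverse of an even matrix with invertible body, in the form in which it
    occurs in the Berezinian. *)
Definition evinv k (M : 'M[G]_k) : 'M[G]_k := gapply GRing.inv (\det M) *: \adj M.

Lemma evinv_even k (M : 'M[G]_k) : gmxpar false M -> gmxpar false (evinv M).
Proof. by move=> eM; apply: gmxparZ; [exact/gapply_even/gdet_even|exact: gadj_even]. Qed.

Lemma evinvK k (M : 'M[G]_k) : gmxpar false M -> gbody (\det M) != 0 ->
  M *m evinv M = 1%:M /\ evinv M *m M = 1%:M.
Proof.
move=> eM M0; have ed := gapply_even GRing.inv (gdet_even eM).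
have E := gapply_invK (gdet_even eM) M0.
rewrite /evinv gscalemxAr// -scalemxAl gmul_mx_adj// gmul_adj_mx//.
by rewrite scale_scalar_mx E.
Qed.

Definition super_parity A := forall a a', gparity (par a (+) par a') (A a a').

Definition schur A : 'M[G]_n := ulsubmx A - ursubmx A *m evinv (drsubmx A) *m dlsubmx A.

Definition superinv A : 'M[G]_(n + m) :=
  let Si := evinv (schur A) in let Di := evinv (drsubmx A) in
  block_mx Si (- (Si *m ursubmx A *m Di))
    (- (Di *m dlsubmx A *m Si)) (Di + Di *m dlsubmx A *m Si *m ursubmx A *m Di).

Lemma berezinianE A :
  berezinian A = \det (schur A) * gapply GRing.inv (\det (drsubmx A)).
Proof. by []. Qed.

Section Fixed.
Variables (A : 'M[G]_(n + m)) (pA : super_parity A) (A0 : gbody (berezinian A) != 0).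

Lemma parUL : gmxpar false (ulsubmx A).
Proof. by move=> i j; rewrite !mxE; have := @pA (lshift m i) (lshift m j); rewrite !par_lshift. Qed.
Lemma parUR : gmxpar true (ursubmx A).
Proof. by move=> i j; rewrite !mxE; have := @pA (lshift m i) (rshift n j); rewrite par_lshift par_rshift. Qed.
Lemma parDL : gmxpar true (dlsubmx A).
Proof. by move=> i j; rewrite !mxE; have := @pA (rshift n i) (lshift m j); rewrite par_lshift par_rshift. Qed.
Lemma parDR : gmxpar false (drsubmx A).
Proof. by move=> i j; rewrite !mxE; have := @pA (rshift n i) (rshift n j); rewrite !par_rshift. Qed.

Lemma schur_even : gmxpar false (schur A).
Proof.
apply: gmxparD; first exact: parUL.
apply: gmxparN; apply: (@gmxparM _ _ true true); last exact: parDL.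
by apply: (@gmxparM _ _ true false); [exact: parUR|apply/evinv_even/parDR].
Qed.

Lemma body_neq0 : gbody (\det (schur A)) != 0 /\ gbody (\det (drsubmx A)) != 0.
Proof.
move: A0; rewrite berezinianE rmorphM/= gbody_gapply mulf_eq0 negb_or => /andP[-> ].
by rewrite invr_eq0.
Qed.

Lemma berezinian_even : gparity false (berezinian A).
Proof.
apply: (@gparityM _ _ false false); first exact/gdet_even/schur_even.
exact/gapply_even/gdet_even/parDR.
Qed.

Lemma superinvK : A *m superinv A = 1%:M /\ superinv A *m A = 1%:M.
Proof.
have [S0 D0] := body_neq0.
have [SSi SiS] := evinvK schur_even S0; have [DDi DiD] := evinvK parDR D0.
rewrite -{1 4}(submxK A); apply: block_inverse => //.
Qed.
End Fixed.
End SuperInverse.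

Section BerezinianDerivative.
Variables (R : realType) (n m : nat) (b : 'I_(n + m)) (x : 'rV[R]_n) (O : set 'rV[R]_n).
Local Notation SF := (superfun R n m).
Local Notation G := (grassmann R m).
Local Notation mxdiff := (@mxdiff R n m x _ _).
Local Notation mxderiv := (@mxderiv R n m b x _ _).
Hypotheses (oO : open O) (Ox : O x).

Lemma mxderiv_local k l (M N : 'rV[R]_n -> 'M[G]_(k, l)) :
  (forall y, O y -> M y = N y) -> mxderiv M = mxderiv N.
Proof.
move=> MN; apply/matrixP => i j; rewrite !mxE; apply: (sderiv_local _ oO Ox) => y Oy.
by rewrite MN.
Qed.

Lemma mxdiff_evinv k (M : 'rV[R]_n -> 'M[G]_k) : mxdiff M ->
  (forall y, O y -> gmxpar false (M y)) -> (forall y, O y -> gbody (\det (M y)) != 0) ->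
  mxdiff (fun y => evinv (M y)).
Proof.
move=> dM eM M0 i j; under eq_fun do rewrite !mxE.
apply: gdiffM.
  have [] // := @sderiv_inv _ _ _ b (fun y => \det (M y)) x O oO Ox.
  - by move=> y Oy; exact/gdet_even/eM.
  - exact: mxdiff_det.
apply: gdiffM; first exact: gdiff_cst.
by apply: mxdiff_det => i' j'; under eq_fun do rewrite !mxE; exact: dM.
Qed.

(** Differentiate M^-1 M = 1. *)
Lemma mxderiv_evinv k (M : 'rV[R]_n -> 'M[G]_k) : mxdiff M ->
  (forall y, O y -> gmxpar false (M y)) -> (forall y, O y -> gbody (\det (M y)) != 0) ->
  mxderiv (fun y => evinv (M y)) = - (evinv (M x) *m mxderiv M *m evinv (M x)).
Proof.
move=> dM eM M0; have di := mxdiff_evinv dM eM M0.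
have [MI IM] := evinvK (eM _ Ox) (M0 _ Ox).
have : mxderiv (fun y => evinv (M y) *m M y) = 0.
  rewrite (@mxderiv_local _ _ _ (fun=> 1%:M)); last first.
    by move=> y Oy; have [] := evinvK (eM _ Oy) (M0 _ Oy).
  apply/matrixP => i j; rewrite !mxE.
  by rewrite -(sderiv_cst (i == j)%:R b x) scaler_nat.
rewrite mxderivM// (mxtwist_even b (evinv_even (eM _ Ox))) => /eqP; rewrite addr_eq0 => /eqP E.
by rewrite -[LHS]mulmx1 -MI mulmxA E mulNmx.
Qed.

Lemma sderiv_det_log k (M : 'rV[R]_n -> 'M[G]_k) : mxdiff M ->
  gmxpar false (M x) -> gbody (\det (M x)) != 0 ->
  gapply GRing.inv (\det (M x)) * sderiv b (fun y => \det (M y)) x =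
  \tr (evinv (M x) *m mxderiv M).
Proof. by move=> dM eM M0; rewrite sderiv_det// /evinv -scalemxAl mxtraceZ. Qed.

Lemma mxderiv_par q k l (M : 'rV[R]_n -> 'M[G]_(k, l)) : (forall y, O y -> gmxpar q (M y)) ->
  gmxpar (par b (+) q) (mxderiv M).
Proof. by move=> pM i j; rewrite mxE; apply: gparity_sderiv oO Ox _ => y Oy; exact: pM. Qed.

Lemma mxderiv_schur k l (a : 'rV[R]_n -> 'M[G]_k) (bb : 'rV[R]_n -> 'M[G]_(k, l))
  (c : 'rV[R]_n -> 'M[G]_(l, k)) (d : 'rV[R]_n -> 'M[G]_l) :
  mxdiff a -> mxdiff bb -> mxdiff c -> mxdiff d ->
  (forall y, O y -> gmxpar false (d y)) -> gmxpar true (bb x) ->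
  (forall y, O y -> gbody (\det (d y)) != 0) ->
  mxdiff (fun y => a y - bb y *m evinv (d y) *m c y) /\
  mxderiv (fun y => a y - bb y *m evinv (d y) *m c y) =
    mxderiv a - ((mxderiv bb *m evinv (d x)
      - (-1) ^+ par b *: (bb x *m evinv (d x) *m mxderiv d *m evinv (d x))) *m c x
      + (-1) ^+ par b *: (bb x *m evinv (d x) *m mxderiv c)).
Proof.
move=> da db dc dd ed pb d0; have dD := mxdiff_evinv dd ed d0.
have dbD := mxdiffM db dD.
have pbD : gmxpar true (bb x *m evinv (d x)).
  by apply: (@gmxparM _ _ true false) => //; apply/evinv_even/ed.
split; first by apply: mxdiffB => //; exact: mxdiffM.
rewrite mxderivB//; last exact: mxdiffM.
rewrite (mxderivM b dbD dc) (mxderivM b db dD) (mxderiv_evinv dd ed d0).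
rewrite (mxtwist_par b pb) (mxtwist_par b pbD) andbT.
move: (evinv (d x)) (bb x) (c x) (mxderiv a) (mxderiv bb) (mxderiv c) (mxderiv d).
by move=> Di B C da' dB dC dD'; rewrite mulmxN -!scalemxAl !mulmxA.
Qed.

Lemma zmod_trace (V : zmodType) (t0 u2 t5 u3 t4 : V) :
  t0 - (- u2 - - t5 + u3) - t4 = t0 - u3 + u2 - (t4 + t5).
Proof.
rewrite !opprD !opprK !addrA.
by rewrite [in RHS](ACl (1*3*5*2*4)).
Qed.

(** The traces from the derivatives of the two determinants combine, after cyclic
    rotations with their signs, into the blocks of the inverse of the full
    matrix. *)
Lemma trace_schur k l (a Si : 'M[G]_k) (B dB : 'M[G]_(k, l)) (C dC : 'M[G]_(l, k)) (Di dD : 'M[G]_l) :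
  gmxpar false Si -> gmxpar false Di -> gmxpar true B -> gmxpar true C ->
  gmxpar (~~ par b) dB -> gmxpar (par b) dD ->
  \tr (Si *m (a - ((dB *m Di - (-1) ^+ par b *: (B *m Di *m dD *m Di)) *m C
      + (-1) ^+ par b *: (B *m Di *m dC)))) - \tr (Di *m dD) =
  \tr (Si *m a) - (-1) ^+ par b * \tr (Si *m B *m Di *m dC)
  + (-1) ^+ par b * \tr (Di *m C *m Si *m dB)
  - \tr ((Di + Di *m C *m Si *m B *m Di) *m dD).
Proof.
move=> pS pD pb pc pdb pdd.
have p2 : gmxpar true (Di *m C) by apply: (@gmxparM _ _ false true).
have p3 : gmxpar true (Si *m B *m Di).
  by apply: (@gmxparM _ _ true false) => //; apply: (@gmxparM _ _ false true).
have E1 : \tr (Si *m dB *m Di *m C) = - ((-1) ^+ par b * \tr (Di *m C *m Si *m dB)).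
  have p1 : gmxpar (~~ par b) (Si *m dB) by apply: (@gmxparM _ _ false _).
  by rewrite -[in LHS]mulmxA (gmxtraceC p1 p2) andbT !mulmxA; case: (par b); rewrite ?expr0 ?expr1 ?mulN1r ?mul1r ?opprK.
have E2 : (-1) ^+ par b * \tr (Si *m B *m Di *m dD *m Di *m C) = - \tr (Di *m C *m Si *m B *m Di *m dD).
  have p1 : gmxpar (~~ par b) (Si *m B *m Di *m dD) by exact: (@gmxparM _ _ true (par b)).
  by rewrite -[in LHS]mulmxA (gmxtraceC p1 p2) andbT !mulmxA; case: (par b); rewrite ?expr0 ?expr1 ?mulN1r ?mul1r ?opprK.
have es : gparity false ((-1) ^+ par b : G).
  by case: (par b); rewrite ?expr0 ?expr1; [apply/gparityN/gparity1|apply/gparity1].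
rewrite mulmxBr mulmxDr mulmxBl mulmxBr mulmxDl -scalemxAl !gscalemxAr// !mulmxA.
rewrite !(gmxtraceB, mxtraceD) !mxtraceZ E1 E2.
exact: zmod_trace.
Qed.

Lemma quotient_log (f g fi Df Dd t1 t2 : G) : gparity false f -> gparity false g ->
  fi * f = 1 -> fi * Df = t1 -> g * Dd = t2 ->
  Df * g + f * - (g * g * Dd) = f * g * (t1 - t2).
Proof.
move=> ef eg fif <- <-; rewrite mulrBr mulrN; congr (_ - _); last by rewrite !mulrA.
rewrite -(gevenC Df eg) -mulrA (mulr_evenCA _ _ ef); congr (_ * _).
by rewrite mulrA (gevenC fi ef) fif mul1r.
Qed.

Variable Am : 'rV[R]_n -> 'M[G]_(n + m).
Hypotheses (dA : mxdiff Am) (pA : forall y, O y -> super_parity (Am y)).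
Hypothesis A0 : forall y, O y -> gbody (berezinian (Am y)) != 0.

(** The supertrace of a product with the signs that a derivative of parity
    [par b] introduces, written in blocks. *)
Lemma super_trace (M N : 'M[G]_(n + m)) :
  \sum_a \sum_a' (-1) ^+ (par a' (+) ((par a (+) par a') && par b)) * (M a' a * N a a') =
  \tr (ulsubmx M *m ulsubmx N) + (-1) ^+ par b * \tr (ursubmx M *m dlsubmx N)
  - (-1) ^+ par b * \tr (dlsubmx M *m ursubmx N) - \tr (drsubmx M *m drsubmx N).
Proof.
have T (k l : nat) (s : G) (P : 'M[G]_(k, l)) (Q : 'M[G]_(l, k)) :
    s * \tr (P *m Q) = \sum_j \sum_i s * (P i j * Q j i).
  rewrite exchange_big mulr_sumr; apply: eq_bigr => i _; rewrite mxE mulr_sumr.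
  by apply: eq_bigr.
rewrite -[\tr (ulsubmx M *m _)]mul1r -[- (_ * \tr (dlsubmx M *m _))]mulNr.
rewrite -[- \tr _]mulN1r !T big_split_ord/=.
under eq_bigr do rewrite big_split_ord/=.
under [X in _ + X = _]eq_bigr do rewrite big_split_ord/=.
rewrite !big_split/= addrA -!addrA; congr (_ + _).
  apply: eq_bigr => i _; apply: eq_bigr => j _; rewrite !mxE !par_lshift/= expr0; done.
rewrite addrCA; congr (_ + _).
  apply: eq_bigr => i _; apply: eq_bigr => j _; rewrite !mxE par_lshift par_rshift/=; done.
congr (_ + _).
  apply: eq_bigr => i _; apply: eq_bigr => j _; rewrite !mxE par_lshift par_rshift/=.
  by case: (par b); rewrite ?expr0 ?expr1 ?opprK.
apply: eq_bigr => i _; apply: eq_bigr => j _; rewrite !mxE !par_rshift/= expr1; done.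
Qed.

(** The super analogue of Jacobi's formula: the logarithmic derivative of the
    Berezinian is the supertrace of the inverse times the derivative.  The
    Berezinian is a quotient of the determinants of the Schur complement and of
    the odd block, and Jacobi's formula applies to both. *)
Lemma sderiv_berezinian :
  gdiff (fun y => berezinian (Am y)) x /\
  sderiv b (fun y => berezinian (Am y)) x = berezinian (Am x) *
  \sum_a \sum_a' (-1) ^+ (par a' (+) ((par a (+) par a') && par b)) *
     (superinv (Am x) a' a * sderiv b (fun y => Am y a a') x).
Proof.
have dbl : [/\ mxdiff (fun y => ulsubmx (Am y)), mxdiff (fun y => ursubmx (Am y)),
    mxdiff (fun y => dlsubmx (Am y)) & mxdiff (fun y => drsubmx (Am y))].
  by split=> i j; under eq_fun do rewrite !mxE; exact: dA.
case: dbl => da db dc dd.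
have ed y : O y -> gmxpar false (drsubmx (Am y)) by move=> Oy; exact: parDR (pA Oy).
have d0 y : O y -> gbody (\det (drsubmx (Am y))) != 0 by move=> Oy; have [] := body_neq0 (A0 Oy).
have S0 : gbody (\det (schur (Am x))) != 0 by have [] := body_neq0 (A0 Ox).
have pb : gmxpar true (ursubmx (Am x)) by exact: parUR (pA Ox).
have pc : gmxpar true (dlsubmx (Am x)) by exact: parDL (pA Ox).
have eS : gmxpar false (schur (Am x)) by exact: schur_even (pA Ox).
have [dS ES] := mxderiv_schur da db dc dd ed pb d0.
have d1 : gdiff (fun y => \det (schur (Am y))) x by exact: mxdiff_det.
have [d2 E2] := @sderiv_inv _ _ _ b (fun y => \det (drsubmx (Am y))) x O oO Ox
  (fun y Oy => gdet_even (ed y Oy)) d0 (mxdiff_det dd).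
split; first exact: gdiffM.
rewrite (sderivM b d1 d2) E2 gtwist_even; last exact: gdet_even.
have L1 : gapply GRing.inv (\det (schur (Am x))) * sderiv b (fun y => \det (schur (Am y))) x =
  \tr (evinv (schur (Am x)) *m mxderiv (fun y => schur (Am y))) := sderiv_det_log dS eS S0.
have L2 := sderiv_det_log dd (ed _ Ox) (d0 _ Ox).
have ef : gparity false (\det (schur (Am x))) by exact: gdet_even.
have eg : gparity false (gapply GRing.inv (\det (drsubmx (Am x)))).
  by apply: gapply_even; apply: gdet_even; exact: ed.
have Ef := gapply_invK ef S0.
apply: etrans (quotient_log ef eg Ef L1 L2) _.
rewrite -berezinianE.
have {}ES : mxderiv (fun y => schur (Am y)) = _ := ES.
apply: congr1; rewrite ES trace_schur//.
- transitivity (\sum_a \sum_a' (-1) ^+ (par a' (+) ((par a (+) par a') && par b)) *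
     (superinv (Am x) a' a * mxderiv Am a a')); last first.
    by apply: eq_bigr => i _; apply: eq_bigr => j _; rewrite [mxderiv Am i j]mxE.
  have -> : mxderiv (fun y => ulsubmx (Am y)) = ulsubmx (mxderiv Am).
    by apply/matrixP => i j; rewrite !mxE; under eq_fun do rewrite !mxE.
  have -> : mxderiv (fun y => ursubmx (Am y)) = ursubmx (mxderiv Am).
    by apply/matrixP => i j; rewrite !mxE; under eq_fun do rewrite !mxE.
  have -> : mxderiv (fun y => dlsubmx (Am y)) = dlsubmx (mxderiv Am).
    by apply/matrixP => i j; rewrite !mxE; under eq_fun do rewrite !mxE.
  have -> : mxderiv (fun y => drsubmx (Am y)) = drsubmx (mxderiv Am).
    by apply/matrixP => i j; rewrite !mxE; under eq_fun do rewrite !mxE.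
  rewrite super_trace /superinv block_mxKul block_mxKur block_mxKdl block_mxKdr.
  by rewrite !mulNmx !gmxtraceN !mulrN opprK.
- exact: evinv_even.
- by apply: evinv_even; exact: ed.
- by have := @mxderiv_par true _ _ (fun y => ursubmx (Am y)) (fun y Oy => parUR (pA Oy)); rewrite addbT.
by have := @mxderiv_par false _ _ (fun y => drsubmx (Am y)) ed; rewrite addbF.
Qed.

End BerezinianDerivative.

(** * The coordinate divergence under a change of coordinates *)
Section DivergenceLaw.
Variables (R : realType) (n m : nat).
Local Notation SF := (superfun R n m).
Local Notation G := (grassmann R m).
Local Notation I := 'I_(n + m).

Lemma superinv_parity (A : 'M[G]_(n + m)) : super_parity A -> super_parity (superinv A).
Proof.
move=> pA; have pS := evinv_even (schur_even pA); have pD := evinv_even (parDR pA).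
have pb := parUR pA; have pc := parDL pA.
have pDC : gmxpar true (evinv (drsubmx A) *m dlsubmx A *m evinv (schur A)).
  by apply: (@gmxparM _ _ true false) => //; apply: (@gmxparM _ _ false true).
elim/ord_split_ind => i; elim/ord_split_ind => j; rewrite ?par_lshift ?par_rshift /superinv.
- by rewrite block_mxEul.
- rewrite block_mxEur; apply: (gmxparN _) => //.
  by apply: (@gmxparM _ _ true false) => //; apply: (@gmxparM _ _ false true).
- by rewrite block_mxEdl; apply: (gmxparN _).
rewrite block_mxEdr; apply: (gmxparD _ _) => //.
by apply: (@gmxparM _ _ false false) => //; apply: (@gmxparM _ _ true true).
Qed.

Definition cdsign (p : bool) (a : I) : R := (-1) ^+ (par a && ~~ p).

(** Invariance of the supertrace under a change of basis, for a matrix w with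
    entries of total parity p. *)
Lemma supertrace_conj (A B : 'M[G]_(n + m)) (p : bool) (w : I -> I -> G) :
  super_parity A -> super_parity B -> A *m B = 1%:M ->
  (forall a b, gparity (par a (+) (par b (+) p)) (w a b)) ->
  \sum_a' \sum_a cdsign p a' *: (B a' a * \sum_b w a b * A b a') =
  \sum_b cdsign p b *: w b b.
Proof.
move=> pA pB AB pw.
have E a' a b : cdsign p a' *: (B a' a * (w a b * A b a')) = cdsign p b *: (A b a' * B a' a * w a b).
  have pBw : gparity (par a' (+) (par b (+) p)) (B a' a * w a b).
    have := gparityM (pB a' a) (pw a b); by rewrite -addbA addKb.
  rewrite mulrA (gmulC pBw (pA b a')) scalerA -mulrA; congr (_ *: _).
  rewrite /cdsign -exprD; apply: signr_odd_eq.
  by case: (par a'); case: (par b); case: (p).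
under eq_bigr do under eq_bigr do rewrite mulr_sumr scaler_sumr.
under eq_bigr do under eq_bigr do under eq_bigr do rewrite E.
under eq_bigr do rewrite exchange_big.
rewrite exchange_big; apply: eq_bigr => b _; rewrite exchange_big /=.
under eq_bigr do rewrite -scaler_sumr -mulr_suml.
rewrite -scaler_sumr; congr (_ *: _).
rewrite (bigD1 b)//= [X in _ + X]big1 ?addr0 => [|a ab].
  have /matrixP/(_ b b) := AB; rewrite !mxE eqxx => ->; exact: mul1r.
have /matrixP/(_ b a) := AB; rewrite !mxE eq_sym (negbTE ab) => ->; exact: mul0r.
Qed.

(** Exchanges the factors u and v and absorbs all signs into one; u will be an
    entry of the inverse Jacobi matrix and v a component of the vector density. *)
Lemma signed_swap (k1 k2 : R) (q r s : bool) (u v t : G) :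
  gparity q u -> gparity r v -> k1 * (k2 * (-1) ^+ (q && r)) = (-1) ^+ s ->
  k1 *: (u * (k2 *: (v * t))) = v * ((-1) ^+ s * (u * t)).
Proof.
move=> pu pv E; rewrite -scaler_signr -!scalerAr scalerA !mulrA (gmulC pu pv) -scalerAl scalerA.
by rewrite -mulrA E.
Qed.

Section Law.
Variables (O V : set 'rV[R]_n) (x : 'rV[R]_n) (Phi : I -> SF).
Hypotheses (oO : open O) (oV : open V) (Ox : O x).
Hypothesis OV : forall y, O y -> V (\row_i gbody (Phi (lshift m i) y)).
Hypotheses (sPhi : forall a, smooth O (Phi a))
  (pPhi : forall a y, O y -> gparity (par a) (Phi a y)).
Let J y := berezinian (jacobi Phi y).
Hypothesis J0 : forall y, O y -> 0 < gbody (J y).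
Let A := jacobi Phi x.
Let B := superinv A.
Let logJ : SF := fun y => gapply (@ln R) (J y).
Let JX w : SF := fun y => gapply (fun s => s `^ w) (J y).

Lemma jacobiE y a a' : jacobi Phi y a a' = sderiv a (Phi a') y.
Proof. by rewrite mxE. Qed.

Lemma jacobi_parity y : O y -> super_parity (jacobi Phi y).
Proof. by move=> Oy a a'; rewrite jacobiE; apply: gparity_sderiv oO Oy _ => z; exact: pPhi. Qed.

Lemma jacobi_diff a a' : gdiff (fun y => jacobi Phi y a a') x.
Proof.
under eq_fun do rewrite jacobiE.
by apply: (smooth_gdiff _ Ox); apply: smooth_sderiv.
Qed.

Lemma J_neq0 y : O y -> gbody (berezinian (jacobi Phi y)) != 0.
Proof. by move=> Oy; have := J0 Oy; rewrite lt0r => /andP[]. Qed.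

Lemma J_even y : O y -> gparity false (J y).
Proof. by move=> Oy; exact: berezinian_even (jacobi_parity Oy). Qed.

(** The logarithmic derivative of the Jacobian in terms of second derivatives of
    the change of coordinates. *)
Lemma J_powR_ln b w :
  [/\ gdiff (JX w) x, gdiff logJ x, sderiv b (JX w) x = w *: (JX w x * sderiv b logJ x) &
      sderiv b logJ x = \sum_a \sum_a' (-1) ^+ (par a' (+) ((par a (+) par a') && par b)) *
     (B a' a * sderiv b (sderiv a (Phi a')) x)].
Proof.
have [dJ EJ] := @sderiv_berezinian R n m b x O oO Ox (jacobi Phi) jacobi_diff jacobi_parity J_neq0.
have [d1 d2 E1 E2] := sderiv_powR_ln b w dJ (J_even Ox) (J0 Ox).
split=> //.
have JK : gapply GRing.inv (J x) * J x = 1 by apply: gapply_invK; [exact: J_even|exact: J_neq0].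
have E3 : J x * sderiv b logJ x = J x * (\sum_a \sum_a' (-1) ^+ (par a' (+) ((par a (+) par a') && par b)) *
     (B a' a * sderiv b (sderiv a (Phi a')) x)).
  rewrite E2 EJ; apply: congr1; apply: eq_bigr => a _; apply: eq_bigr => a' _.
  by under [in LHS]eq_fun do rewrite jacobiE.
by rewrite -[LHS]mul1r -JK -mulrA E3 mulrA JK mul1r.
Qed.

Variables (lam : R) (p : bool) (v v' : I -> SF).
Hypotheses (sv : forall a, smooth O (v a)) (sv' : forall a, smooth V (v' a)).
Hypothesis pv : forall a y, O y -> gparity (par a (+) p) (v a y).
Hypothesis vlaw : forall a' y, O y ->
  pullback Phi (v' a') y = JX (- lam) y * \sum_a v a y * sderiv a (Phi a') y.

(** By the chain rule the pullback of d_a' v'^a' is the contraction of the inverse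
    Jacobi matrix with the derivatives of the pullback of v'^a', that is, of
    J^(-lam) v^b d_b x'^a'.  The Leibniz rule gives three terms.  The derivatives
    of J^(-lam) and of v^b are conjugated away by [supertrace_conj]; the second
    derivatives of the coordinates sum to v^b d_b log J by [J_powR_ln]. *)
Lemma pullback_divergence :
  pullback Phi (fun y => \sum_a cdsign p a *: sderiv a (v' a) y) x =
  JX (- lam) x * (\sum_a cdsign p a *: sderiv a (v a) x
    - (lam - 1) *: \sum_a v a x * sderiv a logJ x).
Proof.
have pA := jacobi_parity Ox; have pB : super_parity B by exact: superinv_parity.
have [AB BA] := superinvK pA (J_neq0 Ox).
have Vb := OV Ox.
have dPhi a : gdiff (Phi a) x by exact: smooth_gdiff (sPhi a) Ox.
have dv a : gdiff (v a) x by exact: smooth_gdiff (sv a) Ox.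
have dA a a' : gdiff (sderiv a (Phi a')) x.
  by apply: (smooth_gdiff _ Ox); apply: smooth_sderiv.
have ej : gparity false (JX (- lam) x) by apply: gapply_even; exact: J_even.
rewrite (pullback_sum oV Vb) => [|a]; last by apply: smoothZ => //; apply: smooth_sderiv.
have Epull a' : pullback Phi (fun y => cdsign p a' *: sderiv a' (v' a') y) x =
    \sum_a cdsign p a' *: (B a' a * sderiv a (fun y => JX (- lam) y * \sum_b v b y * sderiv b (Phi a') y) x).
  rewrite (pullbackZ oV Vb); last by apply: smooth_sderiv.
  rewrite -scaler_sumr; congr (_ *: _).
  have E a : sderiv a (fun y => JX (- lam) y * \sum_b v b y * sderiv b (Phi a') y) x =
      \sum_b A a b * pullback Phi (sderiv b (v' a')) x.
    have [_ EE] := @sderiv_pullback R n m V O Phi (v' a') a x oV oO Ox (sv' a') OV dPhi pPhi.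
    transitivity (sderiv a (pullback Phi (v' a')) x).
      by apply: (sderiv_local _ oO Ox) => y Oy; rewrite vlaw.
    by rewrite EE; apply: eq_bigr => b _; rewrite [A a b]mxE.
  under [RHS]eq_bigr do rewrite E mulr_sumr.
  rewrite exchange_big (bigD1 a')//= [X in _ = _ + X]big1 ?addr0 => [|b ba].
    under eq_bigr do rewrite mulrA.
    have /matrixP/(_ a' a') := BA; rewrite mxE [in RHS]mxE eqxx => BA1.
    by rewrite -mulr_suml BA1 mul1r.
  under eq_bigr do rewrite mulrA.
  have /matrixP/(_ a' b) := BA; rewrite mxE [in RHS]mxE eq_sym (negbTE ba) => BA1.
  by rewrite -mulr_suml BA1 mul0r.
rewrite (eq_bigr _ (fun a' _ => Epull a')).
have dsum a' : gdiff (fun y => \sum_b v b y * sderiv b (Phi a') y) x.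
  by apply: gdiff_sum => b _; apply: gdiffM.
have pv0 b : gparity (par b (+) p) (v b x) by exact: pv.
have Ed a a' : sderiv a (fun y => JX (- lam) y * \sum_b v b y * sderiv b (Phi a') y) x =
  \sum_b (sderiv a (JX (- lam)) x * v b x) * A b a' +
  \sum_b (JX (- lam) x * sderiv a (v b) x) * A b a' +
  JX (- lam) x * \sum_b ((-1) ^+ (par a && (par b (+) p)) * (-1) ^+ (par a && par b) : R) *:
      (v b x * sderiv b (sderiv a (Phi a')) x).
  have [dj _ _ _] := J_powR_ln a (- lam).
  rewrite (sderivM a dj (dsum a')) gtwist_even//.
  rewrite (@sderiv_sum _ _ _ a _ _ _ (fun b y => v b y * sderiv b (Phi a') y)); last by move=> b _; apply: gdiffM.
  rewrite -addrA; congr (_ + _).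
    by rewrite mulr_sumr; apply: eq_bigr => b _; rewrite -jacobiE mulrA.
  rewrite !mulr_sumr -big_split; apply: eq_bigr => b _ /=.
  rewrite (sderivM a (dv b) (dA b a')) mulrDr -jacobiE mulrA; congr (_ + _ * _).
  rewrite (gtwist_parity _ (pv0 b)) (sderiv_swap a b oO Ox (sPhi a')).
  by rewrite -scalerAl -scalerAr scalerA.
rewrite (eq_bigr (fun a' => \sum_a cdsign p a' *: (B a' a * \sum_b (sderiv a (JX (- lam)) x * v b x) * A b a')
  + \sum_a cdsign p a' *: (B a' a * \sum_b (JX (- lam) x * sderiv a (v b) x) * A b a')
  + \sum_a cdsign p a' *: (B a' a * (JX (- lam) x * \sum_b ((-1) ^+ (par a && (par b (+) p)) * (-1) ^+ (par a && par b) : R) *: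
      (v b x * sderiv b (sderiv a (Phi a')) x))))); last first.
  by move=> a' _; rewrite -!big_split; apply: eq_bigr => a _ /=; rewrite Ed !mulrDr !scalerDr.
rewrite !big_split/=.
have pj a : gparity (par a) (sderiv a (JX (- lam)) x).
  rewrite -[par a]addbF; apply: gparity_sderiv oO Ox _ => y Oy.
  by apply: gapply_even; exact: J_even.
rewrite (supertrace_conj pA pB AB (w := fun a b => sderiv a (JX (- lam)) x * v b x)); last first.
  by move=> a b; apply: gparityM.
rewrite (supertrace_conj pA pB AB (w := fun a b => JX (- lam) x * sderiv a (v b) x)); last first.
  move=> a b; apply: (@gparityM _ _ false) => //.
  by apply: gparity_sderiv oO Ox _ => y; exact: pv.
have -> : \sum_b cdsign p b *: (sderiv b (JX (- lam)) x * v b x) =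
    - lam *: (JX (- lam) x * \sum_b v b x * sderiv b logJ x).
  rewrite mulr_sumr scaler_sumr; apply: eq_bigr => b _.
  rewrite (gmulC (pj b) (pv0 b)) scalerA.
  have -> : cdsign p b * (-1) ^+ (par b && (par b (+) p)) = 1.
    rewrite /cdsign -exprD -[RHS](expr0 (-1)); apply: signr_odd_eq.
    by case: (par b); case: (p).
  have [_ _ -> _] := J_powR_ln b (- lam).
  by rewrite scale1r -scalerAr mulr_evenCA.
have -> : \sum_b cdsign p b *: (JX (- lam) x * sderiv b (v b) x) = JX (- lam) x * \sum_b cdsign p b *: sderiv b (v b) x.
  by rewrite mulr_sumr; apply: eq_bigr => b _; rewrite scalerAr.
have -> : \sum_a' \sum_a cdsign p a' *: (B a' a * (JX (- lam) x * \sum_b ((-1) ^+ (par a && (par b (+) p)) * (-1) ^+ (par a && par b) : R) *: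
      (v b x * sderiv b (sderiv a (Phi a')) x))) = JX (- lam) x * \sum_b v b x * sderiv b logJ x.
  under eq_bigr do under eq_bigr do rewrite -(mulr_evenCA _ _ ej) scalerAr mulr_sumr scaler_sumr.
  rewrite exchange_big mulr_sumr.
  under eq_bigr do under eq_bigr do rewrite mulr_sumr.
  under eq_bigr do rewrite exchange_big.
  rewrite exchange_big; apply: eq_bigr => b _.
  have [_ _ _ ->] := J_powR_ln b (- lam).
  rewrite !mulr_sumr; apply: eq_bigr => a _; rewrite !mulr_sumr; apply: eq_bigr => a' _.
  congr (_ * _); apply: (signed_swap _ (pB a' a) (pv0 b)).
  rewrite /cdsign -!exprD; apply: signr_odd_eq.
  by case: (par a'); case: (par a); case: (par b); case: (p).
rewrite mulrBr -scalerAr scalerBl scale1r opprB scaleNr.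
by rewrite [LHS](ACl (2*3*1)) addrA.
Qed.

End Law.

End DivergenceLaw.

(** * Derivations of weight lam on a supermanifold *)
Section ManifoldLaw.
Variables (R : realType) (n m : nat) (M : supermanifold R n m).
Local Notation SF := (superfun R n m).
Local Notation G := (grassmann R m).
Implicit Types (c d : chart M) (X : vfield M).

Lemma chart_open c : open (image_of c).
Proof. exact: image_open. Qed.

Lemma overlap_sub c d x : overlap c d x -> image_of c x.
Proof. by move=> [p [cp dp] <-]; exists p. Qed.

Lemma overlapE c d : overlap c d = image_of c `&` (@param _ _ _ M c) @^-1` (dom d).
Proof.
apply/seteqP; split=> [x [p [cp dp] <-]|x [[p cp <-]]] /=.
  by rewrite coordK//; split=> //; exists p.
by rewrite coordK// => dp; exists p.
Qed.

Lemma overlap_open c d : open (overlap c d).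
Proof.
rewrite openE => x Ox; have Ix := overlap_sub Ox.
have cp : {in image_of c, continuous (@param _ _ _ M c)}.
  rewrite -continuous_open_subspace; [exact: param_continuous|exact: image_open].
move: Ox; rewrite overlapE => -[_ /= dx].
apply: filterI; first by apply: open_nbhs_nbhs; split=> //; exact: image_open.
apply: (cp x); first by rewrite inE.
by apply: open_nbhs_nbhs; split=> //; exact: dom_open.
Qed.

Lemma overlap_body c d y : overlap c d y ->
  image_of d (\row_i gbody (trans c d (lshift m i) y)).
Proof.
move=> [p [cp dp] <-]; exists p => //; apply/rowP => i; rewrite mxE.
exact/esym/trans_body.
Qed.

Section Law.
Variables (lam : R) (p : bool).

(** For lam = 1 the divergence of a vector density is itself a density; the
    deviation is proportional to lam - 1. *)
Lemma coord_div_law V c d x : @is_vector_density _ _ _ M lam p V -> overlap c d x ->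
  pullback (trans c d) (coord_div p V d) x =
  jacX c d (- lam) x *
    (coord_div p V c x - (lam - 1) *: \sum_a V c a x * sderiv a (log_jac c d) x).
Proof.
move=> [sV pV lawV] Ox.
apply: (@pullback_divergence R n m (overlap c d) (image_of d) x (trans c d)) => //.
- exact: overlap_open.
- exact: image_open.
- by move=> y; exact: overlap_body.
- by move=> a; exact: trans_smooth.
- by move=> a y; exact: trans_parity.
- by move=> y; exact: jac_positive.
- by move=> a S s y Oy; apply: sV; exact: overlap_sub Oy.
- by move=> a y Oy; apply: pV; exact: overlap_sub Oy.
by move=> a' y Oy; exact: lawV.
Qed.

Lemma coord_div_smooth V c : @is_vector_density _ _ _ M lam p V -> smooth (image_of c) (coord_div p V c).
Proof.
move=> [sV _ _]; apply: smooth_sum; first exact: image_open.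
move=> a _; apply: smoothZ; first exact: image_open.
by apply: smooth_sderiv; first exact: image_open.
Qed.

Lemma coord_div_parity V c x : @is_vector_density _ _ _ M lam p V -> image_of c x ->
  gparity p (coord_div p V c x).
Proof.
move=> [_ pV _] Ix; apply: gparity_sum => a _; apply: gparityZ.
have := @gparity_sderiv R n m (image_of c) a (V c a) x (par a (+) p) (@chart_open c) Ix.
by rewrite addKb; apply => y; exact: pV.
Qed.

Hypothesis lam_neq1 : lam != 1.

Lemma lam1_neq0 : lam - 1 != 0.
Proof. by rewrite subr_eq0. Qed.

(** The inhomogeneous term of [coord_div_law], divided by - (lam - 1), is the one
    required of the weight component. *)
Lemma canonical_lift_derivation V : @is_vector_density _ _ _ M lam p V ->
  is_derivation lam p (canonical_lift lam p V).
Proof.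
move=> vV; split=> //.
- by move=> c; apply: smoothZ; [exact: image_open|exact: coord_div_smooth].
- by move=> c x Ix; apply: gparityZ; exact: coord_div_parity.
move=> c d x Ox; rewrite /= (pullbackZ (@chart_open d) (overlap_body Ox)); last exact: coord_div_smooth.
rewrite (coord_div_law vV Ox) scalerAr; congr (_ * _).
by rewrite scalerBr scalerA mulNr mulVf ?lam1_neq0// scaleN1r opprK.
Qed.

(** The coordinate expression of the canonical divergence. *)
Definition vfield_div X : chart M -> SF := fun c x => coord_div p (vcoef X) c x + (lam - 1) *: wcoef X c x.

(** The inhomogeneous terms in the laws of the two summands cancel. *)
Lemma vfield_div_density X : is_derivation lam p X -> is_density lam p (vfield_div X).
Proof.
move=> [vX sW pW lawW]; split.
- move=> c; apply: smoothD; [exact: image_open|exact: coord_div_smooth|].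
  by apply: smoothZ => //; exact: image_open.
- by move=> c x Ix; apply: gparityD; [exact: coord_div_parity|apply: gparityZ; exact: pW].
move=> c d x Ox; have oI := @chart_open d; have Bx := overlap_body Ox.
rewrite (pullbackD oI Bx); [|exact: coord_div_smooth|exact: smoothZ].
rewrite (pullbackZ oI Bx)// (coord_div_law vX Ox) lawW// scalerAr -mulrDr; congr (_ * _).
by rewrite [in LHS]scalerDr -addrA; congr (_ + _); rewrite addrCA addNr addr0.
Qed.

Lemma weight_field_derivation (D : chart M -> SF) (k : R) : is_density lam p D ->
  is_derivation lam p (weight_field (fun c x => k *: D c x)).
Proof.
move=> [sD pD lawD]; split.
- split.
  + by move=> c a; exact: smooth0.
  + by move=> c a x _; exact: gparity0.
  + move=> c d a x Ox; rewrite pullback0 big1 ?mulr0// => b _; exact: mul0r.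
- by move=> c; apply: smoothZ => //; exact: image_open.
- by move=> c x Ix; apply: gparityZ; exact: pD.
move=> c d x Ox; rewrite /= (pullbackZ (@chart_open d) (overlap_body Ox))// lawD// big1 ?addr0.
  by rewrite scalerAr.
by move=> b _; exact: mul0r.
Qed.

Lemma vfield_div_lift V : @is_vector_density _ _ _ M lam p V ->
  forall c x, vfield_div (canonical_lift lam p V) c x = 0.
Proof.
move=> vV c x; rewrite /vfield_div /= scalerA mulrN mulfV ?lam1_neq0// scaleN1r; exact: subrr.
Qed.

End Law.
End ManifoldLaw.

(** * The iterated integral *)
Section LineIntegral.
Variable R : realType.
Implicit Types (f g : R -> R) (B C : R).

Local Notation I1 f := (\int[lebesgue_measure]_t (f t)).

Definition supp1 B f := forall t, B < `|t| -> f t = 0.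

Lemma line_integralE B f : supp1 B f -> I1 f = \int[lebesgue_measure]_(t in `[- B, B]) f t.
Proof.
move=> sf; rewrite [RHS]Rintegral_mkcond; congr Rintegral; apply/funext => t.
rewrite patchE; case: ifPn => // /negP tB; apply: sf; rewrite ltNge; apply/negP => tB'.
by apply: tB; rewrite inE/= in_itv/= -ler_norml.
Qed.

Lemma integrable_continuous_itv B f : continuous f ->
  lebesgue_measure.-integrable (`[- B, B] : set R) (EFin \o f).
Proof.
move=> cf; apply: continuous_compact_integrable; first exact: segment_compact.
exact: continuous_subspaceT.
Qed.

Lemma line_integralD B f g : continuous f -> continuous g -> supp1 B f -> supp1 B g ->
  I1 (fun t => f t + g t) = I1 f + I1 g.
Proof.
move=> cf cg sf sg; rewrite (line_integralE sf) (line_integralE sg) (@line_integralE B).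
  by rewrite RintegralD//; exact: integrable_continuous_itv.
by move=> t tB; rewrite sf// sg// addr0.
Qed.

Lemma line_integralZ B (c : R) f : continuous f -> supp1 B f -> I1 (fun t => c * f t) = c * I1 f.
Proof.
move=> cf sf; rewrite (line_integralE sf) (@line_integralE B).
  by rewrite RintegralZl//; exact: integrable_continuous_itv.
by move=> t tB; rewrite sf// mulr0.
Qed.

Lemma Rintegral_itv_cst (a b c : R) : a <= b -> \int[lebesgue_measure]_(t in `[a, b]) c = c * (b - a).
Proof.
move=> ab; rewrite Rintegral_cst//; congr (_ * _).
have E := lebesgue_measure_itv `[a, b].
transitivity (fine (lebesgue_measure (`[a, b] : set R))); first by [].
rewrite E /= lte_fin; case: ltP => [_|ba]; first by rewrite -EFinD.
have -> : a = b by lra.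
by rewrite subrr.
Qed.

Lemma line_integral_bound B C f : 0 <= B -> continuous f -> supp1 B f -> (forall t, `|f t| <= C) ->
  `|I1 f| <= 2 * B * C.
Proof.
move=> B0 cf sf fC; rewrite (line_integralE sf).
have mI : measurable (`[- B, B] : set R) by exact: measurable_itv.
have If := integrable_continuous_itv B cf.
have H : `|\int[lebesgue_measure]_(t in `[- B, B]) f t| <= \int[lebesgue_measure]_(t in `[- B, B]) `|f t|.
  by apply: le_normr_Rintegral => //; exact: If.
apply: (le_trans H).
have -> : 2 * B * C = \int[lebesgue_measure]_(t in `[- B, B]) C.
  by rewrite Rintegral_itv_cst; [ring|lra].
apply: le_Rintegral => //.
  by apply: (@integrable_continuous_itv B (fun t => `|f t|)) => t; apply: continuous_comp; [exact: cf|exact: norm_continuous].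
by apply: (@integrable_continuous_itv B (fun=> C)) => t; exact: cst_continuous.
Qed.

Lemma line_integral_gt0 B f t0 : continuous f -> supp1 B f -> (forall t, 0 <= f t) -> 0 < f t0 -> 0 < I1 f.
Proof.
move=> cf sf f0 ft0.
have [d /= d0 Hd] : exists2 d : R, 0 < d & forall t, `|t0 - t| <= d -> f t0 / 2 <= f t.
  have := cf t0; move=> /cvgrPdist_lt/(_ (f t0 / 2) (divr_gt0 ft0 (ltr0n R 2))).
  move=> /nbhs_ballP[d /= d0 Hd].
  exists (d / 2); first by rewrite divr_gt0.
  move=> t td; have /Hd/= : ball t0 d t by rewrite -ball_normE/= (le_lt_trans td)// ltr_pdivrMr//; lra.
  by rewrite ltr_norml => /andP[_]; lra.
pose B' := Num.max B (`|t0| + d).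
have sf' : supp1 B' f by move=> t tB; apply: sf; apply: le_lt_trans tB; rewrite le_max lexx.
have sub : `[t0 - d, t0 + d] `<=` (`[- B', B'] : set R).
  move=> t /=; rewrite !in_itv/= => /andP[t1 t2]; rewrite -ler_norml le_max; apply/orP; right.
  by rewrite ler_norml; have := ler_norm t0; have := ler_norm (- t0); rewrite normrN; lra.
rewrite (line_integralE sf').
have mI : measurable (`[- B', B'] : set R) by exact: measurable_itv.
have mJ : measurable (`[t0 - d, t0 + d] : set R) by exact: measurable_itv.
apply: (@lt_le_trans _ _ (\int[lebesgue_measure]_(t in `[t0 - d, t0 + d]) (f t0 / 2))).
  by rewrite Rintegral_itv_cst; [rewrite mulr_gt0; lra|lra].
have If := integrable_continuous_itv B' cf.
have IJ : lebesgue_measure.-integrable (`[t0 - d, t0 + d] : set R) (EFin \o f).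
  by apply: continuous_compact_integrable; [exact: segment_compact|exact: continuous_subspaceT].
apply: (@le_trans _ _ (\int[lebesgue_measure]_(t in `[t0 - d, t0 + d]) f t)).
  apply: le_Rintegral => //.
    by apply: continuous_compact_integrable; [exact: segment_compact|apply: continuous_subspaceT => t; exact: cst_continuous].
  move=> t; rewrite /= in_itv/= => /andP[t1 t2]; apply: Hd; rewrite ler_norml; lra.
apply: fine_le; [exact: integrable_fin_num|exact: integrable_fin_num|].
apply: ge0_subset_integral => //; first by have /integrableP[] := If.
by move=> t _; rewrite lee_fin.
Qed.

Lemma line_integral_derive0 B (F f : R -> R) : 0 <= B -> continuous f -> supp1 B F -> supp1 B f ->
  (forall t, is_derive t (1 : R) F (f t)) -> I1 f = 0.
Proof.
move=> B0 cf sF sf dF.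
have sf' : supp1 (B + 1) f by move=> t tB; apply: sf; lra.
have F0 t : B < `|t| -> F t = 0 by exact: sF.
have cF t : {for t, continuous F}.
  by apply: differentiable_continuous; apply/derivable1_diffP; have D := dF t; exact: (@ex_derive _ _ _ _ _ _ _ D).
rewrite (line_integralE sf') /Rintegral (@continuous_FTC2 _ f F).
- by rewrite !F0 ?subee//= ?subrr// ?normrN ger0_norm; lra.
- lra.
- exact: continuous_subspaceT.
- split.
  + by move=> t _; have D := dF t; exact: (@ex_derive _ _ _ _ _ _ _ D).
  + by apply: cvg_at_right_filter; exact: cF.
  + by apply: cvg_at_left_filter; exact: cF.
by move=> t _; rewrite derive1E; have D := dF t; rewrite derive_val.
Qed.

End LineIntegral.

Section IteratedIntegral.
Variable R : realType.
Implicit Types (B C : R).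

Local Notation I1 f := (\int[lebesgue_measure]_t (f t)).
Local Notation rcons t v := (row_mx ((t : R)%:M : 'rV[R]_1) v).

(** Uniform continuity in terms of coordinates, stable under freezing some of
    them. *)
Definition coord_unif_cont k (g : 'rV[R]_k -> R) := forall e, 0 < e ->
  exists2 d, 0 < d & forall x y : 'rV[R]_k, (forall i, `|x 0 i - y 0 i| < d) -> `|g x - g y| < e.

Definition supp_cube k B (g : 'rV[R]_k -> R) := forall (x : 'rV[R]_k) i, B < `|x 0 i| -> g x = 0.

Definition admissible k B (g : 'rV[R]_k -> R) := coord_unif_cont g /\ supp_cube B g.

Lemma admissibleD k B (g h : 'rV[R]_k -> R) : admissible B g -> admissible B h -> admissible B (fun x => g x + h x).
Proof.
move=> [ug sg] [uh sh]; split; last by move=> x i xi; rewrite (sg x i)// (sh x i)// addr0.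
move=> e e0; have e2 : 0 < e / 2 by rewrite divr_gt0.
have [d1 d10 H1] := ug _ e2; have [d2 d20 H2] := uh _ e2.
exists (Num.min d1 d2); first by rewrite lt_min d10.
move=> x y xy; have -> : g x + h x - (g y + h y) = (g x - g y) + (h x - h y) by ring.
rewrite (splitr e); apply: le_lt_trans (ler_normD _ _) _; apply: ltrD.
  by apply: H1 => i; have := xy i; rewrite lt_min => /andP[].
by apply: H2 => i; have := xy i; rewrite lt_min => /andP[].
Qed.

Lemma admissibleZ k B (c : R) (g : 'rV[R]_k -> R) : admissible B g -> admissible B (fun x => c * g x).
Proof.
move=> [ug sg]; split; last by move=> x i xi; rewrite (sg x i)// mulr0.
move=> e e0; have c0 : 0 < `|c| + 1 by rewrite ltr_wpDl.
have [d d0 H] := ug (e / (`|c| + 1)) (divr_gt0 e0 c0); exists d => // x y xy.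
rewrite -mulrBr normrM; have := H x y xy; rewrite ltr_pdivlMr// => h.
apply: le_lt_trans h; rewrite mulrC ler_wpM2l//; lra.
Qed.

Lemma rcons0 k t (v : 'rV[R]_k) : rcons t v 0 (lshift k ord0) = t.
Proof. by rewrite row_mxEl mxE eqxx. Qed.

Lemma rconsS k t (v : 'rV[R]_k) j : rcons t v 0 (rshift 1 j) = v 0 j.
Proof. by rewrite row_mxEr. Qed.

Lemma admissible_slice k B (g : 'rV[R]_k.+1 -> R) t : admissible B g ->
  admissible B (fun v : 'rV[R]_k => g (rcons t v)).
Proof.
move=> [ug sg]; split=> [e e0|v i vi]; last by apply: (sg _ (rshift 1 i)); rewrite rconsS.
have [d d0 H] := ug e e0; exists d => // x y xy; apply: H => i.
rewrite -(splitK (i : 'I_(1 + k))); case: (fintype.split _) => j /=.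
  by rewrite !ord1 !rcons0 subrr normr0.
by rewrite !rconsS; exact: xy.
Qed.

Lemma slice_close k (g : 'rV[R]_k.+1 -> R) e : coord_unif_cont g -> 0 < e ->
  exists2 d, 0 < d & forall t s v, `|t - s| < d -> `|g (rcons t v) - g (rcons s v)| < e.
Proof.
move=> ug e0; have [d d0 H] := ug e e0; exists d => // t s v ts; apply: H => i.
rewrite -(splitK (i : 'I_(1 + k))); case: (fintype.split _) => j /=.
  by rewrite !ord1 !rcons0.
by rewrite !rconsS subrr normr0.
Qed.

Lemma slice_supp k B (g : 'rV[R]_k.+1 -> R) : supp_cube B g ->
  forall t v, B < `|t| -> g (rcons t v) = 0.
Proof. by move=> sg t v tB; apply: (sg (rcons t v : 'rV_(1 + k)) (lshift k (ord0 : 'I_1) : 'I_(1 + k))); rewrite rcons0. Qed.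

Lemma Rn_integral0 k : Rn_integral (fun _ : 'rV[R]_k => 0) = 0.
Proof.
elim: k => [//|k IH] /=; under eq_Rintegral do rewrite IH.
by rewrite Rintegral_cst// mul0r.
Qed.

Lemma eq_Rn_integral k (g h : 'rV[R]_k -> R) : (forall x, g x = h x) -> Rn_integral g = Rn_integral h.
Proof. by move=> gh; congr Rn_integral; apply/funext. Qed.

(** What the induction on the dimension needs from the inner integral: additivity
    makes differences of slices computable and the bound makes them small, hence
    the outer integrand is continuous. *)
Record tame_integral k : Prop := TameIntegral {
  tameD : forall B (g h : 'rV[R]_k -> R), admissible B g -> admissible B h ->
    Rn_integral (fun x => g x + h x) = Rn_integral g + Rn_integral h;
  tameZ : forall B c (g : 'rV[R]_k -> R), admissible B g ->
    Rn_integral (fun x => c * g x) = c * Rn_integral g;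
  tame_bound : forall B C (g : 'rV[R]_k -> R), 0 <= B -> admissible B g -> (forall x, `|g x| <= C) ->
    `|Rn_integral g| <= (2 * B) ^+ k * C
}.

(** The outer integrand of an iterated integral is continuous, because nearby
    slices are uniformly close. *)
Lemma slice_cont k B (g : 'rV[R]_k.+1 -> R) : tame_integral k -> 0 <= B -> admissible B g ->
  continuous (fun t : R => Rn_integral (fun v : 'rV[R]_k => g (rcons t v))) /\
  supp1 B (fun t : R => Rn_integral (fun v : 'rV[R]_k => g (rcons t v))).
Proof.
move=> Gk B0 ag; split=> [t|t tB]; last first.
  rewrite -[RHS](Rn_integral0 k); apply: eq_Rn_integral => v.
  by rewrite (slice_supp ag.2).
apply/cvgrPdist_lt => e e0.
have c0 : 0 < (2 * B) ^+ k + 1 by rewrite ltr_wpDl// exprn_ge0// mulr_ge0.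
have [d d0 H] := slice_close ag.1 (divr_gt0 e0 c0).
apply/nbhs_ballP; exists d; [exact: d0|move=> s ts'].
have {ts'} ts : `|t - s| < d := ts'.
have As := admissible_slice s ag; have At := admissible_slice t ag.
have -> : Rn_integral (fun v : 'rV[R]_k => g (rcons t v)) - Rn_integral (fun v : 'rV[R]_k => g (rcons s v)) =
   Rn_integral (fun v : 'rV[R]_k => g (rcons t v) + -1 * g (rcons s v)).
  by rewrite (tameD Gk At (admissibleZ (-1) As)) (tameZ Gk (-1) As) mulN1r.
apply: le_lt_trans (tame_bound Gk (C := e / ((2 * B) ^+ k + 1)) B0 (admissibleD At (admissibleZ (-1) As)) _) _.
  by move=> v; rewrite mulN1r ltW//; apply: H.
rewrite mulrA ltr_pdivrMr// mulrC ltr_pM2l//; lra.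
Qed.

Lemma tame_integral_all k : tame_integral k.
Proof.
elim: k => [|k Gk].
  split=> //= B C g B0 ag gC; by rewrite expr0 mul1r.
have max0 B (g : 'rV[R]_k.+1 -> R) : admissible B g -> admissible (Num.max B 0) g.
  by move=> [ug sg]; split=> // x i; rewrite gt_max => /andP[xi _]; exact: sg xi.
have B0 B : 0 <= Num.max B 0 by rewrite le_max lexx orbT.
split=> [B g h ag ah|B c g ag|B C g Bp ag gC] /=.
- have {}ag := max0 _ _ ag; have {}ah := max0 _ _ ah.
  have [cg sg] := slice_cont Gk (B0 B) ag; have [ch sh] := slice_cont Gk (B0 B) ah.
  rewrite -(line_integralD cg ch sg sh); congr Rintegral; apply/funext => t.
  exact: (tameD Gk (admissible_slice t ag) (admissible_slice t ah)).
- have {}ag := max0 _ _ ag; have [cg sg] := slice_cont Gk (B0 B) ag.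
  rewrite -(line_integralZ c cg sg); congr Rintegral; apply/funext => t.
  exact: (tameZ Gk c (admissible_slice t ag)).
have [cg sg] := slice_cont Gk Bp ag.
rewrite exprS -mulrA; apply: line_integral_bound => // t.
exact: (tame_bound Gk Bp (admissible_slice t ag)).
Qed.

Lemma Rn_integralD k B (g h : 'rV[R]_k -> R) : admissible B g -> admissible B h ->
    Rn_integral (fun x => g x + h x) = Rn_integral g + Rn_integral h.
Proof. exact: (tameD (tame_integral_all k)). Qed.

Lemma Rn_integralZ k B c (g : 'rV[R]_k -> R) : admissible B g ->
    Rn_integral (fun x => c * g x) = c * Rn_integral g.
Proof. exact: (tameZ (tame_integral_all k)). Qed.

Lemma Rn_integral_ge0 k (g : 'rV[R]_k -> R) : (forall x, 0 <= g x) -> 0 <= Rn_integral g.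
Proof.
elim: k g => [|k IH] g g0 //=; apply: Rintegral_ge0 => t _; exact: IH.
Qed.

Lemma Rn_integral_gt0 k B (g : 'rV[R]_k -> R) x0 : 0 <= B -> admissible B g ->
  (forall x, 0 <= g x) -> 0 < g x0 -> 0 < Rn_integral g.
Proof.
elim: k g x0 => [|k IH] g x0 B0 ag g0 gx.
  by rewrite /= (_ : 0 = x0)//; apply/rowP => -[].
have [cg sg] := slice_cont (tame_integral_all k) B0 ag.
apply: (@line_integral_gt0 R B (fun t : R => Rn_integral (fun v : 'rV[R]_k => g (rcons t v)))
  ((x0 : 'rV_(1 + k)) 0 (lshift k (ord0 : 'I_1))) cg sg) => [t|].
  by apply: Rn_integral_ge0.
apply: (IH _ (rsubmx (x0 : 'rV_(1 + k)))) => //; first exact: admissible_slice.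
rewrite (_ : rcons _ _ = x0)//; apply/rowP => i.
rewrite -(splitK (i : 'I_(1 + k))); case: (fintype.split _) => j /=.
  by rewrite !ord1 rcons0.
by rewrite rconsS mxE.
Qed.

Lemma deriv_rconsS k (g : 'rV[R]_k.+1 -> R^o) t (v : 'rV[R]_k) j dg :
  is_derive (rcons t v : 'rV[R]_k.+1) (delta_mx 0 (rshift 1 j)) g dg ->
  is_derive v (delta_mx 0 j) (fun v => g (rcons t v) : R^o) dg.
Proof.
have E : (fun h : R => h^-1 *: (g (rcons t (h *: (delta_mx 0 j) + v)) - g (rcons t v) : R^o)) =
         (fun h : R => h^-1 *: (g (h *: (delta_mx 0 (rshift 1 j)) + rcons t v : 'rV_(1 + k)) - g (rcons t v) : R^o)).
  apply/funext => h; congr (_ *: (g _ - _)); apply/rowP => i.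
  rewrite -(splitK (i : 'I_(1 + k))); case: (fintype.split _) => l /=.
    by rewrite [in RHS]mxE [in RHS]mxE !ord1 !rcons0 !mxE /= mulr0 add0r.
  by rewrite [in RHS]mxE [in RHS]mxE !rconsS !mxE eqxx /= (inj_eq (@rshift_inj 1 k)).
by move=> [d D]; split; rewrite /derivable /derive /= E.
Qed.

Lemma deriv_rcons0 k (g : 'rV[R]_k.+1 -> R^o) t (v : 'rV[R]_k) dg :
  is_derive (rcons t v : 'rV[R]_k.+1) (delta_mx 0 (lshift k (ord0 : 'I_1)) : 'rV[R]_k.+1) g dg ->
  is_derive t (1 : R) (fun t => g (rcons t v) : R^o) dg.
Proof.
have E : (fun h : R => h^-1 *: (g (rcons (h *: 1 + t) v) - g (rcons t v) : R^o)) =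
         (fun h : R => h^-1 *: (g (h *: (delta_mx 0 (lshift k (ord0 : 'I_1)) : 'rV[R]_k.+1) + rcons t v : 'rV_(1 + k)) - g (rcons t v) : R^o)).
  apply/funext => h; congr (_ *: (g _ - _)); apply/rowP => i.
  rewrite -(splitK (i : 'I_(1 + k))); case: (fintype.split _) => l /=.
    by rewrite [in RHS]mxE [in RHS]mxE !ord1 !rcons0 !mxE.
  by rewrite [in RHS]mxE [in RHS]mxE !rconsS !mxE /= mulr0 add0r.
by move=> [d D]; split; rewrite /derivable /derive /= E.
Qed.

(** Differentiation under the integral sign: by the mean value theorem the
    difference quotients of g converge uniformly to dg, which is uniformly
    continuous. *)
Lemma deriv_slice_integral k B (g dg : 'rV[R]_k.+1 -> R) t : 0 <= B ->
  admissible B g -> admissible B dg ->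
  (forall x, is_derive x (delta_mx 0 (lshift k (ord0 : 'I_1)) : 'rV[R]_k.+1) (g : _ -> R^o) (dg x)) ->
  is_derive t (1 : R) (fun t : R => Rn_integral (fun v : 'rV[R]_k => g (rcons t v)))
    (Rn_integral (fun v : 'rV[R]_k => dg (rcons t v))).
Proof.
move=> B0 ag adg D.
pose G s := Rn_integral (fun v : 'rV[R]_k => g (rcons s v)).
pose L := Rn_integral (fun v : 'rV[R]_k => dg (rcons t v)).
suff C : h^-1 *: (G (h *: 1 + t) - G t) @[h --> 0^'] --> L.
  by split; [apply/cvg_ex; exists L|exact: cvg_lim].
apply/cvgrPdist_lt => e e0.
have c0 : 0 < (2 * B) ^+ k + 1 by rewrite ltr_wpDl// exprn_ge0// mulr_ge0.
have ec := divr_gt0 e0 c0.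
have [d d0 H] := slice_close adg.1 ec.
near=> h.
have h0 : h != 0 by near: h; exact: nbhs_dnbhs_neq.
have hd : `|h| < d by near: h; exact: dnbhs0_lt.
rewrite [h *: 1]mulr1.
have Ah := admissible_slice (h + t) ag; have At := admissible_slice t ag; have Ad := admissible_slice t adg.
pose q (v : 'rV[R]_k) := dg (rcons t v) + (- h^-1) * (g (rcons (h + t) v) + -1 * g (rcons t v)).
have -> : L - h^-1 *: (G (h + t) - G t) = Rn_integral q.
  rewrite (Rn_integralD Ad (admissibleZ (- h^-1) (admissibleD Ah (admissibleZ (-1) At)))).
  rewrite (Rn_integralZ _ (admissibleD Ah (admissibleZ (-1) At))) (Rn_integralD Ah (admissibleZ (-1) At)) (Rn_integralZ _ At).
  by rewrite mulNr mulN1r.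
apply: le_lt_trans (tame_bound (tame_integral_all k) (C := e / ((2 * B) ^+ k + 1)) B0 (admissibleD Ad (admissibleZ (- h^-1) (admissibleD Ah (admissibleZ (-1) At)))) _) _; last first.
  rewrite mulrA ltr_pdivrMr// mulrC ltr_pM2l//; lra.
move=> v; rewrite mulN1r.
have Dv s : is_derive s (1 : R) (fun s => g (rcons s v) : R^o) (dg (rcons s v)).
  exact: deriv_rcons0.
have mvt : exists2 s, `|t - s| < d & g (rcons (h + t) v) - g (rcons t v) = dg (rcons s v) * h.
  have cv (i : interval R) : {within [set` i], continuous (fun s => g (rcons s v))}.
    apply: derivable_within_continuous => s _; have D' := Dv s; exact: (@ex_derive _ _ _ _ _ _ _ D').
  have [hp|hn|h00] := ltgtP 0 h; last by rewrite -h00 eqxx in h0.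
    have th : t < h + t by lra.
    have [s] := @MVT R (fun s => g (rcons s v)) (fun s => dg (rcons s v)) t (h + t) th (fun s _ => Dv s) (cv _).
    rewrite in_itv/= addrK => /andP[s1 s2] E; exists s => //.
    by apply: le_lt_trans hd; rewrite (gtr0_norm hp) ler_norml; lra.
  have th : h + t < t by lra.
  have [s] := @MVT R (fun s => g (rcons s v)) (fun s => dg (rcons s v)) (h + t) t th (fun s _ => Dv s) (cv _).
  rewrite in_itv/= => /andP[s1 s2] E; exists s.
    by apply: le_lt_trans hd; rewrite (ltr0_norm hn) ler_norml; lra.
  by rewrite -opprB E; ring.
have [s ts ->] := mvt.
have -> : dg (rcons t v) + - h^-1 * (dg (rcons s v) * h) = dg (rcons t v) - dg (rcons s v).
  by field.
by rewrite ltW//; exact: H.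
Unshelve. all: by end_near. Qed.

(** For the outermost variable this is the berezin_fundamental theorem of calculus after
    differentiation under the integral sign; for the other ones it holds in each
    slice. *)
Lemma Rn_integral_derive0 k B (g dg : 'rV[R]_k -> R) i : 0 <= B ->
  admissible B g -> admissible B dg ->
  (forall x, is_derive x (delta_mx 0 i) (g : _ -> R^o) (dg x)) -> Rn_integral dg = 0.
Proof.
move=> B0; elim: k g dg i => [|k IH] g dg; first by case.
move=> i; rewrite -(splitK (i : 'I_(1 + k))); case: (fintype.split _) => j /= ag adg D.
  have [cg sg] := slice_cont (tame_integral_all k) B0 ag; have [cd sd] := slice_cont (tame_integral_all k) B0 adg.
  apply: (line_integral_derive0 B0 cd sg sd) => t; apply: (deriv_slice_integral (g := g) (dg := dg) t B0 ag adg) => x.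
  by have := D x; rewrite ord1.
rewrite (_ : (fun t : R => _) = fun=> 0) ?Rintegral_cst ?mul0r//.
apply/funext => t; apply: (IH (fun v => g (rcons t v)) _ j); [exact: admissible_slice|exact: admissible_slice|].
by move=> v; apply: deriv_rconsS.
Qed.

End IteratedIntegral.

(** * Compactly supported functions *)
Section CompactSupport.
Variable R : realType.

(** Heine-Cantor: a common radius is found on K by the covering form of
    compactness, and outside K the function vanishes. *)
Lemma compact_admissible k (g : 'rV[R]_k -> R) (K : set 'rV[R]_k) :
  continuous g -> compact K -> (forall x, ~ K x -> g x = 0) ->
  exists2 B, 0 <= B & admissible B g.
Proof.
move=> cg cK g0.
have [B [Br HB]] := compact_bounded cK.
exists (Num.max B 0 + 1); first by rewrite addr_ge0// le_max lexx orbT.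
have BB : B < Num.max B 0 + 1 by rewrite (@le_lt_trans _ _ (Num.max B 0)) ?le_max ?lexx// ltrDl.
split; last first.
  move=> x i xi; apply: g0 => Kx; have : `|x| <= Num.max B 0 + 1 by exact: HB _ BB _ Kx.
  rewrite leNgt => /negP; apply.
  apply: lt_le_trans xi _; rewrite [leRHS]/Num.Def.normr/= mx_normrE.
  by apply/bigmax_geP; right; exists (0, i).
move=> e e0.
pose P (d : R) (x : 'rV[R]_k) := forall y : 'rV[R]_k, (forall i, `|x 0 i - y 0 i| < d) -> `|g x - g y| < e.
(* Points near x inherit half of the radius that works for x. *)
have NC : \forall d \near 0^'+, K `<=` P d.
  move/compact_near_coveringP : cK; apply=> x Kx.
  have e2 : 0 < e / 2 by rewrite divr_gt0.
  have := cg x; move=> /cvgrPdist_lt/(_ _ e2)/nbhs_ballP[d d0 Hd].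
  have d2 : 0 < d / 2 by rewrite divr_gt0.
  near=> x' r => y xy.
  have rd : r < d / 2 by near: r; exact: nbhs_right_lt.
  have xx' : ball x (d / 2) x' by near: x'; exact: nbhsx_ballx.
  have E : g x' - g y = (g x - g y) - (g x - g x') by ring.
  rewrite E (splitr e); apply: le_lt_trans (ler_normB _ _) _; apply: ltrD; apply: Hd; last first.
    by apply: le_ball xx'; rewrite ler_pdivrMr//; lra.
  rewrite [d]splitr; apply: ball_triangle xx' _; split; first exact: d2.
  by move=> i j; rewrite !ord1; apply: lt_trans (xy j) rd.
have [d [d0 Hd]] : exists d, 0 < d /\ K `<=` P d.
  near (0 : R)^'+ => d; exists d; split; first by near: d; exact: nbhs_right_gt.
  by near: d.
exists d => // x y xy.
have [Kx|nKx] := pselect (K x); first exact: Hd.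
have [Ky|nKy] := pselect (K y); last by rewrite !g0 ?subrr ?normr0.
by rewrite distrC; apply: Hd => // i; rewrite distrC.
Unshelve. all: by end_near. Qed.

End CompactSupport.

Section FlatFunctions.
Variable R : realType.
Implicit Types (p : {poly R}) (t : R).

(** For t > 0 the function p(1/t) exp(-1/t).  This family, with p a polynomial, is
    closed under differentiation, which makes smoothness of exp(-1/t) immediate. *)
Definition flat p t : R := if 0 < t then p.[t^-1] * expR (- t^-1) else 0.

(** (p(1/t) exp(-1/t))' = q(1/t) exp(-1/t) with q = X^2 (p - p'). *)
Definition flatD p : {poly R} := 'X^2 * (p - p^`()).

(** From exp u = (exp (u/k))^k >= (u/k)^k with k = N + 1. *)
Lemma expRN_bound N (u : R) : 0 < u -> expR (- u) <= (N%:R + 1) ^+ N.+1 * u ^- N.+1.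
Proof.
move=> u0; have N0 : 0 < N%:R + 1 :> R by rewrite natr1 ltr0n.
rewrite expRN -ler_pV2 ?inE ?unitfE; first last.
- have H : 0 < (expR u)^-1 by rewrite invr_gt0 expR_gt0.
  by rewrite gt_eqF// H.
- have H : 0 < (N%:R + 1) ^+ N.+1 / u ^+ N.+1 by rewrite divr_gt0 ?exprn_gt0.
  by rewrite gt_eqF// H.
rewrite invrK invfM invrK -exprVn -exprMn mulrC.
have -> : expR u = expR (u / (N%:R + 1)) ^+ N.+1.
  by rewrite -expRM_natl -natr1 mulrC divfK ?gt_eqF.
rewrite lerXn2r ?nnegrE ?expR_ge0 ?divr_ge0 ?ltW//.
have H : u / (N%:R + 1) < 1 + u / (N%:R + 1) by rewrite ltrDr.
exact: lt_le_trans H (expR_ge1Dx _).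
Qed.

Lemma poly_bound p : exists2 C, 0 <= C & forall u : R, 1 <= u -> `|p.[u]| <= C * u ^+ size p.
Proof.
exists (\sum_(i < size p) `|p`_i|); first by apply: sumr_ge0.
move=> u u1; have u0 : 0 <= u by lra.
rewrite horner_coef mulr_suml; apply: le_trans (ler_norm_sum _ _ _) _.
apply: ler_sum => i _; rewrite normrM normrX (ger0_norm u0) ler_wpM2l// ler_weXn2l//.
by rewrite ltnW.
Qed.

(** A quadratic bound at 0 is all that is needed for the derivative to vanish
    there. *)
Lemma flat_bound p : exists2 C, 0 <= C & forall t, t <= 1 -> `|flat p t| <= C * t ^+ 2.
Proof.
(* The exponent N.+1 exceeds the degree of p by enough to leave t^2. *)
have [C C0 HC] := poly_bound p; pose N := (size p).+1.
have K0 : 0 <= (N%:R + 1 : R) ^+ N.+1 by rewrite exprn_ge0// addr_ge0.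
exists (C * (N%:R + 1) ^+ N.+1) => [|t t1]; first by rewrite mulr_ge0.
rewrite /flat; case: ifPn => t0; last by rewrite normr0 mulr_ge0 ?sqr_ge0// mulr_ge0.
have u1 : 1 <= t^-1 by rewrite -invr1 lef_pV2 ?posrE.
have u0 : 0 < t^-1 by rewrite invr_gt0.
rewrite normrM [X in _ * X]ger0_norm ?expR_ge0//.
apply: le_trans (ler_pM _ (expR_ge0 _) (HC _ u1) (expRN_bound N u0)) _ => //.
rewrite !exprVn invrK.
have -> : C * t ^- size p * ((N%:R + 1) ^+ N.+1 * t ^+ N.+1) = C * (N%:R + 1) ^+ N.+1 * (t ^- size p * t ^+ N.+1) by ring.
have -> : t ^+ N.+1 = t ^+ size p * t ^+ 2 by rewrite -exprD addn2.
rewrite [X in _ * X]mulrA mulVf ?mul1r//.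
by rewrite expf_neq0// gt_eqF.
Qed.

Lemma flat_derive p t : is_derive t (1 : R) (flat p : R -> R^o) (flat (flatD p) t).
Proof.
have [t0|t0|->] := ltgtP t 0.
- have -> : flat (flatD p) t = 0 by rewrite /flat ltNge ltW.
  apply: (@near_eq_is_derive _ R^o R^o (cst 0)) => //.
  near=> s; rewrite /flat ltNge ltW//=.
  by near: s; exact: lt_nbhsl.
- have -> : flat (flatD p) t = p.[t^-1] * (expR (- t^-1) * - (- t ^- 2)) + expR (- t^-1) * (- t ^- 2 * p^`().[t^-1]).
    rewrite /flat t0 /flatD hornerM hornerXn hornerD hornerN exprVn; ring.
  apply: (@near_eq_is_derive _ R^o R^o (fun s => p.[s^-1] * expR (- s^-1))) => //.
    near=> s; rewrite /flat ifT//; near: s; exact: lt_nbhsr.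
  have tN0 : t != 0 by rewrite gt_eqF.
  have dV : is_derive t (1 : R) (fun s : R => s^-1 : R^o) (- t ^- 2 *: 1).
    exact: is_deriveV.
  have dp : is_derive (t^-1) (1 : R) (horner p) (p^`().[t^-1]).
    by rewrite derivE derive1E; apply: DeriveDef => //; exact: derivable_horner.
  have dpV := is_derive1_comp dp dV.
  have dN : is_derive t (1 : R) (fun s : R => - s^-1 : R^o) (- (- t ^- 2 *: 1)).
    exact: is_deriveN dV.
  have de := @is_derive1_comp R expR (fun s : R => - s^-1) t _ _ (is_derive_expR (- t^-1)) dN.
  have D := is_deriveM dpV de; apply: (@is_derive_eq _ _ _ _ _ _ _ _ D).
  rewrite /GRing.scale /=; ring.
have -> : flat (flatD p) 0 = 0 by rewrite /flat ltxx.
have [C C0 HC] := flat_bound p.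
suff H : h^-1 *: (flat p (h *: 1 + 0) - flat p 0) @[h --> 0^'] --> (0 : R^o).
  by split; [apply/cvg_ex; exists 0|exact: cvg_lim].
have f0 : flat p 0 = 0 by rewrite /flat ltxx.
apply/cvgrPdist_lt => e e0.
near=> h.
have h0 : h != 0 by near: h; exact: nbhs_dnbhs_neq.
have h1 : `|h| < 1 by near: h; exact: dnbhs0_lt.
have he : `|h| < e / (C + 1) by near: h; apply: dnbhs0_lt; rewrite divr_gt0// ltr_wpDl.
rewrite f0 subr0 addr0 [h *: 1]mulr1 sub0r normrN normrM normfV.
have hp : 0 < `|h| by rewrite normr_gt0.
rewrite mulrC ltr_pdivrMr//; apply: le_lt_trans (HC h _) _.
  by rewrite (le_trans (ler_norm h))// ltW.
rewrite -real_normK ?num_real// expr2 mulrA ltr_pM2r//.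
move: he; rewrite ltr_pdivlMr ?ltr_wpDl// => he; apply: le_lt_trans he; rewrite mulrC ler_wpM2l//; lra.
Unshelve. all: by end_near. Qed.

Lemma flat_gt0 t : 0 < t -> 0 < flat 1 t.
Proof. by move=> t0; rewrite /flat t0 hornerC mul1r expR_gt0. Qed.

Lemma flat_eq0 p t : t <= 0 -> flat p t = 0.
Proof. by move=> t0; rewrite /flat ltNge t0. Qed.

End FlatFunctions.

Section Bump.
Variables (R : realType) (n : nat).

Lemma affine_coord i j (c b : R) (x : 'rV[R]_n) :
  differentiable (fun x : 'rV[R]_n => c * x 0 i + b : R^o) x /\
  'D_(delta_mx 0 j) (fun x : 'rV[R]_n => c * x 0 i + b : R^o) x = c * (i == j)%:R.
Proof.
split.
  have dc := @differentiable_coord R 1 n x 0 i.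
  have := @differentiableD _ _ _ (fun x : 'rV[R]_n => c *: (x 0 i : R^o)) (cst b) x (differentiableZ c dc) (differentiable_cst _ _).
  by [].
rewrite /derive; apply: lim_near_cst => //; near=> h.
have h0 : h != 0 by near: h; exact: nbhs_dnbhs_neq.
rewrite /= !mxE eqxx /= /GRing.scale /=; case: (i == j); field => //.
Unshelve. all: by end_near. Qed.

Lemma flatZ (k : R) (p : {poly R}) t : flat (k *: p) t = k * flat p t.
Proof. by rewrite /flat; case: ifP => _; rewrite ?mulr0// hornerZ mulrA. Qed.

Lemma flat_coord_derive (p : {poly R}) i j (c b : R) (x : 'rV[R]_n) :
  differentiable (fun x : 'rV[R]_n => flat p (c * x 0 i + b) : R^o) x /\
  'D_(delta_mx 0 j) (fun x : 'rV[R]_n => flat p (c * x 0 i + b) : R^o) x =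
    flat ((c * (i == j)%:R) *: flatD p) (c * x 0 i + b).
Proof.
have [dL DL] := affine_coord i j c b x.
have D := flat_derive p (c * x 0 i + b).
have dF : differentiable (flat p : R -> R^o) (c * x 0 i + b).
  by apply/derivable1_diffP; exact: (@ex_derive _ _ _ _ _ _ _ D).
have dC := differentiable_comp dL dF.
split; first exact: dC.
rewrite (deriveE (delta_mx 0 j : 'rV[R]_n) dC) (diff_comp dL dF) /= -(deriveE (delta_mx 0 j : 'rV[R]_n) dL) DL.
have -> : c * (i == j)%:R = (c * (i == j)%:R) *: (1 : R) by rewrite [RHS]mulr1.
rewrite [LHS]linearZ /= -(deriveE (1 : R) dF).
by rewrite [X in X *: flatD p]mulr1 flatZ derive_val.
Qed.

Lemma flat_coord_smooth V (p : {poly R}) i (c b : R) :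
  Csmooth V (fun x : 'rV[R]_n => flat p (c * x 0 i + b)).
Proof.
move=> s x _.
have [q ->] : exists q, partials s (fun x : 'rV[R]_n => flat p (c * x 0 i + b)) =
    (fun x : 'rV[R]_n => flat q (c * x 0 i + b)).
  elim: s => [|j s [q IH]]; first by exists p.
  exists ((c * (i == j)%:R) *: flatD q); apply/funext => y.
  rewrite /= IH; exact: (flat_coord_derive q i j c b y).2.
exact: (flat_coord_derive q i i c b x).1.
Qed.

(** Positive exactly in the open box of radius r around a.  The arguments are
    written in the form c * x_i + b of the previous lemmas. *)
Definition bump_fun (a : 'rV[R]_n) (r : R) (x : 'rV[R]_n) : R^o :=
  \prod_i (flat 1 (1 * x 0 i + (r - a 0 i)) * flat 1 (-1 * x 0 i + (r + a 0 i))).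

Lemma bump_gt0 a r : 0 < r -> 0 < bump_fun a r a.
Proof. by move=> r0; apply: prodr_gt0 => i _; rewrite mulr_gt0 ?flat_gt0//; lra. Qed.

Lemma bump_smooth V a r : open V -> Csmooth V (bump_fun a r).
Proof.
move=> oV; rewrite /bump_fun.
have H (s : seq 'I_n) : Csmooth V (fun x => \prod_(i <- s) (flat 1 (1 * x 0 i + (r - a 0 i)) * flat 1 (-1 * x 0 i + (r + a 0 i)))).
  elim: s => [|i s IH].
    by apply: Csmooth_local (Csmooth_cst (1 : R)) => // y _; rewrite big_nil.
  apply: Csmooth_local (CsmoothM oV (CsmoothM oV (@flat_coord_smooth V 1 i 1 (r - a 0 i)) (@flat_coord_smooth V 1 i (-1) (r + a 0 i))) IH) => // y _.
  by rewrite big_cons.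
exact: H.
Qed.

Definition box (a : 'rV[R]_n) (r : R) : set 'rV[R]_n := [set x | forall i, `|x 0 i - a 0 i| <= r].

Lemma bump_eq0 a r x : ~ box a r x -> bump_fun a r x = 0.
Proof.
move=> H; have [i] : exists i, ~~ (`|x 0 i - a 0 i| <= r).
  apply: contrapT => K; apply: H => i; apply: contrapT => /negP xi; apply: K; by exists i.
rewrite ler_norml negb_and -!ltNge => /orP xi; rewrite /bump_fun (bigD1 i)//=.
case: xi => xi; first by rewrite (flat_eq0 _ (t := 1 * _ + _)) ?mul0r//; lra.
by rewrite (flat_eq0 _ (t := -1 * _ + _)) ?mulr0 ?mul0r//; lra.
Qed.

Lemma box_compact a r : compact (box a r).
Proof.
have := @rV_compact R n (fun i => `[a 0 i - r, a 0 i + r]%classic) (fun i => @segment_compact R _ _).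
congr compact; apply/seteqP; split => x /= H i; have := H i; rewrite in_itv/= ler_norml; lra.
Qed.

Lemma box_sub (V : set 'rV[R]_n) a : open V -> V a -> exists2 r, 0 < r & box a r `<=` V.
Proof.
move=> oV Va; have /nbhs_ballP[d d0 Hd] : nbhs a V by exact: open_nbhs_nbhs.
have d2 : 0 < d / 2 by rewrite divr_gt0.
exists (d / 2) => // x xb; apply: Hd; split => // i j; rewrite !ord1 -ball_normE/= distrC.
by apply: le_lt_trans (xb j) _; lra.
Qed.

End Bump.

(** * Integration by parts and the adjoint of a derivation *)
Section TestFunctions.
Variables (R : realType) (n m : nat).
Local Notation SF := (superfun R n m).
Local Notation G := (grassmann R m).
Implicit Types (V K : set 'rV[R]_n) (F H : SF).

Lemma compact_closed_rV K : compact K -> closed K.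
Proof. by apply: compact_closed; exact: norm_hausdorff. Qed.

Lemma open_off K : compact K -> open (~` K).
Proof. by move=> cK; apply: closed_openC; exact: compact_closed_rV. Qed.

(** Extension by zero: off its compact support, which is closed, the function is
    locally zero, whatever its values outside V would have been. *)
Lemma test_extend V F : test_superfun V F -> test_superfun setT F.
Proof.
move=> [sF [K [cK KV F0]]]; split; last by exists K.
move=> S s x _; have [Kx|nKx] := pselect (K x); first by apply: sF; exact: KV.
have H : smooth (~` K) F.
  by apply: (smooth_local (F := fun=> 0) (open_off cK)) => [y nKy|]; [rewrite F0|exact: smooth0].
exact: H.
Qed.

Lemma test_mulr V F H : open V -> test_superfun V F -> smooth V H ->
  test_superfun V (fun x => F x * H x).
Proof.
move=> oV [sF [K [cK KV F0]]] sH; split; first exact: smoothM.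
by exists K; split=> // x nKx; rewrite F0// mul0r.
Qed.

Lemma test_mull V F H : open V -> test_superfun V F -> smooth V H ->
  test_superfun V (fun x => H x * F x).
Proof.
move=> oV [sF [K [cK KV F0]]] sH; split; first exact: smoothM.
by exists K; split=> // x nKx; rewrite F0// mulr0.
Qed.

Lemma test_sderiv V a F : open V -> test_superfun V F -> test_superfun V (sderiv a F).
Proof.
move=> oV [sF [K [cK KV F0]]]; split; first exact: smooth_sderiv.
exists K; split=> // x nKx.
rewrite (sderiv_local a (open_off cK) nKx (H := fun=> 0)); last exact: F0.
have -> : (fun=> 0 : G) = (fun _ : 'rV[R]_n => 0%:A : G) by apply/funext => y; rewrite scale0r.
by rewrite sderiv_cst.
Qed.

Lemma test_off V F x : test_superfun V F -> ~ V x -> F x = 0.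
Proof. by move=> [_ [K [_ KV F0]]] nVx; apply: F0 => /KV. Qed.

Lemma test_sum V (I : Type) (r : seq I) (F : I -> SF) : open V ->
  (forall i, test_superfun V (F i)) -> test_superfun V (fun x => \sum_(i <- r) F i x).
Proof.
move=> oV tF; split; first by apply: smooth_sum => // i _; have [] := tF i.
elim: r => [|i r [K [cK KV F0]]].
  by exists set0; split=> [|//|x _]; [exact: compact0|rewrite big_nil].
have [_ [L [cL LV L0]]] := tF i; exists (K `|` L); split.
- exact: compactU.
- by rewrite subUset.
by move=> x /not_orP[nK nL]; rewrite big_cons L0// F0// addr0.
Qed.

Lemma testZ V c F : open V -> test_superfun V F -> test_superfun V (fun x => c *: F x).
Proof.
move=> oV [sF [K [cK KV F0]]]; split; first exact: smoothZ.
by exists K; split=> // x nKx; rewrite F0// scaler0.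
Qed.

Lemma admissible_le k B B' (g : 'rV[R]_k -> R) : B <= B' -> admissible B g -> admissible B' g.
Proof. by move=> BB [ug sg]; split=> // x i xi; apply: (sg x i); exact: le_lt_trans xi. Qed.

Lemma test_admissible F S : test_superfun setT F ->
  exists2 B, 0 <= B & admissible B (fun x => F x S).
Proof.
move=> [sF [K [cK _ F0]]]; apply: (compact_admissible _ cK).
  by move=> x; apply: differentiable_continuous; exact: (sF S [::]).
by move=> x nKx; rewrite F0// ffunE.
Qed.

Lemma berezinD F H : test_superfun setT F -> test_superfun setT H ->
  berezin_integral (fun x => F x + H x) = berezin_integral F + berezin_integral H.
Proof.
move=> tF tH; have [B B0 aF] := test_admissible [set: 'I_m]%SET tF; have [C C0 aH] := test_admissible [set: 'I_m]%SET tH.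
rewrite /berezin_integral -(Rn_integralD (B := Num.max B C)).
- by apply: eq_Rn_integral => x; rewrite ffunE.
- by apply: admissible_le aF; rewrite le_max lexx.
by apply: admissible_le aH; rewrite le_max lexx orbT.
Qed.

Lemma berezinZ c F : test_superfun setT F ->
  berezin_integral (fun x => c *: F x) = c * berezin_integral F.
Proof.
move=> tF; have [B B0 aF] := test_admissible [set: 'I_m]%SET tF.
rewrite /berezin_integral -(Rn_integralZ _ aF).
by apply: eq_Rn_integral => x; rewrite ffunE.
Qed.

Lemma berezin0 : berezin_integral ((fun=> 0) : SF) = 0.
Proof. by rewrite /berezin_integral -[RHS](Rn_integral0 R n); apply: eq_Rn_integral => x; rewrite ffunE. Qed.

Lemma berezin_sum (I : Type) (r : seq I) (F : I -> SF) : (forall i, test_superfun setT (F i)) ->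
  berezin_integral (fun x => \sum_(i <- r) F i x) = \sum_(i <- r) berezin_integral (F i).
Proof.
move=> tF; elim: r => [|i r IH].
  by rewrite big_nil -[RHS]berezin0; congr berezin_integral; apply/funext => x; rewrite big_nil.
rewrite big_cons -IH -berezinD//; last by apply: test_sum => //; exact: openT.
by congr berezin_integral; apply/funext => x; rewrite big_cons.
Qed.

(** For an even coordinate this is the vanishing of the integral of a derivative;
    an odd derivative has no component of top degree. *)
Lemma berezin_sderiv a F : test_superfun setT F -> berezin_integral (sderiv a F) = 0.
Proof.
move=> tF; elim/ord_split_ind: a => [i|j]; last first.
  rewrite -[RHS](Rn_integral0 R n); apply: eq_Rn_integral => x.
  by rewrite sderiv_odd gderivE inE.
have [B B0 aF] := test_admissible [set: 'I_m]%SET tF.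
have [C C0 aD] := test_admissible [set: 'I_m]%SET (test_sderiv (lshift m i) openT tF).
have BC : B <= Num.max B C by rewrite le_max lexx.
have CC : C <= Num.max B C by rewrite le_max lexx orbT.
apply: (Rn_integral_derive0 (le_trans B0 BC) (admissible_le BC aF) (admissible_le CC aD) (i := i)) => x.
have dF : differentiable (fun y => F y [set: 'I_m]%SET : R^o) x by exact: (tF.1 _ [::]).
by rewrite sderiv_even; apply: DeriveDef => //; exact: diff_derivable.
Qed.

End TestFunctions.

Section Adjoint.
Variables (R : realType) (n m : nat) (M : supermanifold R n m).
Local Notation SF := (superfun R n m).
Local Notation G := (grassmann R m).

(** The signed derivative of X f h, for one coordinate: the term with the
    derivative of h and the term with the derivative of X are those of the
    adjoint, once f is moved to the left. *)
Lemma leibniz_terms (a p q : bool) (X dX f df h dh : G) :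
  gparity (a (+) p) X -> gparity p dX -> gparity q f ->
  X * df * h + (-1) ^+ (p && q) *: (f * (X * dh + (-1) ^+ (a && ~~ p) *: (dX * h))) =
  (-1) ^+ (a && ~~ p) *: (dX * (f * h) +
    (-1) ^+ (a && (a (+) p)) *: X * (df * h + (-1) ^+ (a && q) *: f * dh)).
Proof.
move=> pX pdX pf.
have fX := gmulC pf pX; have fdX := gmulC pf pdX.
case: a pX fX => pX; case: p pdX pX fdX => pdX pX; case: q pf => pf /=;
  rewrite ?expr0 ?expr1 ?scale1r ?scaleN1r => fdX fX;
  rewrite !(mulrDr, mulrN, mulNr, mulrA, fX, fdX, opprD, opprK);
  by rewrite [RHS]addrC addrA.
Qed.

(** The terms without derivatives match because the weights add up to 1; here A
    and B stand for X^a d_a f and X^a d_a h, and C for the coordinate divergence. *)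
Lemma weight_terms (E : algType R) (lam w w' s : R) (A B C X f h : E) :
  X * f = s *: (f * X) -> s * s = 1 -> w + lam + w' = 1 ->
  (A + w *: (X * f)) * h =
  s *: (f * - (B + w' *: (X * h) + (C + (lam - 1) *: X) * h)) + (A * h + s *: (f * (B + C * h))).
Proof.
move=> Xf ss ww.
have -> : f * - (B + w' *: (X * h) + (C + (lam - 1) *: X) * h) =
  - (f * (B + C * h)) + w *: (f * X * h).
  have -> : w = - (w' + (lam - 1)) by lra.
  rewrite -[f * X * h]mulrA mulrN scaleNr -opprD [_ *: (f * _)]scalerAr -mulrDr; congr (- (f * _)).
  rewrite mulrDl -scalerAl [(w' + _) *: _]scalerDl; exact: addrACA.
rewrite mulrDl Xf scalerDr scalerN scalerA.
rewrite scalerA mulrC -scalerAl.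
by rewrite [X in _ = _ + X]addrC addrACA addNr add0r addrC.
Qed.

Implicit Types (c : chart M) (X : vfield M).

(** The adjoint X* = - X - div X. *)
Definition formal_adj lam p X c (w : R) (chi : SF) : SF :=
  fun x => - (action X c w chi x + vfield_div lam p X c x * chi x).

Lemma action_smooth lam p X c w psi : is_derivation lam p X -> smooth (image_of c) psi ->
  smooth (image_of c) (action X c w psi).
Proof.
move=> [[sX _ _] sW _ _] sp; have oV := @chart_open _ _ _ M c.
apply: smoothD => //.
  by apply: smooth_sum => // a _; apply: smoothM => //; exact: smooth_sderiv.
by apply: smoothZ => //; exact: smoothM.
Qed.

Lemma vfield_div_smooth lam p X c : is_derivation lam p X -> smooth (image_of c) (vfield_div lam p X c).
Proof. by move=> /vfield_div_density[sD _ _]; exact: sD. Qed.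

Lemma formal_adj_smooth lam p X c w chi : is_derivation lam p X -> smooth (image_of c) chi ->
  smooth (image_of c) (formal_adj lam p X c w chi).
Proof.
move=> dX sc; have oV := @chart_open _ _ _ M c.
have H := smoothZ (-1) oV (smoothD oV (action_smooth w dX sc) (smoothM oV (@vfield_div_smooth lam p X c dX) sc)).
by apply: (smooth_local oV _ H) => x _; rewrite scaleN1r.
Qed.

(** The two integrands of the adjunction differ by a sum of total derivatives.
    Outside the chart all terms vanish because the test functions do. *)
Lemma adjoint_integrand lam p X c w w' q psi chi x : is_derivation lam p X ->
  test_superfun (image_of c) psi -> test_superfun (image_of c) chi ->
  (forall x, gparity q (psi x)) -> w + lam + w' = 1 ->
  action X c w psi x * chi x =
  (-1) ^+ (p && q) *: (psi x * formal_adj lam p X c w' chi x) +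
  \sum_a (-1) ^+ (par a && ~~ p) *:
     sderiv a (fun y => vcoef X c a y * (psi y * chi y)) x.
Proof.
move=> dX tp tc pp ww.
have oV := @chart_open _ _ _ M c.
have [[sX pX _] sW pW _] := dX.
have [Vx|nVx] := pselect (image_of c x); last first.
  rewrite (test_off tc nVx) (test_off tp nVx) mulr0 mul0r scaler0 add0r big1// => a _.
  have tP : test_superfun (image_of c) (fun y => vcoef X c a y * (psi y * chi y)).
    by apply: (test_mull oV (test_mulr oV tp tc.1)).
  by rewrite (test_off (test_sderiv a oV tP) nVx) scaler0.
have D a : sderiv a (fun y => vcoef X c a y * (psi y * chi y)) x =
   sderiv a (vcoef X c a) x * (psi x * chi x) +
   (-1) ^+ (par a && (par a (+) p)) *: vcoef X c a x *
     (sderiv a psi x * chi x + (-1) ^+ (par a && q) *: psi x * sderiv a chi x).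
  have gX := smooth_gdiff (sX c a) Vx; have gp := smooth_gdiff tp.1 Vx; have gc := smooth_gdiff tc.1 Vx.
  have gpc := smooth_gdiff (smoothM oV tp.1 tc.1) Vx.
  rewrite (sderivM a gX gpc) (sderivM a gp gc).
  by rewrite (gtwist_parity (par a) (pX c a x Vx)) (gtwist_parity (par a) (pp x)).
have L a : (-1) ^+ (par a && ~~ p) *: sderiv a (fun y => vcoef X c a y * (psi y * chi y)) x =
  vcoef X c a x * sderiv a psi x * chi x + (-1) ^+ (p && q) *:
   (psi x * (vcoef X c a x * sderiv a chi x + (-1) ^+ (par a && ~~ p) *: (sderiv a (vcoef X c a) x * chi x))).
  rewrite D -leibniz_terms//; first exact: pX.
  have := @gparity_sderiv R n m (image_of c) a (vcoef X c a) x (par a (+) p) oV Vx.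
  by rewrite addKb; apply => y; exact: pX.
rewrite (eq_bigr _ (fun a _ => L a)) big_split /= -scaler_sumr -mulr_sumr big_split /=.
have -> : \sum_a vcoef X c a x * sderiv a psi x * chi x =
  (\sum_a vcoef X c a x * sderiv a psi x) * chi x by rewrite mulr_suml.
have -> : \sum_a (-1) ^+ (par a && ~~ p) *: (sderiv a (vcoef X c a) x * chi x) =
  coord_div p (vcoef X) c x * chi x.
  by rewrite /coord_div mulr_suml; apply: eq_bigr => a _; rewrite scalerAl.
rewrite /formal_adj /action /vfield_div.
apply: weight_terms ww; last by rewrite -expr2 sqrr_sign.
exact: (gmulC (pW c x Vx) (pp x)).
Qed.

Lemma vfield_div_adjoint lam p X c : is_derivation lam p X ->
  formal_adjoint lam p c (action X c) (formal_adj lam p X c).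
Proof.
move=> dX w w' q psi chi tp tc pp; have oV := @chart_open _ _ _ M c.
have [[sX pX _] sW pW _] := dX.
rewrite /scalar_product addrA; have -> : w + w' + lam = w + lam + w' by ring.
case: eqP => [ww|_]; last by rewrite mulr0.
have tL : test_superfun setT (fun x => psi x * formal_adj lam p X c w' chi x).
  by apply: (test_extend (test_mulr oV tp (formal_adj_smooth w' dX tc.1))).
have tP a : test_superfun (image_of c) (fun y => vcoef X c a y * (psi y * chi y)).
  by apply: (test_mull oV (test_mulr oV tp tc.1)).
have tD a : test_superfun setT (fun x => (-1) ^+ (par a && ~~ p) *:
     sderiv a (fun y => vcoef X c a y * (psi y * chi y)) x).
  by apply: testZ (test_extend (test_sderiv a oV (tP a))); exact: openT.
transitivity (berezin_integral (fun x =>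
  (-1) ^+ (p && q) *: (psi x * formal_adj lam p X c w' chi x) +
  \sum_a (-1) ^+ (par a && ~~ p) *:
     sderiv a (fun y => vcoef X c a y * (psi y * chi y)) x)).
  by congr berezin_integral; apply/funext => x; exact: adjoint_integrand.
rewrite berezinD; first last.
- exact: (test_sum _ openT tD).
- exact: (testZ _ openT tL).
rewrite (berezinZ _ tL) (berezin_sum _ tD) big1 ?addr0// => a _.
by rewrite (berezinZ _ (test_extend (test_sderiv a oV (tP a)))) (berezin_sderiv _ (test_extend (tP a))) mulr0.
Qed.

Lemma vfield_div_divergence lam p X : is_derivation lam p X -> is_divergence lam p X (vfield_div lam p X).
Proof.
move=> dX; split; first exact: vfield_div_density.
move=> c; exists (formal_adj lam p X c); first exact: vfield_div_adjoint.
by move=> w chi x _ _; rewrite /formal_adj opprD opprK addKr.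
Qed.

End Adjoint.

(** * Uniqueness of the divergence and the decomposition *)
Section Fundamental.
Variables (R : realType) (n m : nat).
Local Notation SF := (superfun R n m).
Local Notation G := (grassmann R m).

Definition gmono (S : {set 'I_m}) : G := [ffun A => (A == S)%:R].

Lemma gmonoE S A : gmono S A = (A == S)%:R :> R.
Proof. by rewrite ffunE. Qed.

(** Multiplication by the complementary monomial moves the component S to the top
    degree, where the Berezin integral sees it. *)
Lemma gmono_mul_top S (b : G) :
  (gmono (~: S)%SET * b) [set: 'I_m]%SET =
  (-1) ^+ ginversions (~: S)%SET ([set: 'I_m] :\: ~: S)%SET * b S.
Proof.
rewrite gmulE (bigD1 (~: S)%SET) ?finset.subsetT//= big1 => [|A /andP[_ AS]].
  by rewrite addr0 gmonoE eqxx mul1r finset.setTD finset.setCK.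
by rewrite gmonoE (negbTE AS) mul0r mulr0.
Qed.

Lemma test_scaled V (g : 'rV[R]_n -> R) (K : set 'rV[R]_n) (b : G) : open V ->
  Csmooth V g -> compact K -> K `<=` V -> (forall x, ~ K x -> g x = 0) ->
  test_superfun V ((fun x => g x *: b) : SF).
Proof.
move=> oV sg cK KV g0; split; last by exists K; split=> // x nKx; rewrite g0// scale0r.
move=> S; apply: (Csmooth_local oV _ (CsmoothZ (b S) oV sg)) => y _.
by rewrite [RHS]ffunE mulrC.
Qed.

(** To test the component T of h at x0, take for psi a bump times the monomial
    complementary to T, and for chi the scalar phi h_T: the top component of the
    integrand is then plus or minus (phi h_T)^2, which has one sign and does not
    vanish at x0 if h_T x0 <> 0. *)
Lemma berezin_fundamental V (h : SF) : open V -> smooth V h ->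
  (forall q psi chi, test_superfun V psi -> test_superfun V chi -> (forall x, gparity q (psi x)) ->
     berezin_integral (fun x => psi x * (h x * chi x)) = 0) ->
  forall x, V x -> h x = 0.
Proof.
move=> oV sh H x0 Vx0; apply/ffunP => T; rewrite [RHS]ffunE; apply: contrapT => /eqP hT.
have [r r0 rV] := box_sub oV Vx0.
pose phi := @bump_fun R n x0 r.
have sphi : Csmooth V phi by exact: bump_smooth.
have cB := @box_compact R n x0 r.
have phi0 x : ~ box x0 r x -> phi x = 0 by exact: bump_eq0.
pose psi : SF := fun x => phi x *: gmono (~: T)%SET.
pose g x := phi x * h x T.
have sg : Csmooth V g by exact: CsmoothM oV sphi (sh T).
have g0 x : ~ box x0 r x -> g x = 0 by move=> nx; rewrite /g phi0// mul0r.
(* The component h_T as a factor of chi makes the integrand a square. *)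
pose chi : SF := fun x => (g x)%:A.
have tpsi : test_superfun V psi by exact: (test_scaled _ oV sphi cB rV phi0).
have tchi : test_superfun V chi by exact: (test_scaled _ oV sg cB rV g0).
have ppsi x : gparity (odd #|(~: T)%SET|) (psi x).
  by move=> A AT; rewrite ffunE gmonoE; case: (eqVneq A (~: T)%SET) AT => [->|_ _]; rewrite ?eqxx// [LHS]mulr0.
have := H _ _ _ tpsi tchi ppsi; set s := (-1) ^+ ginversions (~: T)%SET ([set: 'I_m] :\: ~: T)%SET : R.
have E x : (psi x * (h x * chi x)) [set: 'I_m]%SET = s * (g x * g x).
  rewrite /psi /chi mulr_algr -scalerAl -scalerAr.
  have ZE (k : R) (u : G) A : (k *: u) A = k * u A by rewrite ffunE.
  rewrite 2!ZE gmono_mul_top /g /s; ring.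
have tcc : test_superfun setT (fun x => chi x * chi x).
  by apply: test_extend (test_mulr oV tchi tchi.1).
have [B B0 aB] := test_admissible finset.set0 tcc.
have {}aB : admissible B (fun x => g x * g x).
  have <- : (fun x => (chi x * chi x) finset.set0) = (fun x => g x * g x) => //.
  by apply/funext => x; rewrite /chi mulr_algr !ffunE eqxx /GRing.scale/= mulr1.
rewrite /berezin_integral (eq_Rn_integral E) (Rn_integralZ _ aB) => /eqP.
rewrite mulf_eq0 signr_eq0 /= => /eqP I0.
have := Rn_integral_gt0 (x0 := x0) B0 aB (fun x => sqr_ge0 (g x)).
rewrite I0 ltxx => K; suff : false by []; apply: K.
have gx0 : g x0 != 0 by rewrite mulf_neq0// gt_eqF// bump_gt0.
by rewrite -expr2 exprn_even_gt0.
Qed.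

End Fundamental.

Section Uniqueness.
Variables (R : realType) (n m : nat) (M : supermanifold R n m) (lam : R) (p : bool).
Local Notation SF := (superfun R n m).
Implicit Types (X Y : vfield M) (D : chart M -> SF).

Lemma subr_cancel (U : zmodType) (u v z : U) : - u - z = - (z + v) - (u - v).
Proof. by rewrite opprB opprD addrA subrK addrC. Qed.

(** Two formal adjoints have the same pairings, and the divergences are their
    differences with X; the berezin_fundamental lemma applies to the difference of the
    densities. *)
Lemma divergence_unique X D : is_derivation lam p X -> is_divergence lam p X D ->
  forall c x, image_of c x -> D c x = vfield_div lam p X c x.
Proof.
move=> dX [[sD _ _] HD] c x Vx; have oV := @chart_open _ _ _ M c.
have [Xs aX eX] := HD c.
apply/eqP; rewrite -subr_eq0; apply/eqP.
have sd := @vfield_div_smooth _ _ _ M lam p X c dX.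
pose h : SF := fun x => D c x - vfield_div lam p X c x.
have sh : smooth (image_of c) h.
  have := smoothD oV (sD c) (smoothZ (-1) oV sd); apply: (smooth_local oV) => y _.
  by rewrite scaleN1r.
apply: (@berezin_fundamental R n m (image_of c) h oV sh _ x Vx) => q psi chi tp tc pp.
(* With these weights the pairings are integrals rather than 0 by definition. *)
have A1 := aX (1 - lam) 0 q psi chi tp tc pp.
have A2 := @vfield_div_adjoint _ _ _ M lam p X c dX (1 - lam) 0 _ _ _ tp tc pp.
move: A1; rewrite A2 /scalar_product.
have -> : 1 - lam + (0 + lam) == 1 by apply/eqP; ring.
move=> /(mulfI _); rewrite signr_eq0 => /(_ isT) A.
have oI := openT.
have E y : psi y * Xs 0 chi y = psi y * formal_adj lam p X c 0 chi y + -1 *: (psi y * (h y * chi y)).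
  have [Vy|nVy] := pselect (image_of c y); last by rewrite (test_off tp nVy) !mul0r scaler0 addr0.
  have -> : Xs 0 chi y = - (D c y * chi y) - action X c 0 chi y.
    by rewrite (eX 0 chi y tc Vy) opprK addrAC subrr add0r.
  rewrite scaleN1r -[- (psi y * _)]mulrN -mulrDr /formal_adj /h; congr (_ * _).
  rewrite mulrBl; exact: subr_cancel.
have t1 : test_superfun setT (fun y => psi y * formal_adj lam p X c 0 chi y).
  by apply: (test_extend (test_mulr oV tp (formal_adj_smooth 0 dX tc.1))).
have t2 : test_superfun setT (fun y => psi y * (h y * chi y)).
  by apply: (test_extend (test_mulr oV tp (smoothM oV sh tc.1))).
have : berezin_integral (fun y => psi y * Xs 0 chi y) =
  berezin_integral (fun y => psi y * formal_adj lam p X c 0 chi y + -1 *: (psi y * (h y * chi y))).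
  by congr berezin_integral; apply/funext.
rewrite -A (berezinD t1 (testZ (-1) openT t2)) (berezinZ _ t2) mulN1r => J; lra.
Qed.

Lemma eq_coord_div (V W : chart M -> 'I_(n + m) -> SF) :
  (forall c a x, image_of c x -> V c a x = W c a x) ->
  forall c x, image_of c x -> coord_div p V c x = coord_div p W c x.
Proof.
move=> VW c x Vx; apply: eq_bigr => a _; congr (_ *: _).
by apply: (sderiv_local a (@chart_open _ _ _ M c) Vx) => y Vy; exact: VW.
Qed.

Hypothesis lam_neq1 : lam != 1.

(** Solve div X = 0 for the weight component, which is possible as lam <> 1. *)
Lemma divergence_free_form X : is_derivation lam p X -> divergence_free lam p X ->
  vfield_eq X (canonical_lift lam p (vcoef X)).
Proof.
move=> dX fX c x Vx; split=> //=; have := divergence_unique dX fX Vx.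
rewrite /vfield_div => /esym/eqP; rewrite addrC addr_eq0 => /eqP E.
by rewrite scaleNr -scalerN -E scalerA mulVf ?scale1r// lam1_neq0.
Qed.

Lemma canonical_lift_free V : @is_vector_density _ _ _ M lam p V ->
  divergence_free lam p (canonical_lift lam p V).
Proof.
move=> vV; have := vfield_div_divergence (canonical_lift_derivation lam_neq1 vV).
rewrite /divergence_free; congr is_divergence.
by apply/funext => c; apply/funext => x; exact: vfield_div_lift.
Qed.

(** The weight components add up because the coordinate divergence cancels. *)
Lemma lift_decomposition X D : (forall c x, image_of c x -> D c x = vfield_div lam p X c x) ->
  vfield_eq X (vfield_add (canonical_lift lam p (vcoef X))
    (weight_field (fun c x => (lam - 1)^-1 *: D c x))).
Proof.
move=> HD c x Vx; split=> [a|] /=; first by rewrite addr0.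
rewrite HD// /vfield_div scalerDr scalerA mulVf ?lam1_neq0// scale1r scaleNr.
by rewrite addKr.
Qed.

(** Both weight components are given by the same local expression in the
    components of the vector density. *)
Lemma lift_unique X Y : is_derivation lam p X -> is_derivation lam p Y ->
  divergence_free lam p X -> divergence_free lam p Y ->
  (forall c a x, image_of c x -> vcoef X c a x = vcoef Y c a x) -> vfield_eq X Y.
Proof.
move=> dX dY fX fY XY c x Vx; split=> [a|]; first exact: XY.
have [_ ->] := divergence_free_form dX fX Vx; have [_ ->] := divergence_free_form dY fY Vx.
by rewrite /= (eq_coord_div XY).
Qed.

End Uniqueness.
Theorem theorem2p1 (R : realType) (n m : nat) (M : supermanifold R n m)
    (lam : R) (p : bool) (lam_neq1 : lam != 1) :
  [/\
    (* unique decomposition *)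
    forall X : vfield M, is_derivation lam p X ->
      exists (Y : vfield M) (f : chart M -> superfun R n m),
        [/\ is_derivation lam p Y, divergence_free lam p Y,
            is_derivation lam p (weight_field f),
            vfield_eq X (vfield_add Y (weight_field f)) &
            forall (Y' : vfield M) (f' : chart M -> superfun R n m),
              is_derivation lam p Y' -> divergence_free lam p Y' ->
              is_derivation lam p (weight_field f') ->
              vfield_eq X (vfield_add Y' (weight_field f')) ->
              vfield_eq Y' Y /\ vfield_eq (weight_field f') (weight_field f)],
    (* form of the divergence-free derivations *)
    forall X : vfield M, is_derivation lam p X -> divergence_free lam p X ->
      vfield_eq X (canonical_lift lam p (vcoef X)),
    (* a divergence-free derivation is uniquely defined by its vector density *)
    forall V : chart M -> 'I_(n + m) -> superfun R n m,
      is_vector_density lam p V ->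
      exists Y : vfield M,
        [/\ is_derivation lam p Y, divergence_free lam p Y,
            forall c a x, image_of c x -> vcoef Y c a x = V c a x &
            forall Y' : vfield M,
              is_derivation lam p Y' -> divergence_free lam p Y' ->
              (forall c a x, image_of c x -> vcoef Y' c a x = V c a x) ->
              vfield_eq Y' Y] &
    (* explicit decomposition *)
    forall X : vfield M, is_derivation lam p X ->
      (exists D, is_divergence lam p X D) /\
      forall D, is_divergence lam p X D ->
        [/\ is_derivation lam p (canonical_lift lam p (vcoef X)),
            divergence_free lam p (canonical_lift lam p (vcoef X)),
            is_derivation lam p (weight_field (fun c x => (lam - 1)^-1 *: D c x)) &
            vfield_eq X (vfield_add (canonical_lift lam p (vcoef X))
              (weight_field (fun c x => (lam - 1)^-1 *: D c x)))]
  ].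
Proof.
have dens (X : vfield M) : is_derivation lam p X -> is_vector_density lam p (vcoef X) by case.
split.
- move=> X dX.
  have dY := canonical_lift_derivation lam_neq1 (dens X dX).
  have fY := canonical_lift_free lam_neq1 (dens X dX).
  exists (canonical_lift lam p (vcoef X)), (fun c x => (lam - 1)^-1 *: vfield_div lam p X c x).
  have XE := lift_decomposition (D := vfield_div lam p X) lam_neq1 (fun c x _ => erefl).
  split=> //.
    by apply: weight_field_derivation; exact: vfield_div_density.
  move=> Y' f' dY' fY' _ XE'.
  have Y'Y : vfield_eq Y' (canonical_lift lam p (vcoef X)).
    apply: (lift_unique lam_neq1 dY' dY fY' fY) => c a x Vx.
    by have [/(_ a) /= -> _] := XE' c x Vx; rewrite addr0.
  split=> // c x Vx; split=> //=.
  have [_ /= E1] := XE c x Vx; have [_ /= E2] := XE' c x Vx; have [_ /= E3] := Y'Y c x Vx.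
  by move: E2; rewrite E1 E3 => /addrI.
- by move=> X; exact: divergence_free_form.
- move=> V vV; exists (canonical_lift lam p V); split=> //.
  + exact: canonical_lift_derivation.
  + exact: canonical_lift_free.
  move=> Y' dY' fY' VE; apply: (lift_unique lam_neq1 dY' _ fY') => //.
    exact: canonical_lift_derivation.
  exact: canonical_lift_free.
move=> X dX; split; first by exists (vfield_div lam p X); exact: vfield_div_divergence.
move=> D HD; split.
- exact: (canonical_lift_derivation lam_neq1 (dens X dX)).
- exact: (canonical_lift_free lam_neq1 (dens X dX)).
- by apply: weight_field_derivation; case: HD.
by apply: lift_decomposition => // c x; exact: divergence_unique.
Qed.
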